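(* Let $S$ be a torsion-free monoid with quotient group $G$ such that $G$ satisfies the ascending chain condition on cyclic subgroups, and let $D$ be an integral domain with quotient field $K$. Then the monoid algebra $D[S]$ is a weakly Krull domain if and only if $S$ is weakly Krull and $K$-UMT, and $D$ is weakly Krull and $G$-UMT.
   Context: A monoid is a cancellative commutative semigroup with identity, written additively; groups are regarded as monoids. A monoid is torsion-free if $nx=ny$ with $n\ge 1$ implies $x=y$ (equivalently, its quotient group is torsion-free). For a domain $D$ and a torsion-free monoid $S$, $D[S]$ denotes the monoid algebra, whose elements are finite sums $\sum d_iX^{s_i}$ ($d_i\in D$, $s_i\in S$); it is a domain. For $P\subseteq D$, $P[S]\subseteq D[S]$ is the set of finite sums $\sum p_iX^{s_i}$ with $p_i\in P$, $s_i\in S$; for $H\subseteq S$, $D[H]\subseteq D[S]$ is the set of finite sums $\sum d_iX^{h_i}$ with $d_i\in D$, $h_i\in H$. An ideal of a monoid $S$ is a subset $I\subseteq S$ with $I+S\subseteq I$ (the empty set is allowed); it is prime if $I\ne S$ and $a+b\in I$ implies $a\in I$ or $b\in I$. For a prime ideal $P$ of $S$, $S_P=\{a-b\mid a\in S,\ b\in S\setminus P\}$ inside the quotient group. $\mathfrak X(D)$ denotes the set of height-one prime ideals of a domain $D$, and $\mathfrak X(S)$ the set of minimal non-empty prime ideals of a monoid $S$. A domain $D$ is weakly Krull if $D=\bigcap_{P\in\mathfrak X(D)}D_P$ and every non-zero non-unit of $D$ lies in only finitely many $P\in\mathfrak X(D)$. A monoid $S$ is weakly Krull if $S=\bigcap_{P\in\mathfrak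 X(S)}S_P$ and every non-unit of $S$ lies in only finitely many $P\in\mathfrak X(S)$. An empty intersection is the quotient field (resp. quotient group), so fields and groups are weakly Krull. Let $D$ be a domain with quotient field $K$ and $S$ a torsion-free monoid with quotient group $G$. $D$ is called $S$-UMT if $\mathfrak X(D[S])=\{P[S]\mid P\in\mathfrak X(D)\}\cup\{\overline Q\cap D[S]\mid \overline Q\in\mathfrak X(K[S])\}$. $S$ is called $D$-UMT if $\mathfrak X(D[S])=\{D[P]\mid P\in\mathfrak X(S)\}\cup\{\overline Q\cap D[S]\mid \overline Q\in\mathfrak X(D[G])\}$. *)

(* Defs.v *)
From HB Require Import structures.
From mathcomp Require Import all_boot all_order all_algebra.
From mathcomp Require Import generic_quotient ring_quotient fraction finmap.
From mathcomp Require Import boolp classical_sets cardinality.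

Set Implicit Arguments.
Unset Strict Implicit.
Unset Printing Implicit Defensive.

Import GRing.Theory.
Local Open Scope ring_scope.
Local Open Scope classical_set_scope.

Reserved Notation "{ 'monalg' D [ S ] }"
  (at level 0, D, S at level 2, format "{ 'monalg'  D [ S ] }").

HB.mixin Record isTorsionFreeMonoid S of GRing.Nmodule S := {
  addm_inj : forall x : S, injective (+%R x);
  mulmn_inj : forall n (x y : S), x *+ n.+1 = y *+ n.+1 -> x = y
}.

#[short(type="tfMonoidType")]
HB.structure Definition TfMonoid :=
  { S of isTorsionFreeMonoid S & GRing.Nmodule S }.

(* The group of formal differences: the class of (a, b) stands for a - b. *)
Module QuotientGroup.
Section QuotientGroup.
Variable S : tfMonoidType.
Implicit Types x y z : S * S.
Local Open Scope quotient_scope.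

Definition equivd x y := x.1 + y.2 == x.2 + y.1.

Lemma equivd_refl : reflexive equivd.
Proof. by move=> x; rewrite /equivd addrC. Qed.

Lemma equivd_sym : symmetric equivd.
Proof.
by move=> x y; rewrite /equivd eq_sym addrC [x.1 + _]addrC.
Qed.

Lemma equivd_trans : transitive equivd.
Proof.
move=> y x z /eqP xy /eqP yz; apply/eqP/(@addm_inj S (y.2 + y.1)).
rewrite addrACA [y.2 + x.1]addrC xy yz [x.2 + y.1]addrC addrACA.
by rewrite [y.1 + y.2]addrC.
Qed.

Canonical equivd_equiv := EquivRel equivd equivd_refl equivd_sym equivd_trans.

Definition type := {eq_quot equivd}.
HB.instance Definition _ : EqQuotient _ equivd type := EqQuotient.on type.
HB.instance Definition _ := Choice.on type.

Lemma piP x y : reflect (x.1 + y.2 = x.2 + y.1) (\pi_type x == \pi_type y).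
Proof. by rewrite eqmodE; apply: eqP. Qed.

Definition embed (s : S) : type := \pi_type (s, 0).
Definition add (a b : type) : type :=
  \pi_type ((repr a).1 + (repr b).1, (repr a).2 + (repr b).2).
Definition opp (a : type) : type := \pi_type ((repr a).2, (repr a).1).

Lemma pi_repr x :
  (repr (\pi_type x)).1 + x.2 = (repr (\pi_type x)).2 + x.1.
Proof. by apply/piP; rewrite reprK. Qed.

Lemma pi_add x y :
  add (\pi_type x) (\pi_type y) = \pi_type (x.1 + y.1, x.2 + y.2).
Proof.
by apply/eqP/piP => /=; rewrite addrACA !pi_repr addrACA.
Qed.

Lemma pi_opp x : opp (\pi_type x) = \pi_type (x.2, x.1).
Proof. by apply/eqP/piP => /=; rewrite pi_repr. Qed.

Lemma addA : associative add.
Proof.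
elim/quotW=> x; elim/quotW=> y; elim/quotW=> z.
by rewrite (pi_add y z) (pi_add x y) !pi_add /= !addrA.
Qed.

Lemma addC : commutative add.
Proof.
elim/quotW=> x; elim/quotW=> y.
by rewrite !pi_add addrC [x.2 + _]addrC.
Qed.

Lemma add0 : left_id (embed 0) add.
Proof.
by elim/quotW=> x; rewrite /embed pi_add !add0r -surjective_pairing.
Qed.

Lemma addN : left_inverse (embed 0) opp add.
Proof.
elim/quotW=> x; rewrite pi_opp pi_add; apply/eqP/piP => /=.
by rewrite !addr0 addrC.
Qed.

HB.instance Definition _ := GRing.isZmodule.Build type addA addC add0 addN.

Lemma type_addm_inj (a : type) : injective (+%R a).
Proof. exact: addrI. Qed.

Lemma pi_muln x n : \pi_type x *+ n = \pi_type (x.1 *+ n, x.2 *+ n).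
Proof.
elim: n => [|n IHn]; first by rewrite !mulr0n.
by rewrite mulrS IHn [LHS]pi_add -!mulrS.
Qed.

Lemma type_mulmn_inj n (a b : type) : a *+ n.+1 = b *+ n.+1 -> a = b.
Proof.
elim/quotW: a => x; elim/quotW: b => y; rewrite !pi_muln => /eqP/piP /= xy.
by apply/eqP/piP/(@mulmn_inj S n); rewrite !mulrnDl.
Qed.

HB.instance Definition _ :=
  isTorsionFreeMonoid.Build type type_addm_inj type_mulmn_inj.

Lemma embed_inj : injective embed.
Proof. by move=> s t /eqP/piP /=; rewrite addr0 add0r. Qed.

Lemma embedD : {morph embed : s t / s + t}.
Proof. by move=> s t; rewrite [RHS]pi_add /= addr0. Qed.

Lemma embed0 : embed 0 = 0. Proof. by []. Qed.

Lemma embedP (a : type) : exists s t, a = embed s - embed t.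
Proof.
elim/quotW: a => x; exists x.1, x.2; rewrite [- _]pi_opp [RHS]pi_add /=.
by rewrite addr0 add0r -surjective_pairing.
Qed.

End QuotientGroup.
End QuotientGroup.
HB.export QuotientGroup.

Notation quotient_group := QuotientGroup.type.
Notation toquot := (@QuotientGroup.embed _).

(* By Zorn's lemma a torsion-free abelian group has a translation-invariant
   total order. This is what makes D[S] a domain (alg_integral below): the
   leading terms of two non-zero elements cannot cancel in their product. *)
Lemma group_positive_cone (G : zmodType) :
    (forall n (x : G), x *+ n.+1 = 0 -> x = 0) ->
  exists C : set G, [/\ forall x y, C x -> C y -> C (x + y), ~ C 0 &
    forall x, x != 0 -> C x \/ C (- x)].
Proof.
move=> tfG.
pose P (C : set G) := (forall x y, C x -> C y -> C (x + y)) /\ ~ C 0.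
have [|C [[CD C0] Cmax]] := @Zorn_bigcup G P.
  move=> F FP Ftot; split=> [x y [A FA Ax] [B FB By]|[A FA A0]]; last first.
    by case: (FP _ FA).
  have [AB|BA] := Ftot _ _ FA FB.
    by exists B => //; apply: (FP _ FB).1 => //; apply: AB.
  by exists A => //; apply: (FP _ FA).1 => //; apply: BA.
have CMn x n : C x -> C (x *+ n.+1).
  move=> Cx; elim: n => [|n IHn]; first by rewrite mulr1n.
  by rewrite mulrS; apply: CD.
have key x : x != 0 -> ~ C x -> exists n, C (- (x *+ n.+1)).
  move=> x0 nCx; pose C' := [set y | C y \/ (exists n, y = x *+ n.+1) \/
    exists c n, C c /\ y = c + x *+ n.+1].
  have C'x : C' x by right; left; exists 0%N; rewrite mulr1n.
  have C'D y z : C' y -> C' z -> C' (y + z).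
    move=> [Cy|[[n ->]|[c [n [Cc ->]]]]] [Cz|[[m ->]|[d [m [Cd ->]]]]].
    - by left; apply: CD.
    - by right; right; exists y, m.
    - by right; right; exists (y + d), m; rewrite addrA; split=> //; apply: CD.
    - by right; right; exists z, n; rewrite addrC.
    - by right; left; exists (n + m).+1; rewrite -mulrnDr addSn addnS.
    - right; right; exists d, (n + m).+1; split=> //.
      by rewrite addrCA -mulrnDr addSn addnS.
    - right; right; exists (c + z), n; split; first exact: CD.
      by rewrite addrAC.
    - right; right; exists c, (n + m).+1; split=> //.
      by rewrite -addrA -mulrnDr addSn addnS.
    - right; right; exists (c + d), (n + m).+1; split; first exact: CD.
      by rewrite addrACA -mulrnDr addSn addnS.
  have CC' : C `<` C'.
    by split=> [y Cy|/(_ _ C'x)//]; left.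
  have : C' 0 by apply: contrapT => C'0; apply: (Cmax C').
  move=> [//|[[n /esym/tfG xe0]|[c [n [Cc /esym/eqP]]]]].
    by rewrite xe0 eqxx in x0.
  by rewrite addr_eq0 => /eqP cE; exists n; rewrite -cE.
exists C; split=> // x x0; apply: contrapT => /not_orP[nCx nCNx].
have [n Cn] := key x x0 nCx.
have [|m] := key (- x) _ nCNx; first by rewrite oppr_eq0.
rewrite mulNrn opprK => Cm; apply: C0.
have := CD _ _ (CMn _ m Cn) (CMn _ n Cm).
by rewrite mulNrn -!mulrnA [(m.+1 * _)%N]mulnC addNr.
Qed.

Lemma tfMonoid_order (S : tfMonoidType) : exists lt : S -> S -> Prop,
  [/\ forall x, ~ lt x x,
      forall x y z, lt x y -> lt y z -> lt x z,
      forall x y, x != y -> lt x y \/ lt y x &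
      forall x y z, lt x y -> lt (z + x) (z + y)].
Proof.
have [|C [CD C0 CT]] := @group_positive_cone (quotient_group S).
  by move=> n x xn0; apply: (@mulmn_inj _ n); rewrite mul0rn.
exists (fun x y => C (toquot y - toquot x)); split.
- by move=> x; rewrite subrr.
- move=> x y z xy yz.
  by rewrite -[_ z](subrK (toquot y)) -addrA; apply: CD.
- move=> x y xy.
  have : toquot y - toquot x != 0.
    by rewrite subr_eq0; apply: contraNneq xy => /QuotientGroup.embed_inj ->.
  by move/CT; rewrite opprB.
- by move=> x y z; rewrite !QuotientGroup.embedD opprD addrACA subrr add0r.
Qed.

(* Finitely supported functions S -> D with the convolution product. The type
   {malg D[S]} of mathcomp-multinomials does not apply: its monomials admit no
   invertible element besides 1, whereas S may be a group here. *)
Record monalg (D : nzRingType) (S : choiceType) : predArgType :=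
  MonAlg { monalg_val : {fsfun S -> D with 0} }.

Notation "{ 'monalg' D [ S ] }" := (monalg D S) : type_scope.
Bind Scope ring_scope with monalg.

HB.instance Definition _ (D : nzRingType) (S : choiceType) :=
  [isNew for @monalg_val D S].
HB.instance Definition _ (D : nzRingType) (S : choiceType) :=
  [Choice of monalg D S by <:].

Section MonAlgZmod.
Variables (D : nzRingType) (S : choiceType).
Implicit Types (f g h : {monalg D[S]}) (s t : S) (c d : D).

Definition acoef f s : D := monalg_val f s.
Definition asupp f : {fset S} := finsupp (monalg_val f).

Definition monom c s : {monalg D[S]} :=
  MonAlg [fsfun t in [fset s]%fset => c].

Definition alg_zero : {monalg D[S]} := MonAlg [fsfun].
Definition alg_opp f := MonAlg [fsfun s in asupp f => - acoef f s].
Definition alg_add f g :=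
  MonAlg [fsfun s in (asupp f `|` asupp g)%fset => acoef f s + acoef g s].

Lemma algP f g : acoef f =1 acoef g <-> f = g.
Proof.
case: f g => [f] [g]; split=> [fg|[->]//].
by congr MonAlg; apply/fsfunP.
Qed.

Lemma acoef_dflt f s : s \notin asupp f -> acoef f s = 0.
Proof. exact: fsfun_dflt. Qed.

Lemma mem_asupp f s : (s \in asupp f) = (acoef f s != 0).
Proof. by rewrite /asupp mem_finsupp. Qed.

Lemma coef_monom c s t : acoef (monom c s) t = if t == s then c else 0.
Proof. by rewrite /acoef fsfun_fun inE. Qed.

Lemma coef_zero s : acoef alg_zero s = 0.
Proof. by rewrite /acoef fsfun0E. Qed.

Lemma coef_opp f s : acoef (alg_opp f) s = - acoef f s.
Proof.
rewrite /acoef fsfun_fun -/(acoef f s); case: ifPn => // /acoef_dflt ->.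
by rewrite oppr0.
Qed.

Lemma coef_add f g s : acoef (alg_add f g) s = acoef f s + acoef g s.
Proof.
rewrite /acoef fsfun_fun in_fsetU -/(acoef f s) -/(acoef g s).
case: ifPn => //; rewrite negb_or => /andP[/acoef_dflt -> /acoef_dflt ->].
by rewrite addr0.
Qed.

Lemma alg_addA : associative alg_add.
Proof. by move=> f g h; apply/algP => s; rewrite !coef_add addrA. Qed.
Lemma alg_addC : commutative alg_add.
Proof. by move=> f g; apply/algP => s; rewrite !coef_add addrC. Qed.
Lemma alg_add0 : left_id alg_zero alg_add.
Proof. by move=> f; apply/algP => s; rewrite coef_add coef_zero add0r. Qed.
Lemma alg_addN : left_inverse alg_zero alg_opp alg_add.
Proof.
by move=> f; apply/algP => s; rewrite coef_add coef_opp coef_zero addNr.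
Qed.

HB.instance Definition _ :=
  GRing.isZmodule.Build {monalg D[S]} alg_addA alg_addC alg_add0 alg_addN.

Lemma acoef_is_zmod_morphism s :
  zmod_morphism ((fun f => acoef f s) : {monalg D[S]} -> D).
Proof. by move=> f g; rewrite coef_add coef_opp. Qed.

Lemma acoef0 s : acoef 0 s = 0. Proof. exact: coef_zero. Qed.
Lemma acoefD f g s : acoef (f + g) s = acoef f s + acoef g s.
Proof. exact: coef_add. Qed.

Lemma acoef_sum I (r : seq I) (P : pred I) (F : I -> {monalg D[S]}) s :
  acoef (\sum_(i <- r | P i) F i) s = \sum_(i <- r | P i) acoef (F i) s.
Proof.
by apply: (big_morph (fun f => acoef f s)) => [f g|];
   rewrite ?acoefD ?acoef0.
Qed.

Lemma monomD s : {morph (fun c => monom c s) : c d / c + d}.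
Proof.
move=> c d; apply/algP => t; rewrite acoefD !coef_monom.
by case: ifP; rewrite ?addr0.
Qed.

Lemma monom0 s : monom 0 s = 0.
Proof. by apply/algP => t; rewrite acoef0 coef_monom if_same. Qed.

Section Lift.
Variables (V : nmodType) (F : D -> S -> V).
Hypotheses (F0 : forall s, F 0 s = 0)
  (FD : forall s c d, F (c + d) s = F c s + F d s).

Definition lift_alg f : V := \sum_(s <- asupp f) F (acoef f s) s.

Lemma lift_algEw f (A : {fset S}) : (asupp f `<=` A)%fset ->
  lift_alg f = \sum_(s <- A) F (acoef f s) s.
Proof.
move=> fA; rewrite /lift_alg; apply: big_fset_incl => // s _ /acoef_dflt ->.
exact: F0.
Qed.

Lemma lift_algD f g : lift_alg (f + g) = lift_alg f + lift_alg g.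
Proof.
pose A := (asupp f `|` asupp g)%fset.
rewrite !(@lift_algEw _ A) ?fsubsetUl ?fsubsetUr // -?big_split /=.
  by apply: eq_bigr => s _; rewrite acoefD FD.
apply/fsubsetP => s; rewrite in_fsetU !mem_asupp acoefD.
by apply: contraR; rewrite negb_or !negbK => /andP[/eqP -> /eqP ->];
   rewrite addr0.
Qed.

Lemma lift_alg_monom c s : lift_alg (monom c s) = F c s.
Proof.
rewrite (@lift_algEw _ [fset s]%fset) ?big_seq_fset1 ?coef_monom ?eqxx //.
apply/fsubsetP => t; rewrite mem_asupp coef_monom inE.
by case: (t == s); rewrite ?eqxx.
Qed.

Lemma lift_alg0 : lift_alg 0 = 0.
Proof.
rewrite (@lift_algEw _ fset0) ?big_seq_fset0 //.
by apply/fsubsetP => t; rewrite mem_asupp acoef0 eqxx.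
Qed.

End Lift.

Lemma alg_sum_monom f : f = \sum_(s <- asupp f) monom (acoef f s) s.
Proof.
apply/algP => t; rewrite acoef_sum.
have [tf|tf] := boolP (t \in asupp f).
  rewrite (big_fsetD1 t) //= coef_monom eqxx big_seq big1 ?addr0 // => s.
  by rewrite in_fsetD1 coef_monom eq_sym => /andP[/negPf ->].
rewrite acoef_dflt // big_seq big1 // => s sf; rewrite coef_monom.
by case: eqP tf => // ->; rewrite sf.
Qed.

Lemma alg_ind (P : {monalg D[S]} -> Prop) :
  P 0 -> (forall c s, P (monom c s)) -> (forall f g, P f -> P g -> P (f + g)) ->
  forall f, P f.
Proof. by move=> P0 Pm PD f; rewrite [f]alg_sum_monom; apply: big_ind. Qed.

End MonAlgZmod.

Section MonAlgRing.
Variables (D : comNzRingType) (S : nmodType).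
Implicit Types (f g h : {monalg D[S]}) (s t : S) (c d : D).

Definition alg_one : {monalg D[S]} := monom 1 0.
Definition alg_mul f g : {monalg D[S]} :=
  \sum_(s <- asupp f) \sum_(t <- asupp g)
    monom (acoef f s * acoef g t) (s + t).

Let mulF g c s : {monalg D[S]} :=
  lift_alg (fun d t => monom (c * d) (s + t)) g.

Let mulF0 g s : mulF g 0 s = 0.
Proof. by rewrite /mulF /lift_alg big1 // => t _; rewrite mul0r monom0. Qed.

Let mulFD g s c d : mulF g (c + d) s = mulF g c s + mulF g d s.
Proof.
rewrite /mulF /lift_alg -big_split /=.
by apply: eq_bigr => t _; rewrite mulrDl monomD.
Qed.

Lemma alg_mulE f g : alg_mul f g = lift_alg (mulF g) f. Proof. by []. Qed.

Lemma alg_mulDl : left_distributive alg_mul +%R.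
Proof. by move=> f g h; rewrite !alg_mulE lift_algD. Qed.

Lemma alg_mul0r g : alg_mul 0 g = 0.
Proof. by rewrite alg_mulE lift_alg0. Qed.

Lemma alg_mulC : commutative alg_mul.
Proof.
move=> f g; rewrite /alg_mul exchange_big /=; apply: eq_bigr => t _.
by apply: eq_bigr => s _; rewrite mulrC addrC.
Qed.

Lemma alg_mulr0 g : alg_mul g 0 = 0.
Proof. by rewrite alg_mulC alg_mul0r. Qed.

Lemma alg_mulDr f g h : alg_mul f (g + h) = alg_mul f g + alg_mul f h.
Proof. by rewrite alg_mulC alg_mulDl !(alg_mulC f). Qed.

Lemma alg_mul_monom c d s t :
  alg_mul (monom c s) (monom d t) = monom (c * d) (s + t).
Proof.
rewrite alg_mulE (lift_alg_monom (mulF0 _)) /mulF lift_alg_monom // => u.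
by rewrite mulr0 monom0.
Qed.

Lemma alg_mulA : associative alg_mul.
Proof.
move=> f g h; elim/alg_ind: f => [|c s|f f' IHf IHf'].
- by rewrite !alg_mul0r.
- elim/alg_ind: g => [|d t|g g' IHg IHg'].
  + by rewrite !(alg_mul0r, alg_mulr0).
  + elim/alg_ind: h => [|e u|h h' IHh IHh'].
    * by rewrite !alg_mulr0.
    * by rewrite !alg_mul_monom mulrA addrA.
    * by rewrite !alg_mulDr IHh IHh'.
  + by rewrite alg_mulDr !alg_mulDl alg_mulDr IHg IHg'.
- by rewrite !alg_mulDl IHf IHf'.
Qed.

Lemma alg_mul1 : left_id alg_one alg_mul.
Proof.
move=> f; elim/alg_ind: f => [|c s|f g IHf IHg].
- exact: alg_mulr0.
- by rewrite alg_mul_monom mul1r add0r.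
- by rewrite alg_mulDr IHf IHg.
Qed.

Lemma alg_one_neq0 : alg_one != 0.
Proof.
apply/eqP => /algP/(_ 0)/eqP; rewrite acoef0 coef_monom eqxx.
by rewrite oner_eq0.
Qed.

HB.instance Definition _ := GRing.Zmodule_isComNzRing.Build {monalg D[S]}
  alg_mulA alg_mulC alg_mul1 alg_mulDl alg_one_neq0.

Lemma acoefM f g u : acoef (f * g) u =
  \sum_(s <- asupp f) \sum_(t <- asupp g)
    (if u == s + t then acoef f s * acoef g t else 0).
Proof.
rewrite [f * g]/(alg_mul f g) acoef_sum; apply: eq_bigr => s _.
by rewrite acoef_sum; apply: eq_bigr => t _; rewrite coef_monom.
Qed.

End MonAlgRing.

Section MonAlgDomain.
Variables (D : idomainType) (S : tfMonoidType).
Implicit Types (f g : {monalg D[S]}).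

(* Invertibility in D[S] is not decidable, hence the classical definitions. *)
Definition alg_unit : pred {monalg D[S]} := fun f => `[< exists g, g * f = 1 >].
Definition alg_inv f : {monalg D[S]} :=
  if pselect (exists g, g * f = 1) is left e then projT1 (cid e) else f.

Lemma alg_mulVr : {in alg_unit, left_inverse 1 alg_inv *%R}.
Proof.
move=> f /asboolP fU; rewrite /alg_inv; case: pselect => // e.
by case: (cid e).
Qed.

Lemma alg_unitPl f g : g * f = 1 -> alg_unit f.
Proof. by move=> gf; apply/asboolP; exists g. Qed.

Lemma alg_invr_out : {in [predC alg_unit], alg_inv =1 id}.
Proof.
move=> f /negP fU; rewrite /alg_inv; case: pselect => // e.
by case: fU; apply/asboolP.
Qed.

HB.instance Definition _ :=
  GRing.ComNzRing_hasMulInverse.Build {monalg D[S]}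
    alg_mulVr alg_unitPl alg_invr_out.

Lemma alg_integral : GRing.integral_domain_axiom {monalg D[S]}.
Proof.
move=> f g fg0; apply/norP => -[f0 g0].
have [lt [lt_irr lt_tr lt_tot ltD]] := tfMonoid_order S.
have exmaxs (r : seq S) : r != [::] ->
    exists2 m, m \in r & forall s, s \in r -> s != m -> lt s m.
  elim: r => // a [_ _|b r IHr _].
    exists a; rewrite ?mem_head // => s; rewrite inE => /eqP ->.
    by rewrite eqxx.
  have [//|m mr mmax] := IHr.
  have [ma|ma] := eqVneq a m.
    exists m; rewrite ?ma ?mem_head // => s; rewrite inE => /orP[/eqP ->|].
      by rewrite eqxx.
    exact: mmax.
  have [am|mlta] := lt_tot _ _ ma.
    exists m; first by rewrite inE mr orbT.
    move=> s; rewrite inE => /orP[/eqP -> //|]; exact: mmax.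
  exists a; first by rewrite mem_head.
  move=> s; rewrite inE => /orP[/eqP ->|sr _]; first by rewrite eqxx.
  by have [-> //|/(mmax _ sr) sm] := eqVneq s m; apply: lt_tr mlta.
have exmax (h : {monalg D[S]}) : h != 0 ->
    exists2 m, m \in asupp h & forall s, s \in asupp h -> s != m -> lt s m.
  move=> h0; have [|m mh hmax] := exmaxs (asupp h); last by exists m.
  apply: contraNneq h0 => h0; rewrite [h]alg_sum_monom.
  by rewrite h0 big_nil.
have [m mf fmax] := exmax f f0.
have [n ng gmax] := exmax g g0.
have /algP/(_ (m + n)) := fg0; rewrite acoef0 acoefM.
have uniq_mn s t : s \in asupp f -> t \in asupp g -> m + n = s + t ->
    s = m /\ t = n.
  move=> sf tg mn; have [sm|sm] := eqVneq s m.
    by split=> //; apply/esym/(@addm_inj S m); rewrite mn sm.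
  have stm : lt (t + s) (t + m) by apply: ltD; apply: fmax.
  have mtmn : lt (t + m) (m + n) \/ t + m = m + n.
    have [->|tn] := eqVneq t n; first by right; rewrite addrC.
    by left; rewrite [t + m]addrC; apply: ltD; apply: gmax.
  case: (lt_irr (m + n)); rewrite {1}mn [s + t]addrC.
  by case: mtmn => [|<-//]; apply: lt_tr.
rewrite (big_fsetD1 m) //= (big_fsetD1 n) //= eqxx.
rewrite big_seq big1 => [|t]; last first.
  rewrite in_fsetD1 => /andP[tn tg]; case: eqP => // /(uniq_mn _ _ mf tg)[_ tE].
  by rewrite tE eqxx in tn.
rewrite addr0 big_seq big1 => [|s]; last first.
  rewrite in_fsetD1 => /andP[sm sf]; rewrite big_seq big1 // => t tg.
  by case: eqP => // /(uniq_mn _ _ sf tg)[sE _]; rewrite sE eqxx in sm.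
by rewrite addr0 => /eqP; rewrite mulf_eq0 -[_ || _]negbK negb_or -!mem_asupp mf ng.
Qed.

HB.instance Definition _ :=
  GRing.ComUnitRing_isIntegral.Build {monalg D[S]} alg_integral.

End MonAlgDomain.

Definition map_alg (D E : nzRingType) (S T : choiceType)
    (phi : D -> E) (h : S -> T) (f : {monalg D[S]}) : {monalg E[T]} :=
  \sum_(s <- asupp f) monom (phi (acoef f s)) (h s).

(* The inclusion of D[S] in K[S], K the quotient field of D. *)
Definition scalar_ext (D : idomainType) (S : tfMonoidType) :
    {monalg D[S]} -> {monalg {fraction D}[S]} :=
  map_alg (@FracField.tofrac D) id.

(* The inclusion of D[S] in D[G], G the quotient group of S. *)
Definition exponent_ext (D : idomainType) (S : tfMonoidType) :
    {monalg D[S]} -> {monalg D[quotient_group S]} :=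
  map_alg id (@QuotientGroup.embed S).

(* Finite sums of c X^s with c in A and s in H; exponents may repeat. *)
Definition alg_over (D : nzRingType) (S : choiceType) (A : set D) (H : set S) :
    set {monalg D[S]} :=
  [set f | exists2 r : seq (D * S),
     (forall x, x \in r -> A x.1 /\ H x.2) & f = \sum_(x <- r) monom x.1 x.2].

(* P[S] *)
Definition coef_ext (D : nzRingType) (S : choiceType) (P : set D) :
  set {monalg D[S]} := alg_over P setT.

(* D[H] *)
Definition exp_ext (D : nzRingType) (S : choiceType) (H : set S) :
  set {monalg D[S]} := alg_over setT H.

Section Domain.
Variable R : idomainType.
Implicit Type P : set R.

Definition prime_ideal P :=
  idealr_closed [in P] /\ prime_idealr_closed [in P].

(* A chain of length n, i.e. with n strict inclusions between C 0, ..., C n;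
   the values of C beyond n are irrelevant. *)
Definition prime_chain (n : nat) (C : nat -> set R) :=
  (forall i, (i <= n)%N -> prime_ideal (C i)) /\
  (forall i, (i < n)%N -> C i `<` C i.+1).

Definition has_height P (n : nat) :=
  (exists2 C, prime_chain n C & C n = P) /\
  (forall m C, prime_chain m C -> C m = P -> (m <= n)%N).

Definition height_one_primes : set (set R) :=
  [set P | prime_ideal P /\ has_height P 1].

Definition localization P : set {fraction R} :=
  [set z | exists a b, ~ P b /\
     z = FracField.tofrac a / FracField.tofrac b].

(* An empty \bigcap is setT, here the whole quotient field. *)
Definition weakly_Krull_domain :=
  range (@FracField.tofrac R) = \bigcap_(P in height_one_primes) localization P
  /\ forall a : R, a != 0 -> a \isn't a GRing.unit ->
       finite_set [set P | height_one_primes P /\ P a].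

End Domain.

Arguments height_one_primes : clear implicits.
Arguments weakly_Krull_domain : clear implicits.

Section Monoid.
Variable S : tfMonoidType.
Implicit Types I P Q : set S.

(* The empty set is an ideal. *)
Definition monoid_ideal I := forall a b, I a -> I (a + b).

Definition monoid_prime_ideal P :=
  [/\ monoid_ideal P, P <> setT & forall a b, P (a + b) -> P a \/ P b].

Definition minimal_nonempty_primes : set (set S) :=
  [set P | [/\ monoid_prime_ideal P, P !=set0 &
     forall Q, monoid_prime_ideal Q -> Q !=set0 -> Q `<=` P -> Q = P]].

Definition monoid_localization P : set (quotient_group S) :=
  [set g | exists a b, ~ P b /\ g = toquot a - toquot b].

Definition weakly_Krull_monoid :=
  range (@QuotientGroup.embed S) =
    \bigcap_(P in minimal_nonempty_primes) monoid_localization P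
  /\ forall a : S, ~ (exists b, a + b = 0) ->
       finite_set [set P | minimal_nonempty_primes P /\ P a].

End Monoid.

Arguments minimal_nonempty_primes : clear implicits.
Arguments weakly_Krull_monoid : clear implicits.

Definition domain_UMT (D : idomainType) (S : tfMonoidType) :=
  height_one_primes {monalg D[S]} =
    [set coef_ext P | P in height_one_primes D] `|`
    [set @scalar_ext D S @^-1` Q | Q in height_one_primes {monalg {fraction D}[S]}].

Definition monoid_UMT (D : idomainType) (S : tfMonoidType) :=
  height_one_primes {monalg D[S]} =
    [set exp_ext P | P in minimal_nonempty_primes S] `|`
    [set @exponent_ext D S @^-1` Q |
       Q in height_one_primes {monalg D[quotient_group S]}].

Definition acc_cyclic_subgroups (G : zmodType) :=
  forall g : nat -> G,
    (forall n, range (fun k : int => g n *~ k)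
                 `<=` range (fun k : int => g n.+1 *~ k)) ->
  exists N, forall n, (N <= n)%N ->
    range (fun k : int => g n *~ k) = range (fun k : int => g N *~ k).

(* Main.v *)
Require Import Defs.
From HB Require Import structures.
From mathcomp Require Import all_boot all_order all_algebra.
From mathcomp Require Import generic_quotient ring_quotient fraction finmap.
From mathcomp Require Import ring zify.
From mathcomp Require Import boolp classical_sets cardinality.

Set Implicit Arguments.
Unset Strict Implicit.
Unset Printing Implicit Defensive.

Import GRing.Theory.
Local Open Scope ring_scope.
Local Open Scope quotient_scope.
Local Open Scope classical_set_scope.

(** Let K be the quotient field of D and G the quotient group of S. The rings K[S],
    D[G] and K[G] are localizations of D[S]: at the nonzero constants, at the monomials,
    and at both; and D[S] is the intersection of K[S] and D[G]. A height-one prime of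
    D[S] containing a monomial X^s is spanned by the monomials in it, so it is D[P] for
    some P in X(S) ([height_one_monomial]); one containing a nonzero constant is P[S]
    for some P in X(D) ([height_one_constant]); all others come from K[G].

    Necessity. The weakly Krull property passes to localizations
    ([weakly_Krull_localization]), in particular to K[S] and D[G]. In a weakly Krull
    domain every nonzero prime contains a height-one prime
    ([weakly_Krull_prime_contains]); applied to K[P] for P in X(S), and to P[G] for P in
    X(D), this shows that these primes have height one. That is the content of the two
    UMT properties. The remaining height-one primes of K[S] contain no
    monomial, so divisibility of monomials in K[S], which is divisibility in S, can be
    tested at the primes K[P]; this makes S weakly Krull, and D likewise.

    Sufficiency. The chain condition on cyclic subgroups makes K[G] factorial
    ([group_algebra_ufd]), hence weakly Krull. Here irreducible elements are prime
    because any divisibility relation lives, up to a monomial, in a polynomial ring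
    over K: finitely generated subgroups of G are free, and Gauss's lemma applies. The
    number of non-unit factors of f is bounded because a non-unit has a Newton polytope
    with an edge, edges of factors add up along the edges of the polytope of f, and
    each edge of f has finite length in the cyclic group of elements of G along it.

    By the UMT properties the D[P] and P[S] are height-one primes of D[S], and
    membership of a nonzero f in a height-one prime is controlled by one exponent, one
    coefficient, and the image of f in K[G]: this gives finite character. If a / b lies
    in all localizations, the primes contracted from K[G] show that it is an element h
    of K[G]. At D[P] there is d outside D[P] with d h in D[S]; the terms of d with
    exponent in P are nilpotent modulo K[S_P], and the other ones are units there, so
    h lies in K[S_P] ([exponents_at_prime]). In the same way h has coefficients in D_P
    for P in X(D) ([coefficients_at_prime]). Since S and D are weakly Krull, h lies in
    D[S]. *)

(** * Height-one primes and weakly Krull domains *)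

Lemma fraction_quotient (R : idomainType) (z : {fraction R}) :
  exists a b, b != 0 /\ z = FracField.tofrac a / FracField.tofrac b.
Proof.
elim/quotW: z => x; exists \n_x, \d_x; split; first exact: denom_ratioP.
have dx0 : FracField.tofrac \d_x != 0 by rewrite tofrac_eq0 denom_ratioP.
rewrite -[LHS](mulfK dx0); congr (_ / _).
rewrite [LHS](_ : _ = FracField.mul (\pi x) (FracField.tofrac \d_x)) //.
apply/eqP; rewrite !piE /FracField.equivf /FracField.mulf.
by rewrite !numden_Ratio ?mulf_neq0 ?oner_eq0 ?denom_ratioP // !mulr1 mulrC.
Qed.

Section Divisibility.
Variable R : idomainType.
Implicit Types (a b c d t u v x y : R) (P Q T : set R).

Definition dvr b a := exists c, a = c * b.

Lemma dvr_refl a : dvr a a.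
Proof. by exists 1; rewrite mul1r. Qed.

Lemma dvr_mull b a c : dvr b a -> dvr b (c * a).
Proof. by move=> [d ->]; exists (c * d); rewrite mulrA. Qed.

Lemma dvr_mulr b a c : dvr b a -> dvr b (a * c).
Proof. by rewrite mulrC; apply: dvr_mull. Qed.

Lemma dvr_trans b a c : dvr a b -> dvr b c -> dvr a c.
Proof. by move=> ab [d ->]; apply: dvr_mull. Qed.

Lemma dvr_unit u a : u \is a GRing.unit -> dvr u a.
Proof. by move=> uU; exists (a / u); rewrite mulrVK. Qed.

Lemma unit_dvr u : dvr u 1 -> u \is a GRing.unit.
Proof. by move=> [c cu]; apply/unitrP; exists c; rewrite [u * c]mulrC -cu. Qed.

Lemma prime_idealE P : prime_ideal P <->
  [/\ P 0, ~ P 1, forall a u v, P u -> P v -> P (a * u + v) &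
      forall u v, P (u * v) -> P u \/ P v].
Proof.
split=> [[[P0 P1 PD] PM]|[P0 P1 PD PM]].
- split; first exact: set_mem.
  + by move=> Q1; move: P1; rewrite mem_set.
  + by move=> a u v Pu Pv; apply/set_mem/PD; apply: mem_set.
  + by move=> u v /mem_set/PM/orP[] /set_mem; [left|right].
- split.
    split; [exact: mem_set|by apply/negP => /set_mem|].
    by move=> a u v /set_mem Pu /set_mem Pv; apply/mem_set/PD.
  by move=> u v /set_mem/PM[] /mem_set ->; rewrite ?orbT.
Qed.

Section PrimeIdeal.
Variable P : set R.
Hypothesis primeP : prime_ideal P.

Lemma prime0 : P 0.
Proof. by have /prime_idealE[] := primeP. Qed.

Lemma prime1 : ~ P 1.
Proof. by have /prime_idealE[] := primeP. Qed.

Lemma primeD u v : P u -> P v -> P (u + v).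
Proof.
have /prime_idealE[_ _ PD _] := primeP.
by move=> Pu Pv; rewrite -[u]mul1r; apply: PD.
Qed.

Lemma primeMl a u : P u -> P (a * u).
Proof.
have /prime_idealE[P0 _ PD _] := primeP.
by move=> Pu; rewrite -[_ * _]addr0; apply: PD.
Qed.

Lemma primeN u : P u -> P (- u).
Proof. by rewrite -mulN1r; apply: primeMl. Qed.

Lemma primeM u v : P (u * v) -> P u \/ P v.
Proof. by have /prime_idealE[_ _ _ PM] := primeP; apply: PM. Qed.

Lemma primeX u n : P (u ^+ n) -> P u.
Proof.
elim: n => [|n IHn]; first by rewrite expr0 => /prime1.
by rewrite exprS => /primeM[].
Qed.

Lemma prime_sum I (r : seq I) (p : pred I) (F : I -> R) :
  (forall i, p i -> P (F i)) -> P (\sum_(i <- r | p i) F i).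
Proof. by move=> PF; apply: big_ind => //; [apply: prime0|apply: primeD]. Qed.

Lemma prime_dvr b a : dvr b a -> P b -> P a.
Proof. by move=> [c ->]; apply: primeMl. Qed.

Lemma prime_not_unit u : P u -> u \isn't a GRing.unit.
Proof. by move=> Pu; apply/negP => /dvr_unit-/(_ 1)/prime_dvr/(_ Pu)/prime1. Qed.

End PrimeIdeal.

Lemma prime_ideal_zero : prime_ideal [set 0 : R].
Proof.
apply/prime_idealE; split=> //=.
- by move/eqP; rewrite oner_eq0.
- by move=> a u v -> ->; rewrite mulr0 addr0.
- by move=> u v /eqP; rewrite mulf_eq0 => /orP[] /eqP; [left|right].
Qed.

Lemma height_oneE P : height_one_primes R P <->
  [/\ prime_ideal P, exists2 x, P x & x != 0 &
     forall Q, prime_ideal Q -> (exists2 x, Q x & x != 0) -> Q `<=` P -> Q = P].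
Proof.
split=> [[pP [[C [Cp Cs] C1] Pmax]]|[pP [x Px x0] Pmin]].
- split=> //.
    have [_ /nonsubset[y []]] := Cs 0%N isT; rewrite C1 => Py C0y.
    by exists y => //; apply/eqP => y0; case: C0y; rewrite y0; apply: prime0; apply: Cp.
  move=> Q pQ [x Qx x0] QP; apply: contrapT => nQP.
  pose C' n := if n is n'.+1 then if n' is 0%N then Q else P else [set 0 : R].
  suff /Pmax/(_ erefl) : prime_chain 2 C' by [].
  split=> [[|[|i]] _ //=|[|[|i]] _ //=]; first exact: prime_ideal_zero.
    split=> [_ ->|]; first exact: prime0.
    by move/(_ _ Qx)/eqP; rewrite (negPf x0).
  by split=> // PQ; apply: nQP; rewrite eqEsubset.
- split=> //; split.
    exists (fun n => if n is 0%N then [set 0 : R] else P) => //.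
    split=> [[|i] _ //=|[|i] //= _]; first exact: prime_ideal_zero.
    split=> [_ ->|]; first exact: prime0.
    by move/(_ _ Px)/eqP; rewrite (negPf x0).
  move=> [|[|m]] // C [Cp Cs] CP.
  have [CmC /nonsubset[y [Cy C0y]]] := Cs m (leqnSn _).
  have [+ []] := Cs m.+1 (leqnn _); rewrite CP => CP'.
  rewrite (Pmin (C m.+1)) //; first by apply: Cp; apply: leqnSn.
  exists y => //; apply/eqP => y0; case: C0y; rewrite y0.
  by apply: prime0; apply: Cp; rewrite ltnW // ltnW.
Qed.

Lemma height_one_prime P : height_one_primes R P -> prime_ideal P.
Proof. by move/height_oneE => []. Qed.

Lemma localizationE P a b : prime_ideal P -> b != 0 ->
  localization P (FracField.tofrac a / FracField.tofrac b) <->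
  exists2 d, ~ P d & dvr b (a * d).
Proof.
move=> pP b0; have tofrac0 c : c != 0 -> FracField.tofrac c != 0.
  by rewrite tofrac_eq0.
have P0 c : ~ P c -> c != 0.
  by move=> Pc; apply/eqP => c0; apply: Pc; rewrite c0; apply: prime0.
split=> [[c [d [Pd /eqP]]]|[d Pd [c ad]]].
  rewrite eqr_div ?tofrac0 // ?P0 // -!rmorphM tofrac_eq.
  by move=> /eqP ad; exists d => //; exists c.
exists c, d; split=> //; apply/eqP.
by rewrite eqr_div ?tofrac0 // ?P0 // -!rmorphM tofrac_eq ad.
Qed.

(** Says that a / b lies in the localization at every height-one prime, without
    mentioning the fraction field; this is the form used throughout. *)
Definition locally_dvr b a :=
  forall P, height_one_primes R P -> exists2 d, ~ P d & dvr b (a * d).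

Lemma weakly_KrullE : weakly_Krull_domain R <->
  (forall a b, b != 0 -> locally_dvr b a -> dvr b a) /\
  (forall a, a != 0 -> a \isn't a GRing.unit ->
     finite_set [set P | height_one_primes R P /\ P a]).
Proof.
have tofrac0 c : c != 0 -> FracField.tofrac c != 0.
  by rewrite tofrac_eq0.
split=> -[wK fin]; split=> //.
  move=> a b b0 ab.
  have : (\bigcap_(P in height_one_primes R) localization P)
      (FracField.tofrac a / FracField.tofrac b).
    by move=> P hP; apply/localizationE; [apply: height_one_prime|..|apply: ab].
  rewrite -wK => -[c _ /eqP]; rewrite -[X in X == _]divr1 -(tofrac1 R).
  rewrite eqr_div ?tofrac0 ?oner_eq0 // -!rmorphM tofrac_eq.
  by rewrite mulr1 => /eqP <-; exists c.
rewrite eqEsubset; split=> [_ [c _ <-] P hP|z zP].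
  exists c, 1; split; first exact: prime1 (height_one_prime hP).
  by rewrite tofrac1 divr1.
have [a [b [b0 zE]]] : exists a b,
    b != 0 /\ z = FracField.tofrac a / FracField.tofrac b.
  exact: fraction_quotient.
rewrite zE in zP *; have [|c ->] := wK a b b0.
  move=> P hP; apply/localizationE; [exact: height_one_prime|exact: b0|exact: zP].
by exists c => //; rewrite tofracM mulfK // tofrac0.
Qed.

(** Krull's separation argument: an ideal that is maximal among those containing b
    and avoiding the multiplicative set T is prime. *)
Lemma prime_avoiding T b : T 1 -> (forall u v, T u -> T v -> T (u * v)) ->
    (forall r, ~ T (r * b)) ->
  exists P, [/\ prime_ideal P, P b & forall t, T t -> ~ P t].
Proof.
move=> T1 TM Tb.
(* The empty set is admitted because Zorn's lemma asks for a bound of the empty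
   chain; it is not maximal, as b R is larger. *)
pose good (A : set R) := [/\ forall a u v, A u -> A v -> A (a * u + v),
  forall t, T t -> ~ A t & A b \/ A = set0].
have [F FA Ftot|A [[AD AT Ab] Amax]] := @Zorn_bigcup R good.
  split=> [a u v [X FX Xu] [Y FY Yv]|t Tt [X /FA[_ XT _]]|]; last 1 first.
  - have [[X FX X0]|nF] := pselect (exists2 X, F X & X !=set0).
      left; exists X => //; have [_ _ [//|XE]] := FA _ FX.
      by case: X0 => x; rewrite XE.
    right; apply: contrapT => /eqP/set0P[x [X FX Xx]]; apply: nF.
    by exists X => //; exists x.
  - have [XY|YX] := Ftot _ _ FX FY.
      by exists Y => //; have [YD _ _] := FA _ FY; apply: YD => //; apply: XY.
    by exists X => //; have [XD _ _] := FA _ FX; apply: XD => //; apply: YX.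
  - exact: XT.
have {}Ab : A b.
  case: Ab => // A0; case: (Amax [set x | dvr b x]).
    rewrite A0; split=> [x //|/(_ b)]; apply; exact: dvr_refl.
  split; [|by move=> t Tt [r tE]; apply: (Tb r); rewrite -tE|].
    by move=> a _ _ [r ->] [q ->]; exists (a * r + q); rewrite mulrDl mulrA.
  by left; apply: dvr_refl.
have A0 : A 0 by rewrite -(addNr b) -mulN1r; apply: AD.
have AMl a u : A u -> A (a * u) by move=> Au; rewrite -[_ * _]addr0; apply: AD.
have meet u : ~ A u -> exists t a r, [/\ T t, A a & t = r * u + a].
  move=> Au; apply: contrapT => nT.
  apply: (Amax [set x | exists r a, A a /\ x = r * u + a]).
    split=> [x Ax|/(_ u)]; first by exists 0, x; rewrite mul0r add0r.
    by case/(_ _)/Au; exists 1, 0; rewrite mul1r addr0.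
  split; last by left; exists 0, b; rewrite mul0r add0r.
    move=> a _ _ [r [x [Ax ->]]] [q [y [Ay ->]]].
    exists (a * r + q), (a * x + y); split; first exact: AD.
    by rewrite mulrDr mulrDl mulrA addrACA.
  by move=> t Tt [r [a [Aa tE]]]; apply: nT; exists t, a, r.
exists A; split=> //; apply/prime_idealE; split=> //; first exact: AT.
move=> u v Auv; apply: contrapT => /not_orP[/meet[t [a [r [Tt Aa tE]]]]].
move=> /meet[s [c [q [Ts Ac sE]]]]; apply: (AT (t * s)); first exact: TM.
rewrite tE sE (_ : _ * _ = r * q * (u * v) + (r * u * c + (q * v + c) * a)).
  by apply: (AD) => //; apply: (AD) => //; apply: AMl.
by ring.
Qed.

(** The localization at a height-one prime P has P as its only nonzero prime, so
    every element of P is nilpotent modulo b there. *)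
Lemma height_one_nilpotent P b t : height_one_primes R P -> b != 0 -> P t ->
  exists2 d, ~ P d & exists n, dvr b (t ^+ n * d).
Proof.
move=> /height_oneE[pP _ Pmin] b0 Pt; apply: contrapT => nd.
pose T := [set x | exists d n, ~ P d /\ x = t ^+ n * d].
have [||r [d [n [Pd rbE]]]|Q [pQ Qb QT]] := @prime_avoiding T b.
- by exists 1, 0%N; rewrite expr0 mulr1; split=> //; apply: prime1.
- move=> _ _ [d [n [Pd ->]]] [e [m [Pe ->]]]; exists (d * e), (n + m)%N.
  by rewrite exprD mulrACA; split=> // /(primeM pP)[].
- by apply: nd; exists d => //; exists n, r.
have QP : Q `<=` P.
  move=> x Qx; apply: contrapT => Px; apply: (QT x) => //.
  by exists x, 0%N; rewrite expr0 mul1r.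
suff : ~ Q t by apply; rewrite (Pmin Q) //; exists b.
by apply: QT; exists 1, 1%N; rewrite expr1 mulr1; split=> //; apply: prime1.
Qed.

(** Only finitely many height-one primes contain b, so the product of one witness for
    each of them is a common witness. The multiplicative set T will be the complement
    of a prime, or the set of denominators of a localization. *)
Lemma weakly_Krull_common (T : set R) (Phi : set R -> R -> Prop) b :
    weakly_Krull_domain R -> b != 0 ->
    T 1 -> (forall u v, T u -> T v -> T (u * v)) ->
    (forall P t u, Phi P t -> Phi P (t * u)) ->
    (forall P, height_one_primes R P -> P b -> exists2 t, T t & Phi P t) ->
  exists2 t, T t & forall P, height_one_primes R P -> P b -> Phi P t.
Proof.
move=> /weakly_KrullE[_ fin] b0 T1 TM PhiM PhiT.
have [bU|bU] := boolP (b \is a GRing.unit).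
  exists 1 => // P hP Pb.
  by have := prime_not_unit (height_one_prime hP) Pb; rewrite bU.
have /finite_seqP[r rE] := fin _ b0 bU.
have {}rE P : (P \in r) = `[< height_one_primes R P /\ P b >].
  by apply/idP/asboolP; have /seteqP[rl rr] := rE; [apply: rr|apply: rl].
suff [t Tt tr] : exists2 t, T t & forall P, P \in r -> Phi P t.
  by exists t => // P hP Pb; apply: tr; rewrite rE; apply/asboolP.
have : forall P, P \in r -> exists2 t, T t & Phi P t.
  by move=> P; rewrite rE => /asboolP[]; apply: PhiT.
elim: r {rE} => [|P r IHr] Pr; first by exists 1.
have [t Tt Pt] := Pr P (mem_head _ _).
have [|u Tu ur] := IHr; first by move=> Q Qr; apply: Pr; rewrite inE Qr orbT.
exists (t * u) => [|Q]; first exact: TM.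
rewrite inE => /orP[/eqP ->|/ur Qu]; first exact: PhiM.
by rewrite mulrC; apply: PhiM.
Qed.

(** If every height-one prime containing b had an element outside Q, a product of
    powers of these elements would be a multiple of b outside Q. *)
Lemma weakly_Krull_prime_contains Q b : weakly_Krull_domain R ->
    prime_ideal Q -> Q b -> b != 0 ->
  exists P, [/\ height_one_primes R P, P b & P `<=` Q].
Proof.
move=> wK pQ Qb b0; apply: contrapT => nP.
have [|||P hP Pb|t Qt tP] := @weakly_Krull_common (~` Q)
    (fun P t => exists2 d, ~ P d & dvr b (t * d)) b wK b0.
- exact: prime1.
- by move=> u v Qu Qv /(primeM pQ)[].
- by move=> P t u [d Pd btd]; exists d => //; rewrite mulrAC; apply: dvr_mulr.
- have /nonsubset[u [Pu Qu]] : ~ P `<=` Q by move=> PQ; apply: nP; exists P.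
  have [d Pd [n bd]] := height_one_nilpotent hP b0 Pu.
  by exists (u ^+ n); [move=> /(primeX pQ)|exists d].
apply: Qt; apply: (prime_dvr pQ _ Qb).
have /weakly_KrullE[wK1 _] := wK; apply: wK1 => // P hP.
have [Pb|Pb] := pselect (P b); first exact: tP.
by exists b => //; apply/dvr_mull/dvr_refl.
Qed.

End Divisibility.

Lemma dvr_rmorph (R R' : idomainType) (phi : {rmorphism R -> R'}) b a :
  dvr b a -> dvr (phi b) (phi a).
Proof. by move=> [c ->]; exists (phi c); rewrite rmorphM. Qed.

Lemma prime_preimage (R R' : idomainType) (phi : {rmorphism R -> R'}) Q :
  prime_ideal Q -> prime_ideal (phi @^-1` Q).
Proof.
move=> pQ; apply/prime_idealE; split=> /=.
- by rewrite rmorph0; apply: prime0.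
- by rewrite rmorph1; apply: prime1.
- move=> a u v Qu Qv; rewrite rmorphD rmorphM; apply: (primeD pQ) => //.
  exact: primeMl.
- by move=> u v; rewrite rmorphM => /(primeM pQ).
Qed.

(** * Localization at a multiplicative set *)

Section Localization.
Variables (R R' : idomainType) (phi : {rmorphism R -> R'}) (T : set R).
Implicit Types (P : set R) (Q : set R').

Record is_localization : Prop := IsLocalization {
  loc_inj : injective phi;
  loc1 : T 1;
  locM : forall t u, T t -> T u -> T (t * u);
  loc_unit : forall t, T t -> phi t \is a GRing.unit;
  loc_frac : forall z, exists2 t, T t & exists r, z * phi t = phi r }.

Hypothesis loc : is_localization.

Lemma loc_prime_disjoint Q t : prime_ideal Q -> T t -> ~ Q (phi t).
Proof.
move=> pQ /(loc_unit loc) tU Qt.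
by have := prime_not_unit pQ Qt; rewrite tU.
Qed.

Lemma loc_neq0 r : r != 0 -> phi r != 0.
Proof. by rewrite -(inj_eq (loc_inj loc)) rmorph0. Qed.

Lemma loc_preimageS Q1 Q2 : prime_ideal Q1 -> prime_ideal Q2 ->
  phi @^-1` Q1 `<=` phi @^-1` Q2 -> Q1 `<=` Q2.
Proof.
move=> pQ1 pQ2 Q12 z Qz; have [t Tt [r zt]] := loc_frac loc z.
have /(primeM pQ2)[//|] : Q2 (z * phi t).
  by rewrite zt; apply: Q12; rewrite /= -zt mulrC; apply: primeMl.
by move/(loc_prime_disjoint pQ2 Tt).
Qed.

(** The extension of P consists of the fractions with numerator in P. *)
Lemma loc_extend P : prime_ideal P -> (forall t, T t -> ~ P t) ->
  exists2 Q, prime_ideal Q & phi @^-1` Q = P.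
Proof.
move=> pP PT; pose Q := [set z | exists t r, [/\ T t, P r & z * phi t = phi r]].
have QE : phi @^-1` Q = P.
  rewrite eqEsubset; split=> r /=; last first.
    by exists 1, r; rewrite rmorph1 mulr1; split=> //; apply: loc1 loc.
  move=> [t [s [Tt Ps]]]; rewrite -rmorphM => /(loc_inj loc) rts.
  by have /(primeM pP)[|/PT] : P (r * t) by rewrite rts.
exists Q => //; apply/prime_idealE; split.
- by rewrite -(rmorph0 phi); have := prime0 pP; rewrite -QE.
- by rewrite -(rmorph1 phi); have := prime1 pP; rewrite -{1}QE.
- move=> a u v [t [r [Tt Pr uE]]] [s [q [Ts Pq vE]]].
  have [w Tw [b aE]] := loc_frac loc a.
  exists (w * (t * s)), (b * r * s + q * t * w); split.
  + by apply: (locM loc) => //; apply: (locM loc).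
  + apply: (primeD pP); last by rewrite -mulrA mulrC; apply: primeMl.
    by rewrite mulrAC; apply: primeMl.
  + rewrite rmorphD !rmorphM -uE -vE -aE; ring.
- move=> u v [t [r [Tt Pr uvE]]].
  have [w Tw [b uE]] := loc_frac loc u; have [s Ts [c vE]] := loc_frac loc v.
  have : P (b * c * t).
    rewrite (_ : _ * t = w * s * r); first exact: primeMl.
    by apply: (loc_inj loc); rewrite !rmorphM -uE -vE -uvE; ring.
  case/(primeM pP)=> [/(primeM pP)[Pb|Pc]|/PT//]; [left|right].
    by exists w, b.
  by exists s, c.
Qed.

Lemma loc_height_one Q : height_one_primes R' Q ->
  height_one_primes R (phi @^-1` Q).
Proof.
move=> /height_oneE[pQ [z Qz z0] Qmin].
apply/height_oneE; split; first exact: prime_preimage.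
  have [t Tt [r zt]] := loc_frac loc z.
  exists r; first by rewrite /= -zt mulrC; apply: primeMl.
  apply/eqP => r0; move: zt; rewrite r0 rmorph0 => /eqP; rewrite mulf_eq0.
  rewrite (negPf z0) /= => /eqP t0; have := loc_unit loc Tt.
  by rewrite t0 unitr0.
move=> P pP [x Px x0] PQ.
have [|Q' pQ' Q'E] := loc_extend pP.
  by move=> t Tt /PQ /=; apply: loc_prime_disjoint.
rewrite -Q'E (Qmin Q') //; last by apply: loc_preimageS; rewrite ?Q'E.
exists (phi x); last exact: loc_neq0.
by move: Px; rewrite -Q'E.
Qed.

Lemma loc_height_one_extend P : height_one_primes R P ->
    (forall t, T t -> ~ P t) ->
  exists2 Q, height_one_primes R' Q & phi @^-1` Q = P.
Proof.
move=> /height_oneE[pP [x Px x0] Pmin] PT.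
have [Q pQ QE] := loc_extend pP PT; exists Q => //.
apply/height_oneE; split=> //.
  by exists (phi x); [move: Px; rewrite -QE|apply: loc_neq0].
move=> Q' pQ' [z Qz z0] Q'Q; rewrite eqEsubset; split=> //.
apply: loc_preimageS => //; rewrite QE -(Pmin (phi @^-1` Q')) //.
- exact: prime_preimage.
- have [t Tt [r zt]] := loc_frac loc z.
  exists r; first by rewrite /= -zt mulrC; apply: primeMl.
  apply/eqP => r0; move: zt; rewrite r0 rmorph0 => /eqP; rewrite mulf_eq0.
  rewrite (negPf z0) /= => /eqP t0; have := loc_unit loc Tt.
  by rewrite t0 unitr0.
- by rewrite -QE => y /=; apply: Q'Q.
Qed.

Lemma loc_dvr b a : dvr (phi b) (phi a) -> exists2 t, T t & dvr b (a * t).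
Proof.
move=> [c aE]; have [t Tt [r ct]] := loc_frac loc c.
exists t => //; exists r; apply: (loc_inj loc).
by rewrite !rmorphM -ct aE mulrAC.
Qed.

(** Let a / b lie in the localizations of R at all height-one primes that avoid T.
    Only finitely many of the other height-one primes contain b, and at each of them a
    power of an element of T is a multiple of b; so a single t in T brings a / b into
    all localizations, hence into R. *)
Lemma weakly_Krull_localization :
  weakly_Krull_domain R -> weakly_Krull_domain R'.
Proof.
move=> wK; have /weakly_KrullE[wK1 fin] := wK; apply/weakly_KrullE; split.
  move=> a' b' b'0 ab'.
  have [ta Ta [a aE]] := loc_frac loc a'; have [tb Tb [b bE]] := loc_frac loc b'.
  have taU := loc_unit loc Ta; have tbU := loc_unit loc Tb.
  have b0 : b != 0.
    apply/eqP => b0; move: bE; rewrite b0 rmorph0 => /eqP.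
    rewrite mulf_eq0 (negPf b'0) => /eqP tb0.
    by move: tbU; rewrite tb0 unitr0.
  have lab Q : height_one_primes R' Q ->
      exists2 d, ~ Q (phi d) & dvr b (a * d).
    move=> hQ; have pQ := height_one_prime hQ.
    have [d Qd [c ad]] := ab' _ hQ; have [s Ts [e dE]] := loc_frac loc d.
    have [|t Tt bt] := @loc_dvr b (a * e).
      rewrite rmorphM -aE -dE -bE mulrACA ad.
      exists (c * (phi tb)^-1 * phi ta * phi s).
      set i := (phi tb)^-1.
      rewrite [RHS](_ : _ = c * b' * (phi ta * phi s) * (i * phi tb)); last by ring.
      by rewrite mulVr // mulr1.
    exists (e * t); last by rewrite mulrA.
    rewrite rmorphM => /(primeM pQ)[|]; last exact: loc_prime_disjoint.
    by rewrite -dE => /(primeM pQ)[//|]; apply: loc_prime_disjoint.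
  have [|P t u [d Pd]|P hP Pb|t Tt tP] := @weakly_Krull_common R T
    (fun P t => exists2 d, ~ P d & dvr b (a * t * d)) b wK b0 (loc1 loc).
  - exact: locM loc.
  - by exists d => //; rewrite mulrA mulrAC; apply: dvr_mulr.
  - have [[t Tt Pt]|PT] := pselect (exists2 t, T t & P t).
      have [d Pd [n bd]] := height_one_nilpotent hP b0 Pt.
      exists (t ^+ n); last by exists d => //; rewrite -mulrA; apply: dvr_mull.
      elim: n {bd} => [|n IHn]; rewrite ?expr0 ?exprS; first exact: loc1 loc.
      exact: (locM loc).
    have [|Q hQ QE] := loc_height_one_extend hP.
      by move=> t Tt Pt; apply: PT; exists t.
    have [d Qd bd] := lab _ hQ.
    exists 1; first exact: loc1 loc.
    by exists d; [rewrite -QE|rewrite mulr1].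
  have [|c atE] := wK1 (a * t) b b0.
    move=> P hP; have [/(tP _ hP)//|Pb] := pselect (P b).
    by exists b => //; apply/dvr_mull/dvr_refl.
  exists (phi c * phi tb / phi t / phi ta).
  have abE : a' * phi ta * phi t = phi c * phi tb * b'.
    by rewrite aE -rmorphM atE rmorphM -bE; ring.
  rewrite -[a'](mulrK taU) -[a' * _](mulrK (loc_unit loc Tt)) abE.
  by ring.
move=> a' a'0 a'U; have [t Tt [a aE]] := loc_frac loc a'.
have tU := loc_unit loc Tt.
have a0 : a != 0.
  apply/eqP => a0; move: aE; rewrite a0 rmorph0 => /eqP.
  rewrite mulf_eq0 (negPf a'0) => /eqP t0.
  by move: tU; rewrite t0 unitr0.
have aU : a \isn't a GRing.unit.
  apply: contra a'U => /(rmorph_unit phi); rewrite -aE.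
  by rewrite unitrM => /andP[].
pose F : set (set R') := [set Q | height_one_primes R' Q /\ Q a'].
have : finite_set ((fun Q => phi @^-1` Q) @` F).
  apply: sub_finite_set (fin a a0 aU) => _ [Q [hQ Qa] <-]; split.
    exact: loc_height_one.
  by rewrite /= -aE mulrC; apply: primeMl (height_one_prime hQ) _ _ Qa.
rewrite (eq_finite_set (inj_card_eq _)) // => Q1 Q2 /set_mem[h1 _] /set_mem[h2 _] E.
have p1 := height_one_prime h1; have p2 := height_one_prime h2.
by rewrite eqEsubset; split; apply: loc_preimageS; rewrite ?E.
Qed.

End Localization.

(** * Unique factorization domains *)

Section UniqueFactorization.
Variable R : idomainType.
Implicit Types (a b c p q u : R) (ps qs : seq R).

Definition prime_elt p := [/\ p != 0, p \isn't a GRing.unit &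
  forall a b, dvr p (a * b) -> dvr p a \/ dvr p b].

Definition ufd := forall a, a != 0 -> exists u ps,
  [/\ u \is a GRing.unit, forall p, p \in ps -> prime_elt p &
      a = u * \prod_(p <- ps) p].

Lemma prime_elt_ideal p : prime_elt p -> prime_ideal [set x | dvr p x].
Proof.
move=> [p0 pU pM]; apply/prime_idealE; split=> //=.
- by exists 0; rewrite mul0r.
- by move/unit_dvr; apply/negP.
- by move=> a _ _ [c ->] [d ->]; exists (a * c + d); rewrite mulrDl mulrA.
Qed.

Lemma prime_dvr_prod p u ps : prime_elt p -> u \is a GRing.unit ->
  dvr p (u * \prod_(q <- ps) q) -> exists2 q, q \in ps & dvr p q.
Proof.
move=> pp uU; have pI := prime_elt_ideal pp.
have nu v : v \is a GRing.unit -> ~ dvr p v.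
  by move=> vU pv; have := prime_not_unit pI pv; rewrite vU.
have [_ _ pM] := pp; move=> /pM[/nu//|].
elim: ps => [|q ps IHps]; first by rewrite big_nil => /nu; case; apply: unitr1.
rewrite big_cons => /pM[pq|/IHps[r rps pr]].
  by exists q; rewrite ?mem_head.
by exists r; rewrite ?inE ?rps ?orbT.
Qed.

Lemma prime_dvr_prime p q : prime_elt p -> prime_elt q -> dvr p q ->
  exists2 e, e \is a GRing.unit & q = e * p.
Proof.
move=> [p0 pU _] [q0 _ qM] [e qE]; exists e => //.
have /qM[[k eE]|[k pE]] : dvr q (e * p) by rewrite -qE; apply: dvr_refl.
  case/negP: pU; apply: unit_dvr; exists k.
  by apply: (mulfI q0); rewrite mulr1 {1}qE eE; ring.
apply: unit_dvr; exists k.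
by apply: (mulfI p0); rewrite mulr1 {1}pE qE; ring.
Qed.

Lemma ufd_prime_ideal_mem (P : set R) : ufd -> prime_ideal P ->
  (exists2 x, P x & x != 0) -> exists2 p, prime_elt p & P p.
Proof.
move=> fR pP [x Px /fR[u [ps [uU pps xE]]]]; move: Px; rewrite xE.
move=> /(primeM pP)[Pu|]; first by have := prime_not_unit pP Pu; rewrite uU.
elim: ps pps {xE} => [|p ps IHps] pps; first by rewrite big_nil => /(prime1 pP).
rewrite big_cons => /(primeM pP)[Pp|].
  by exists p => //; apply: pps; rewrite mem_head.
by apply: IHps => q qps; apply: pps; rewrite inE qps orbT.
Qed.

Lemma prime_elt_height_one p : ufd -> prime_elt p ->
  height_one_primes R [set x | dvr p x].
Proof.
move=> fR pp; have [p0 _ _] := pp; apply/height_oneE; split.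
- exact: prime_elt_ideal.
- by exists p => //; apply: dvr_refl.
- move=> Q pQ Q0 Qp; rewrite eqEsubset; split=> // x [c ->].
  have [q qp Qq] := ufd_prime_ideal_mem fR pQ Q0.
  have [e eU qE] := prime_dvr_prime pp qp (Qp _ Qq).
  by apply: primeMl => //; move: Qq; rewrite qE => /(primeMl pQ e^-1); rewrite mulKr.
Qed.

(** The height-one primes are the principal ideals generated by prime elements, so a
    denominator is cancelled one prime factor at a time. *)
Lemma ufd_weakly_Krull : ufd -> weakly_Krull_domain R.
Proof.
move=> fR; apply/weakly_KrullE; split=> [a b /fR[u [ps [uU pps ->]]]|a a0 aU].
  elim: ps a pps => [|p ps IHps] a pps ab.
    by rewrite big_nil mulr1; apply: dvr_unit.
  have pp : prime_elt p by apply: pps; rewrite mem_head.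
  have [p0 pU pM] := pp; move: ab; rewrite big_cons mulrCA => ab.
  have [d pd bd] := ab _ (prime_elt_height_one fR pp).
  have /pM[[a' aE]|/pd//] : dvr p (a * d).
    by apply: dvr_trans bd; exists (u * \prod_(q <- ps) q); rewrite mulrC.
  rewrite aE in ab *; rewrite [p * _]mulrC.
  suff [c ->] : dvr (u * \prod_(q <- ps) q) a' by exists c; rewrite -mulrA.
  apply: IHps => [q qps|P hP]; first by apply: pps; rewrite inE qps orbT.
  have [e Pe [c ape]] := ab P hP; exists e => //; exists c.
  by apply: (mulfI p0); rewrite [RHS]mulrCA -ape; ring.
have [u [ps [uU pps aE]]] := fR a a0.
apply: (@sub_finite_set _ _ ((fun p => [set x | dvr p x]) @` [set` ps])).
  move=> P [hP Pa]; have [pP _ Pmin] := (height_oneE P).1 hP.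
  suff [p pps' Pp] : exists2 p, p \in ps & P p.
    exists p => //; apply: Pmin; first exact/prime_elt_ideal/pps.
      by exists p; [apply: dvr_refl|case: (pps _ pps')].
    by move=> x [c ->]; apply: primeMl.
  move: Pa; rewrite aE => /(primeM pP)[Pu|].
    by have := prime_not_unit pP Pu; rewrite uU.
  elim: ps {pps aE} => [|p ps IHps]; first by rewrite big_nil => /(prime1 pP).
  rewrite big_cons => /(primeM pP)[Pp|/IHps[q qps Pq]].
    by exists p; rewrite ?mem_head.
  by exists q; rewrite ?inE ?qps ?orbT.
by apply: finite_image; apply: finite_seq.
Qed.

(** Every prime of the product divides a or b and is cancelled there. *)
Lemma prime_prod_split ps a b c : (forall p, p \in ps -> prime_elt p) ->
    \prod_(p <- ps) p * c = a * b ->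
  exists d e a' b', [/\ \prod_(p <- ps) p = d * e, a = d * a' & b = e * b'].
Proof.
elim: ps a b => [|p ps IHps] a b pps; rewrite ?big_nil ?big_cons => cE.
  by exists 1, 1, a, b; rewrite !mul1r.
have [p0 _ pM] : prime_elt p by apply: pps; rewrite mem_head.
have {}pps q : q \in ps -> prime_elt q.
  by move=> qps; apply: pps; rewrite inE qps orbT.
have /pM[[a1 aE]|[b1 bE]] : dvr p (a * b).
  by exists (\prod_(q <- ps) q * c); rewrite -cE; ring.
- have [|d [e [a' [b' [dE aE' bE]]]]] := IHps a1 b pps.
    by apply: (mulfI p0); rewrite mulrA cE aE; ring.
  by exists (p * d), e, a', b'; rewrite dE aE aE' -bE; split=> //; ring.
- have [|d [e [a' [b' [dE aE bE']]]]] := IHps a b1 pps.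
    by apply: (mulfI p0); rewrite mulrA cE bE; ring.
  by exists d, (p * e), a', b'; rewrite dE bE bE' -aE; split=> //; ring.
Qed.

Lemma prime_prod_coprime ps a b : (forall p, p \in ps -> prime_elt p) ->
    (forall p, p \in ps -> ~ dvr p a) ->
  dvr (\prod_(p <- ps) p) (a * b) -> dvr (\prod_(p <- ps) p) b.
Proof.
elim: ps b => [|p ps IHps] b pps pa; rewrite ?big_nil ?big_cons => -[c cE].
  exact/dvr_unit/unitr1.
have [p0 _ pM] : prime_elt p by apply: pps; rewrite mem_head.
have /pM[pa'|[b' bE]] : dvr p (a * b).
- by rewrite cE; apply/dvr_mull/dvr_mulr/dvr_refl.
- by case: (pa p); rewrite ?mem_head.
suff [c' b'E] : dvr (\prod_(p <- ps) p) b' by exists c'; rewrite bE b'E; ring.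
apply: IHps => [q qps|q qps|]; first by apply: pps; rewrite inE qps orbT.
  by apply: pa; rewrite inE qps orbT.
by exists c; apply: (mulfI p0); rewrite [RHS]mulrCA -cE bE; ring.
Qed.

End UniqueFactorization.

(** * Gauss's lemma: polynomial rings over unique factorization domains *)

Section GaussLemma.
Variable R : idomainType.
Implicit Types (c p u : R) (f g h : {poly R}) (ps : seq R).

Lemma dvr_polyC p f : dvr p%:P f <-> forall i, dvr p f`_i.
Proof.
split=> [[g ->] i|pf]; first by rewrite coefMC; exists g`_i.
exists (\poly_(i < size f) sval (cid (pf i))); apply/polyP => i.
rewrite coefMC coef_poly; case: ltnP => [_|/(nth_default 0) ->].
  exact: (svalP (cid (pf i))).
by rewrite mul0r.
Qed.

(** The first coefficients of f and g that p does not divide multiply to a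
    coefficient of f * g that p does not divide. *)
Lemma prime_elt_polyC p : prime_elt p -> prime_elt p%:P.
Proof.
move=> pp; have [p0 pU pM] := pp; have pI := prime_elt_ideal pp.
split; first by rewrite polyC_eq0.
  by rewrite poly_unitE size_polyC p0 coefC eqxx.
move=> f g pfg; apply: contrapT => /not_orP[pf pg].
have least h : ~ dvr p%:P h -> exists n, ~ dvr p h`_n /\
    forall i, (i < n)%N -> dvr p h`_i.
  move=> ph; have ex : exists n, `[< ~ dvr p h`_n >].
    apply: contrapT => nex; apply/ph/dvr_polyC => i; apply: contrapT => phi.
    by apply: nex; exists i; apply/asboolP.
  have [n /asboolP pn nmin] := ex_minnP ex; exists n; split=> // i lt_in.
  apply: contrapT => phi; have := nmin i (asboolT phi).
  by rewrite leqNgt lt_in.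
have [n [pfn fmin]] := least f pf; have [m [pgm gmin]] := least g pg.
have /dvr_polyC/(_ (n + m)%N) := pfg; rewrite coefM.
have lt_n : (n < (n + m).+1)%N by rewrite ltnS leq_addr.
rewrite (bigD1 (Ordinal lt_n)) //= addKn => pnm.
suff /pM[] : dvr p (f`_n * g`_m) by [].
rewrite -[_ * _](addrK (\sum_(i < (n + m).+1 | i != Ordinal lt_n)
  f`_i * g`_(n + m - i))).
apply: (primeD pI pnm); apply: (primeN pI); apply: (prime_sum pI) => i.
rewrite -val_eqE /= neq_ltn => /orP[lt_in|lt_ni].
  by apply/dvr_mulr/fmin.
by apply/dvr_mull/gmin; have := ltn_ord i; lia.
Qed.

Hypothesis fR : ufd R.

Definition primitive f := forall p, prime_elt p -> ~ dvr p%:P f.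

(** Prime factors are taken out of f one by one; each of them removes a prime factor
    of the leading coefficient. *)
Lemma primitive_part f : f != 0 ->
  exists c g, [/\ c != 0, primitive g & f = c%:P * g].
Proof.
move=> f0; have lf0 : lead_coef f != 0 by rewrite lead_coef_eq0.
have [u [ps [uU pps]]] := fR lf0.
have [n sz] := ubnP (size ps); elim: n => // n IHn in f f0 lf0 u ps uU pps sz *.
move=> lfE; have [prf|] := pselect (primitive f).
  by exists 1, f; rewrite oner_eq0 mul1r.
move/existsNP => [p /not_implyP[pp /contrapT[g fE]]].
have [p0 _ _] := pp.
have lpE : u * \prod_(q <- ps) q = lead_coef g * p.
  by rewrite -lfE fE lead_coefM lead_coefC.
have [|q qps pq] := @prime_dvr_prod _ p u ps pp uU.
  by rewrite lpE; apply/dvr_mull/dvr_refl.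
have [e eU qE] := prime_dvr_prime pp (pps _ qps) pq.
have g0 : g != 0 by apply: contraNneq f0 => g0; rewrite fE g0 mul0r.
have [|||||c [h [c0 prh gE]]] := IHn g g0 _ (u * e) (rem q ps).
- by rewrite lead_coef_eq0.
- by rewrite unitrM uU.
- by move=> r /mem_rem; apply: pps.
- by rewrite size_rem //; case: (ps) qps sz.
- apply: (mulIf p0); rewrite -lpE (perm_big _ (perm_to_rem qps)) big_cons /= qE.
  by ring.
by exists (p * c), h; rewrite mulf_neq0 // fE gE polyCM; split=> //; ring.
Qed.

Lemma prod_polyC ps : (\prod_(p <- ps) p)%:P = \prod_(f <- map polyC ps) f.
Proof. by rewrite big_map rmorph_prod. Qed.

Lemma map_polyC_prime ps : (forall p, p \in ps -> prime_elt p) ->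
  forall f, f \in map polyC ps -> prime_elt f.
Proof. by move=> pps _ /mapP[p /pps pp ->]; apply: prime_elt_polyC. Qed.

Definition factors f := exists (u : {poly R}) (fs : seq {poly R}),
  [/\ u \is a GRing.unit, forall g, g \in fs -> prime_elt g &
      f = u * \prod_(g <- fs) g].

Lemma factorsM f g : factors f -> factors g -> factors (f * g).
Proof.
move=> [u [fs [uU pfs ->]]] [v [gs [vU pgs ->]]].
exists (u * v), (fs ++ gs); rewrite unitrM uU big_cat mulrACA; split=> // h.
by rewrite mem_cat => /orP[/pfs|/pgs].
Qed.

Lemma factorsC c : c != 0 -> factors c%:P.
Proof.
move=> /fR[u [ps [uU pps ->]]]; exists u%:P, (map polyC ps).
rewrite polyCM prod_polyC rmorph_unit //; split=> //.
exact: map_polyC_prime.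
Qed.

(** Pseudo-division gives divisibility up to a constant factor; the primes of the
    constant do not divide a primitive polynomial, so they cancel. *)
Lemma primitive_irreducible_prime f :
  primitive f -> irreducible_poly f -> prime_elt f.
Proof.
move=> prf [sf irrf]; split.
- by rewrite -size_poly_gt0 ltnW.
- by rewrite poly_unitE gtn_eqF.
have dvdp_dvr g : f %| g -> dvr f g.
  case/Pdiv.WeakIdomain.dvdpP => -[c h] /= c0; rewrite -mul_polyC.
  have [u [ps [uU pps cE]]] := fR c0; rewrite cE polyCM prod_polyC => gE.
  have [|||k hE] := @prime_prod_coprime _ (map polyC ps) f h.
  - exact: map_polyC_prime.
  - by move=> _ /mapP[p /pps/prf pf ->].
  - exists (u%:P * g); rewrite mulrC -gE; ring.
  exists (k * u^-1%:P).
  have P0 : \prod_(q <- map polyC ps) q != 0.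
    rewrite -prod_polyC polyC_eq0; apply: contraNneq c0.
    by rewrite cE => ->; rewrite mulr0.
  have uu : u^-1%:P * u%:P = 1 :> {poly R} by rewrite -polyCM mulVr.
  apply: (mulfI P0); move: gE; rewrite hE.
  move: (u^-1)%:P u%:P (\prod_(_ <- _) _) uu => v w P vw1 gE.
  by rewrite -[LHS]mul1r -vw1 -!mulrA [w * _]mulrA gE; ring.
move=> g h [k ghE].
have := dvdp_gcdl f g; set d := gcdp f g => df.
have [sd|sd] := eqVneq (size d) 1%N.
  right; apply: dvdp_dvr.
  rewrite -(@Pdiv.CommonIdomain.Gauss_dvdpr _ h g) ?ghE ?dvdp_mulIr //.
  by rewrite coprimep_def sd.
left; apply: dvdp_dvr; have := irrf d sd df => /eqp_dvdl <-.
exact: dvdp_gcdr.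
Qed.

(** A primitive polynomial that is reducible up to a constant is a product of two
    primitive polynomials of smaller degree, because the primes of the constant can be
    cancelled in the factors. *)
Lemma ufd_poly : ufd {poly R}.
Proof.
suff prim n f : (size f <= n)%N -> f != 0 -> primitive f -> factors f.
  move=> f f0; have [c [g [c0 prg fE]]] := primitive_part f0.
  rewrite -/(factors f) fE; apply: factorsM; first exact: factorsC.
  apply: (prim (size g)) => //.
  by apply: contraNneq f0 => g0; rewrite fE g0 mulr0.
elim: n f => [|n IHn] f; first by rewrite leqn0 size_poly_eq0 => /eqP->; rewrite eqxx.
move=> sf f0 prf; have [sf1|sf1] := leqP (size f) 1.
  by move: f0; rewrite (size1_polyC sf1) polyC_eq0; apply: factorsC.
have [irr|] := pselect (irreducible_poly f).
  exists 1, [:: f]; rewrite unitr1 big_seq1 mul1r; split=> // g.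
  by rewrite inE => /eqP ->; apply: primitive_irreducible_prime.
move=> nirr.
have [q [sq qf nqf]] : exists q : {poly R}, [/\ size q != 1%N, q %| f & ~~ (q %= f)].
  apply: contrapT => nq; apply: nirr; split=> // q sq qf.
  by apply/negPn/negP => nqf; apply: nq; exists q.
have /Pdiv.WeakIdomain.dvdpP[[c k] /= c0] := qf; rewrite -mul_polyC => cE.
have [u [ps [uU pps cpE]]] := fR c0.
have fE : \prod_(p <- map polyC ps) p * f = u^-1%:P * k * q.
  rewrite -mulrA -cE cpE polyCM prod_polyC.
  have uu : u^-1%:P * u%:P = 1 :> {poly R} by rewrite -polyCM mulVr.
  by rewrite !mulrA uu mul1r.
have [d [e [k1 [q1 [deE kE qE]]]]] := prime_prod_split (map_polyC_prime pps) fE.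
have P0 : \prod_(q <- map polyC ps) q != 0.
  rewrite -prod_polyC polyC_eq0; apply: contraNneq c0.
  by rewrite cpE => ->; rewrite mulr0.
have fkq : f = k1 * q1.
  by apply: (mulfI P0); rewrite fE kE qE deE; ring.
have := P0; rewrite deE mulf_eq0 negb_or => /andP[d0 e0].
have k10 : k1 != 0 by apply: contraNneq f0 => k10; rewrite fkq k10 mul0r.
have q10 : q1 != 0 by apply: contraNneq f0 => q10; rewrite fkq q10 mulr0.
have szC : size e = 1%N.
  have: (size (d * e)%R <= 1)%N by rewrite -deE -prod_polyC size_polyC_leq1.
  rewrite size_mul //; have := size_poly_gt0 d; have := size_poly_gt0 e.
  rewrite d0 e0; case: (size d) => // -[|a]; case: (size e) => // -[|b] //.
  by rewrite addnS.
have szq : size q = size q1 by rewrite qE size_mul // szC.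
have prq : primitive q1.
  by move=> p pp [h hE]; apply: (prf p pp); rewrite fkq hE; exists (k1 * h); ring.
have prk : primitive k1.
  by move=> p pp [h hE]; apply: (prf p pp); rewrite fkq hE; exists (h * q1); ring.
have sfE := size_mul k10 q10; rewrite -fkq in sfE.
have lt_q : (size q1 < size f)%N.
  rewrite -szq ltn_neqAle dvdp_leq // andbT; apply: contra nqf.
  by rewrite (dvdp_size_eqp qf).
have gt_q : (1 < size q1)%N.
  by rewrite ltn_neqAle eq_sym -szq sq szq size_poly_gt0.
have gt_k : (0 < size k1)%N by rewrite size_poly_gt0.
by rewrite fkq; apply: factorsM; apply: IHn => //; lia.
Qed.

End GaussLemma.

(** * Supports and leading exponents in monoid algebras *)

Lemma monomM (D : comNzRingType) (S : nmodType) (c d : D) (s t : S) :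
  monom c s * monom d t = monom (c * d) (s + t).
Proof. exact: alg_mul_monom. Qed.

Lemma acoefN (D : nzRingType) (S : choiceType) (f : {monalg D[S]}) s :
  acoef (- f) s = - acoef f s.
Proof. exact: coef_opp. Qed.

Section Support.
Variables (D : idomainType) (S : tfMonoidType).
Implicit Types (f g h : {monalg D[S]}) (s t u : S) (c d : D) (H : set S) (P : set D).

Lemma monom_eq0 c s : (monom c s == 0) = (c == 0).
Proof.
apply/eqP/eqP => [/algP/(_ s)|->]; last exact: monom0.
by rewrite coef_monom eqxx acoef0.
Qed.

Lemma acoef_monom_neq0 c s t : acoef (monom c s) t != 0 -> t = s.
Proof. by rewrite coef_monom; have [->|] := eqVneq t s; rewrite ?eqxx. Qed.

Lemma monom_unit c s t : c \is a GRing.unit -> s + t = 0 ->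
  monom c s \is a GRing.unit.
Proof.
move=> cU st; apply: unit_dvr; exists (monom c^-1 t).
by rewrite monomM mulVr // addrC st.
Qed.

Lemma monomX c s n : monom c s ^+ n = monom (c ^+ n) (s *+ n).
Proof.
elim: n => [|n IHn]; first by rewrite !expr0 mulr0n.
by rewrite !exprS IHn monomM mulrS.
Qed.

Lemma monom_is_zmod_morphism : zmod_morphism (fun c : D => monom c (0 : S)).
Proof.
move=> c d; rewrite monomD; congr (_ + _); apply/algP => s.
by rewrite acoefN !coef_monom; case: ifP; rewrite ?oppr0.
Qed.

Lemma monom_is_monoid_morphism : monoid_morphism (fun c : D => monom c (0 : S)).
Proof. by split=> // c d; rewrite monomM addr0. Qed.

Definition scalar_monom (c : D) : {monalg D[S]} := monom c 0.

HB.instance Definition _ := GRing.isZmodMorphism.Build D {monalg D[S]} scalar_monom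
  monom_is_zmod_morphism.
HB.instance Definition _ := GRing.isMonoidMorphism.Build D {monalg D[S]} scalar_monom
  monom_is_monoid_morphism.

Lemma acoef_monomM c s f t : acoef (monom c s * f) (s + t) = c * acoef f t.
Proof.
elim/alg_ind: f => [|d u|f g IHf IHg].
- by rewrite mulr0 !acoef0 mulr0.
- rewrite monomM !coef_monom (inj_eq (@addm_inj S s)).
  by case: eqP; rewrite ?mulr0.
- by rewrite mulrDr !acoefD IHf IHg mulrDr.
Qed.

Lemma acoefM_neq0 f g u : acoef (f * g) u != 0 ->
  exists s t, [/\ acoef f s != 0, acoef g t != 0 & u = s + t].
Proof.
move=> fg0; apply: contrapT => nst; case/eqP: fg0; rewrite acoefM.
rewrite big_seq big1 // => s; rewrite mem_asupp => fs.
rewrite big_seq big1 // => t; rewrite mem_asupp => gt.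
by case: eqP => // uE; case: nst; exists s, t.
Qed.

Lemma alg_neq0 f : f != 0 -> exists s, acoef f s != 0.
Proof.
move=> f0; apply: contrapT => nf; case/eqP: f0; apply/algP => s.
by rewrite acoef0; apply/eqP/negPn/negP => fs; apply: nf; exists s.
Qed.

Definition alg_restrict (p : pred S) f : {monalg D[S]} :=
  MonAlg [fsfun s in asupp f => if p s then acoef f s else 0].

Lemma acoef_alg_restrict p f s :
  acoef (alg_restrict p f) s = if p s then acoef f s else 0.
Proof.
rewrite /acoef fsfun_fun -/(acoef f s); case: ifPn => // /acoef_dflt ->.
by rewrite if_same.
Qed.

Lemma alg_restrictC p f : f = alg_restrict p f + alg_restrict (predC p) f.
Proof.
apply/algP => s; rewrite acoefD !acoef_alg_restrict /=.
by case: (p s); rewrite ?addr0 ?add0r.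
Qed.

Lemma sum_monom_filter (p : pred S) f :
  \sum_(w <- [seq monom (acoef f s) s | s <- asupp f & p s]) w = alg_restrict p f.
Proof.
apply/algP => s; rewrite acoef_alg_restrict acoef_sum big_map big_filter.
have [sf|sf] := boolP (s \in asupp f); last first.
  rewrite (acoef_dflt sf) if_same big_seq_cond big1 // => t /andP[tf _].
  by rewrite coef_monom; case: eqP => // st; rewrite st tf in sf.
rewrite big_mkcond (big_fsetD1 s) //= coef_monom eqxx big_seq big1 ?addr0 // => t.
rewrite in_fsetD1 coef_monom eq_sym => /andP[/negPf -> _].
by rewrite if_same.
Qed.

Lemma mul_main_parts (R : comNzRingType) (f g f1 f2 g1 g2 : R) :
  f = f1 + f2 -> g = g1 + g2 -> f1 * g1 = f * g + (- g * f2 + - f1 * g2).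
Proof. by move=> -> ->; ring. Qed.

Lemma exp_extE H f : exp_ext H f <-> forall s, acoef f s != 0 -> H s.
Proof.
split=> [[r rH ->] s|fH].
  rewrite acoef_sum => rs; apply: contrapT => nHs; case/eqP: rs.
  rewrite big_seq big1 // => x xr; rewrite coef_monom; case: eqP => // sx.
  by case: nHs; rewrite sx; case: (rH x xr).
exists [seq (acoef f s, s) | s <- asupp f]; last by rewrite big_map -alg_sum_monom.
by move=> _ /mapP[s sf ->] /=; split=> //; apply: fH; rewrite -mem_asupp.
Qed.

Lemma coef_extE P f : prime_ideal P -> coef_ext P f <-> forall s, P (acoef f s).
Proof.
move=> pP; split=> [[r rP ->] s|fP].
  rewrite acoef_sum big_seq; apply: (prime_sum pP) => x xr.
  rewrite coef_monom; case: ifP => _; last exact: prime0.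
  by case: (rP x xr).
exists [seq (acoef f s, s) | s <- asupp f]; last by rewrite big_map -alg_sum_monom.
by move=> _ /mapP[s sf ->]; split=> //; apply: fP.
Qed.

Lemma exp_ext_monom H c s : c != 0 -> exp_ext H (monom c s) <-> H s.
Proof.
move=> c0; split=> [/exp_extE/(_ s)|Hs]; first by rewrite coef_monom eqxx; apply.
by apply/exp_extE => t; rewrite coef_monom; have [->|] := eqVneq t s; rewrite ?eqxx.
Qed.

Lemma coef_ext_monom P c s : prime_ideal P -> coef_ext P (monom c s) <-> P c.
Proof.
move=> pP; split=> [/(coef_extE _ pP)/(_ s)|Pc]; first by rewrite coef_monom eqxx.
apply/(coef_extE _ pP) => t; rewrite coef_monom; case: ifP => // _; exact: prime0.
Qed.

(** Modulo D[H] both factors may be replaced by their terms with exponent outside H;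
    the product of what remains is nonzero and has no exponent in H. *)
Lemma exp_ext_prime H : monoid_prime_ideal H ->
  prime_ideal (exp_ext H : set {monalg D[S]}).
Proof.
move=> [HI HT HP].
have HIr a b : H b -> H (a + b) by rewrite addrC; apply: HI.
have H0 : ~ H 0.
  by move=> H0; apply: HT; rewrite -subTset => s _; rewrite -(add0r s); apply: HI.
have mulH f g : exp_ext H f -> exp_ext H (g * f).
  move=> /exp_extE fH; apply/exp_extE => u /acoefM_neq0[s [t [_ /fH Ht ->]]].
  exact: HIr.
have addH f g : exp_ext H f -> exp_ext H g -> exp_ext H (f + g).
  move=> /exp_extE fH /exp_extE gH; apply/exp_extE => s; rewrite acoefD.
  by have [->|/fH//] := eqVneq (acoef f s) 0; rewrite add0r; apply: gH.
apply/prime_idealE; split.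
- by apply/exp_extE => s; rewrite acoef0 eqxx.
- by move/exp_extE/(_ 0); rewrite coef_monom eqxx oner_eq0 => /(_ isT).
- by move=> a f g Hf Hg; apply: addH => //; apply: mulH.
- move=> f g fgH; apply: contrapT => /not_orP[nf ng].
  pose p s := `[< ~ H s >].
  have inp h s : acoef (alg_restrict p h) s != 0 -> ~ H s.
    by rewrite acoef_alg_restrict /p; case: asboolP; rewrite ?eqxx.
  have out h : exp_ext H (alg_restrict (predC p) h).
    apply/exp_extE => s; rewrite acoef_alg_restrict /= /p asbool_neg negbK.
    by case: asboolP; rewrite ?eqxx.
  have res0 h : ~ exp_ext H h -> alg_restrict p h != 0.
    move=> nh; apply/eqP => h0; apply: nh; rewrite (alg_restrictC p h) h0 add0r.
    exact: out.
  have : alg_restrict p f * alg_restrict p g != 0 by rewrite mulf_neq0 ?res0.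
  case/alg_neq0 => u fgu; have := fgu; case/acoefM_neq0 => s [t []].
  move=> /inp Hs /inp Ht uE.
  suff /exp_extE/(_ u fgu) : exp_ext H (alg_restrict p f * alg_restrict p g).
    by rewrite uE => /HP[].
  rewrite (mul_main_parts (alg_restrictC p f) (alg_restrictC p g)).
  by apply: (addH) => //; apply: addH; apply: mulH; apply: out.
Qed.

Section LeadingExponent.
Variable lt : S -> S -> Prop.

Definition mon_order := [/\ forall x, ~ lt x x,
      forall x y z, lt x y -> lt y z -> lt x z,
      forall x y, x != y -> lt x y \/ lt y x &
      forall x y z, lt x y -> lt (z + x) (z + y)].

Definition leading f m :=
  acoef f m != 0 /\ forall s, acoef f s != 0 -> s != m -> lt s m.

Hypothesis ltO : mon_order.

Lemma leading_exists f : f != 0 -> exists m, leading f m.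
Proof.
have [_ tr tot _] := ltO; move=> f0.
suff ex (r : seq S) : r != [::] ->
    exists2 m, m \in r & forall s, s \in r -> s != m -> lt s m.
  have [|m mf fm] := ex (asupp f).
    have [s fs] := alg_neq0 f0; apply/eqP => r0.
    suff : s \in (asupp f : seq S) by rewrite r0.
    by rewrite -[_ \in _]/(s \in asupp f) mem_asupp.
  exists m; split; first by rewrite -mem_asupp.
  by move=> s; rewrite -mem_asupp; apply: fm.
elim: r => // a [_ _|b r IHr _].
  exists a; rewrite ?mem_head // => s; rewrite inE => /eqP ->.
  by rewrite eqxx.
have [//|m mr mmax] := IHr.
have [ma|ma] := eqVneq a m.
  exists m; rewrite ?ma ?mem_head // => s; rewrite inE => /orP[/eqP ->|].
    by rewrite eqxx.
  exact: mmax.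
have [am|mlta] := tot _ _ ma.
  exists m; first by rewrite inE mr orbT.
  move=> s; rewrite inE => /orP[/eqP -> //|]; exact: mmax.
exists a; first by rewrite mem_head.
move=> s; rewrite inE => /orP[/eqP ->|sr _]; first by rewrite eqxx.
by have [-> //|/(mmax _ sr) sm] := eqVneq s m; apply: tr mlta.
Qed.

Lemma leading_uniq f m n : leading f m -> leading f n -> m = n.
Proof.
have [irr tr _ _] := ltO; move=> [fm mmax] [fn nmax].
apply/eqP/negPn/negP => mn; apply: (irr m); apply: (tr _ n); first exact: nmax.
by apply: mmax => //; rewrite eq_sym.
Qed.

Lemma lt_leading_add f g m n s t : leading f m -> leading g n ->
  acoef f s != 0 -> acoef g t != 0 ->
  (s = m /\ t = n) \/ lt (s + t) (m + n).
Proof.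
have [irr tr _ ltD] := ltO; move=> [fm mmax] [gn nmax] fs gt.
have [->|sm] := eqVneq s m; have [->|tn] := eqVneq t n; [by left|right|right|right].
- exact/ltD/nmax.
- by rewrite ![_ + n]addrC; apply/ltD/mmax.
- apply: (tr _ (s + n)); first exact/ltD/nmax.
  by rewrite ![_ + n]addrC; apply/ltD/mmax.
Qed.

(** The sum of the leading exponents of f and g is reached only once among the sums of
    their exponents, so no cancellation occurs there. *)
Lemma leadingM f g m n : leading f m -> leading g n ->
  acoef (f * g) (m + n) = acoef f m * acoef g n /\ leading (f * g) (m + n).
Proof.
move=> fm gn; have [irr _ _ _] := ltO.
have coefE : acoef (f * g) (m + n) = acoef f m * acoef g n.
  pose f' := alg_restrict (predC (pred1 m)) f.
  have fE : f = monom (acoef f m) m + f'.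
    apply/algP => s; rewrite acoefD coef_monom acoef_alg_restrict /=.
    by case: eqP => [->|_]; rewrite ?addr0 ?add0r.
  rewrite {1}fE mulrDl acoefD acoef_monomM -[RHS]addr0; congr (_ + _).
  apply/eqP/negPn/negP => /acoefM_neq0[s [t [f's gt mnE]]].
  have [sm fs] : s != m /\ acoef f s != 0.
    by move: f's; rewrite acoef_alg_restrict /=; case: ifP; rewrite ?eqxx.
  have [[sE]|] := lt_leading_add fm gn fs gt; first by rewrite sE eqxx in sm.
  by rewrite -mnE => /irr.
split=> //; split; first by rewrite coefE mulf_neq0 //; [case: fm|case: gn].
move=> _ /acoefM_neq0[s [t [fs gt ->]]].
by have [[-> ->]|//] := lt_leading_add fm gn fs gt; rewrite eqxx.
Qed.

End LeadingExponent.

(** Modulo P[S] both factors may be replaced by their terms with coefficient outside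
    P; the leading coefficients of what remains multiply to an element outside P. *)
Lemma coef_ext_prime P : prime_ideal P ->
  prime_ideal (coef_ext P : set {monalg D[S]}).
Proof.
move=> pP; have [lt ltO] := tfMonoid_order S.
have mulP f g : coef_ext P f -> coef_ext P (g * f).
  move=> /(coef_extE _ pP) fP; apply/(coef_extE _ pP) => u; rewrite acoefM.
  do 2![apply: (prime_sum pP) => ? _]; case: ifP => _; last exact: prime0.
  exact: primeMl.
have addP f g : coef_ext P f -> coef_ext P g -> coef_ext P (f + g).
  move=> /(coef_extE _ pP) fP /(coef_extE _ pP) gP; apply/(coef_extE _ pP) => s.
  by rewrite acoefD; apply: primeD.
apply/prime_idealE; split.
- by apply/(coef_extE _ pP) => s; rewrite acoef0; apply: prime0.
- by move/(coef_extE _ pP)/(_ 0); rewrite coef_monom eqxx => /(prime1 pP).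
- by move=> a f g Pf Pg; apply: addP => //; apply: mulP.
- move=> f g fgP; apply: contrapT => /not_orP[nf ng].
  pose p h s := `[< ~ P (acoef h s) >].
  have inP h : coef_ext P (alg_restrict (predC (p h)) h).
    apply/(coef_extE _ pP) => s; rewrite acoef_alg_restrict /= /p asbool_neg negbK.
    by case: asboolP => // _; apply: prime0.
  have res0 h : ~ coef_ext P h -> exists m, leading lt (alg_restrict (p h) h) m.
    move=> nh; apply: (leading_exists ltO); apply/eqP => h0; apply: nh.
    by rewrite (alg_restrictC (p h) h) h0 add0r.
  have [m fm] := res0 f nf; have [n gn] := res0 g ng.
  have outP h k : acoef (alg_restrict (p h) h) k != 0 ->
      ~ P (acoef (alg_restrict (p h) h) k).
    by rewrite acoef_alg_restrict /p; case: asboolP; rewrite ?eqxx.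
  have [E _] := leadingM ltO fm gn.
  suff /(coef_extE _ pP)/(_ (m + n)) :
      coef_ext P (alg_restrict (p f) f * alg_restrict (p g) g).
    by rewrite E => /(primeM pP)[]; apply: outP; [case: fm|case: gn].
  rewrite (mul_main_parts (alg_restrictC (p f) f) (alg_restrictC (p g) g)).
  by apply: (addP) => //; apply: addP; apply: mulP; apply: inP.
Qed.

End Support.

(** * Torsion-free abelian groups and their orders *)

#[short(type="tfGroupType")]
HB.structure Definition TfGroup :=
  { G of isTorsionFreeMonoid G & GRing.Zmodule G }.

(* Quotient groups carry both structures, which were declared before their join. *)
HB.saturate QuotientGroup.type.

Section TorsionFreeGroup.
Variable G : tfGroupType.
Implicit Types (x y z d : G) (C M P : set G) (E : seq G).

Lemma mulrn_inj n : injective (fun x : G => x *+ n.+1).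
Proof. by move=> x y; apply: mulmn_inj. Qed.

Lemma mulrn_eq0P x n : x *+ n.+1 = 0 -> x = 0.
Proof. by move=> xn0; apply: (@mulrn_inj n); rewrite xn0 mul0rn. Qed.

Lemma mulrz_inj x y (k : int) : k != 0 -> x *~ k = y *~ k -> x = y.
Proof.
case: k => [[|n]|n] // _; first exact: mulrn_inj.
by rewrite !NegzE !mulrNz => /oppr_inj/mulrn_inj.
Qed.

Lemma mulrz_injl x : x != 0 -> injective (fun k : int => x *~ k).
Proof.
move=> x0 k l /eqP; rewrite -subr_eq0 -mulrzBr => /eqP xkl.
apply/eqP; rewrite -subr_eq0; apply: contraNT x0 => kl.
by apply/eqP/(mulrz_inj kl); rewrite xkl mul0rz.
Qed.

Definition pure_subgroup M := [/\ M 0, forall x y, M x -> M y -> M (x - y) &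
  forall n x, M (x *+ n.+1) -> M x].

(** A subsemigroup that is maximal among those containing P and disjoint from M is the
    set of positive elements of a total order on G/M. *)
Lemma total_cone M P : pure_subgroup M ->
    (forall x y, P x -> P y -> P (x + y)) -> (forall x, P x -> ~ M x) ->
  exists C, [/\ P `<=` C, forall x y, C x -> C y -> C (x + y),
    forall x, C x -> ~ M x & forall x, ~ M x -> C x \/ C (- x)].
Proof.
move=> [M0 MB Mpure] PD PM.
pose good C := [/\ forall x y, C x -> C y -> C (x + y), forall x, C x -> ~ M x &
  C = set0 \/ P `<=` C].
have [F FA Ftot|C [[CD CM PC] Cmax]] := @Zorn_bigcup G good.
  split=> [x y [X FX Xx] [Y FY Yy]|x [X FX Xx]|].
  - have [XY|YX] := Ftot _ _ FX FY.
      by exists Y => //; have [YD _ _] := FA _ FY; apply: YD => //; apply: XY.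
    by exists X => //; have [XD _ _] := FA _ FX; apply: XD => //; apply: YX.
  - by have [_ XM _] := FA _ FX; apply: XM.
  - have [[X FX X0]|nF] := pselect (exists2 X, F X & X !=set0).
      right=> x Px; exists X => //; have [_ _ [XE|]] := FA _ FX; last exact.
      by case: X0 => z; rewrite XE.
    left; rewrite -subset0 => x [X FX Xx]; apply: nF.
    by exists X => //; exists x.
have {}PC : P `<=` C.
  case: PC => // C0; apply: contrapT => PC; apply: (Cmax P); last by split=> //; right.
  by rewrite C0; split=> // P0; apply: PC; rewrite C0.
have CMn x n : C x -> C (x *+ n.+1).
  move=> Cx; elim: n => [|n IHn]; first by rewrite mulr1n.
  by rewrite mulrS; apply: CD.
(* Adjoining x to C as a new positive element must meet M. *)
have key x : ~ M x -> ~ C x -> exists n c, C c /\ M (c + x *+ n.+1).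
  move=> Mx nCx; apply: contrapT => nc.
  pose C' := [set y | exists c n, [/\ C c \/ c = 0, C c \/ (0 < n)%N & y = c + x *+ n]].
  apply: (Cmax C').
    split=> [c Cc|/(_ x)].
      by exists c, 0%N; rewrite mulr0n addr0; split=> //; left.
    move=> C'x; apply/nCx/C'x.
    by exists 0, 1%N; rewrite add0r mulr1n; split=> //; right.
  split.
  - move=> _ _ [c [n [Cc cn ->]]] [d [m [Cd dm ->]]]; exists (c + d), (n + m)%N.
    rewrite mulrnDr addrACA; split=> //.
      case: Cc => [Cc|->]; case: Cd => [Cd|->]; rewrite ?addr0 ?add0r; try by left.
      + by left; apply: CD.
      + by right.
    case: cn => [{Cc}Cc|n0]; last by right; rewrite addn_gt0 n0.
    case: Cd => [Cd|->]; last by left; rewrite addr0.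
    by left; apply: CD.
  - move=> _ [c [[|n] [Cc cn ->]]]; rewrite ?mulr0n ?addr0.
      by case: cn => // /CM.
    case: Cc => [Cc|->]; first by move=> Mcx; apply: nc; exists n, c.
    by rewrite add0r => /Mpure.
  - by right=> y /PC Cy; exists y, 0%N; rewrite mulr0n addr0; split=> //; left.
exists C; split=> // x Mx; apply: contrapT => /not_orP[nCx nCNx].
have [n [c [Cc Mcx]]] := key x Mx nCx.
have [|m [d [Cd Mdx]]] := key (- x) _ nCNx.
  by move=> MNx; apply: Mx; rewrite -[x]opprK -sub0r; apply: MB.
have MN z : M z -> M (- z) by rewrite -sub0r; apply: MB.
have MD z t : M z -> M t -> M (z + t) by move=> Mz /MN; rewrite -{2}[t]opprK; apply: MB.
have MMn z k : M z -> M (z *+ k).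
  by move=> Mz; elim: k => [|k IHk]; rewrite ?mulr0n // mulrS; apply: MD.
apply: (CM (c *+ m.+1 + d *+ n.+1)); first by apply: CD; apply: CMn.
have := MD _ _ (MMn _ m.+1 Mcx) (MMn _ n.+1 Mdx).
by rewrite !mulrnDl addrACA mulNrn mulNrn -!mulrnA [(m.+1 * _)%N]mulnC subrr addr0.
Qed.

Definition cone_lt C x y := C (y - x).

Lemma cone_lt_order C : (forall x y, C x -> C y -> C (x + y)) -> ~ C 0 ->
  (forall x, x != 0 -> C x \/ C (- x)) -> mon_order (cone_lt C).
Proof.
move=> CD C0 Ctot; rewrite /cone_lt; split.
- by move=> x; rewrite subrr.
- by move=> x y z xy yz; rewrite -[z](subrK y) -addrA; apply: CD.
- by move=> x y xy; rewrite -[x - y]opprB; apply: Ctot; rewrite subr_eq0 eq_sym.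
- by move=> x y z; rewrite opprD addrACA subrr add0r.
Qed.

Fixpoint ncone E : set G :=
  if E is e :: E' then [set z | exists k z', ncone E' z' /\ z = e *+ k + z']
  else [set 0].

Lemma ncone0 E : ncone E 0.
Proof. by elim: E => //= e E IHE; exists 0%N, 0; rewrite mulr0n addr0. Qed.

Lemma nconeD E x y : ncone E x -> ncone E y -> ncone E (x + y).
Proof.
elim: E x y => [|e E IHE] x y /=; first by move=> -> ->; rewrite addr0.
move=> [k [x' [Ex ->]]] [l [y' [Ey ->]]]; exists (k + l)%N, (x' + y').
by rewrite mulrnDr addrACA; split=> //; apply: IHE.
Qed.

Lemma nconeMn E x n : ncone E x -> ncone E (x *+ n).
Proof.
move=> Ex; elim: n => [|n IHn]; first by rewrite mulr0n; apply: ncone0.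
by rewrite mulrS; apply: nconeD.
Qed.

Lemma ncone_mem E x : x \in E -> ncone E x.
Proof.
elim: E => //= e E IHE; rewrite inE => /orP[/eqP ->|/IHE Ex].
  by exists 1%N, 0; rewrite mulr1n addr0; split=> //; apply: ncone0.
by exists 0%N, x; rewrite mulr0n add0r.
Qed.

Lemma ncone_pos E C x : (forall x y, C x -> C y -> C (x + y)) ->
  (forall e, e \in E -> C e) -> ncone E x -> x = 0 \/ C x.
Proof.
move=> CD; elim: E x => [|e E IHE] x EC /=; first by left.
move=> [k [z [Ez ->]]].
have CMn n : C (e *+ n.+1).
  elim: n => [|n IHn]; first by rewrite mulr1n; apply: EC; rewrite mem_head.
  by rewrite mulrS; apply: CD => //; apply: EC; rewrite mem_head.
have [|z0|Cz] := IHE z _ Ez.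
- by move=> y yE; apply: EC; rewrite inE yE orbT.
- by rewrite z0 addr0; case: k => [|k]; [left; rewrite mulr0n|right].
- by right; case: k => [|k]; [rewrite mulr0n add0r|apply: CD].
Qed.

(** In a list of minimal length that generates the cone of E up to multiples, no
    element has a multiple in the cone of the others. When the cone of E contains no
    line, the first element of the list spans an extremal ray. *)
Lemma extremal_ray E : (exists2 d, d \in E & d != 0) -> exists d0 E',
  [/\ d0 \in E, {subset E' <= E},
    forall d, d \in E -> exists n, ncone (d0 :: E') (d *+ n.+1) &
    forall n, ~ ncone E' (d0 *+ n.+1)].
Proof.
move=> [d1 d1E d10].
pose gen F := {subset F <= E} /\ forall d, d \in E -> exists n, ncone F (d *+ n.+1).
have ex : exists n, `[< exists2 F, gen F & size F = n >].
  exists (size E); apply/asboolP; exists E => //; split=> // d dE.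
  by exists 0%N; rewrite mulr1n; apply: ncone_mem.
have [n /asboolP[F [FE Fgen] Fn] nmin] := ex_minnP ex.
case: F FE Fgen Fn => [|d0 E'] FE Fgen Fn.
  have [k /= /mulrn_eq0P d1E0] := Fgen _ d1E.
  by rewrite d1E0 eqxx in d10.
exists d0, E'; split=> //; first by apply: FE; rewrite mem_head.
  by move=> e eE; apply: FE; rewrite inE eE orbT.
move=> m Ed0; suff /nmin : `[< exists2 F, gen F & size F = size E' >].
  by rewrite -Fn /= ltnn.
apply/asboolP; exists E' => //; split.
  by move=> e eE; apply: FE; rewrite inE eE orbT.
move=> d /Fgen[k [l [z [Ez dE]]]]; exists (k.+1 * m.+1).-1.
rewrite prednK ?muln_gt0 // mulrnA dE mulrnDl; apply: nconeD.
  by rewrite -mulrnA mulnC mulrnA; apply: nconeMn.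
exact: nconeMn.
Qed.

End TorsionFreeGroup.

(** * Edges of Newton polytopes *)

Section Edges.
Variables (K : idomainType) (G : tfGroupType).
Implicit Types (f g h : {monalg K[G]}) (x y : G).

(** The relation between the orders that single out the two ends of an edge: they
    disagree only along the direction d0 of that edge. *)
Definition adjacent (lt1 lt2 : G -> G -> Prop) := exists d0, forall x,
  lt1 0 x -> lt2 x 0 -> exists m n, x *+ m.+1 = d0 *+ n.+1.

(** An edge of the Newton polytope of f. Let m1 be the vertex singled out by some
    order, and let d0 be an extremal direction of the cone spanned by the differences
    m1 - a, for a in the support of f. There is a total order modulo d0 for which these
    differences are nonnegative; it is completed in two ways along d0. *)
Lemma exists_edge f s t : s != t -> acoef f s != 0 -> acoef f t != 0 ->
  exists lt1 lt2 m1 m2, [/\ mon_order lt1, mon_order lt2, adjacent lt1 lt2,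
    leading lt1 f m1 /\ leading lt2 f m2 & m1 <> m2].
Proof.
move=> st fs ft.
have [|||C0 [_ C0D C0n C0tot]] := @total_cone G [set 0] set0; [|by []|by []|].
  split=> //= [x y -> ->|n x]; [by rewrite subr0|exact: mulrn_eq0P].
have {}C0n : ~ C0 0 by move/C0n; apply.
have C0Mn x n : C0 x -> C0 (x *+ n.+1).
  move=> Cx; elim: n => [|n IHn]; first by rewrite mulr1n.
  by rewrite mulrS; apply: C0D.
have f0 : f != 0 by apply: contraNneq fs => ->; rewrite acoef0.
have {}C0tot x : x != 0 -> C0 x \/ C0 (- x) by move=> /eqP x0; apply: C0tot.
have [m1 [fm1 m1max]] := leading_exists (cone_lt_order C0D C0n C0tot) f0.
pose ds := [seq m1 - a | a <- asupp f & a != m1].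
have dsP d : d \in ds -> exists a, [/\ acoef f a != 0, a != m1 & d = m1 - a].
  case/mapP => a; rewrite mem_filter => /andP[am1 af] ->; exists a.
  by rewrite -mem_asupp.
have ds_mem a : acoef f a != 0 -> a != m1 -> m1 - a \in ds.
  move=> fa am1; apply: map_f.
  by rewrite mem_filter am1 -[_ \in _]/(a \in asupp f) mem_asupp.
have dsC0 d : d \in ds -> C0 d by move=> /dsP[a [fa am1 ->]]; apply: m1max.
have [|d0 [E [d0ds Eds Egen Eext]]] := @extremal_ray G ds.
  have [a [fa am1]] : exists a, acoef f a != 0 /\ a != m1.
    have [sm|sm] := eqVneq s m1; last by exists s.
    by exists t; split=> //; rewrite -sm eq_sym.
  by exists (m1 - a); rewrite ?ds_mem // subr_eq0 eq_sym.
have C0d0 := dsC0 _ d0ds.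
have C0E e : e \in E -> C0 e by move/Eds/dsC0.
have d00 : d0 != 0 by apply/eqP => d00; apply: C0n; rewrite -d00.
(* The pure closure of the line through d0. *)
pose M := [set y | exists m (k : int), y *+ m.+1 = d0 *~ k].
have pM : pure_subgroup M.
  split.
  - by exists 0%N, 0; rewrite mul0rn mulr0z.
  - move=> x y [m [k xE]] [n [l yE]]; exists (m.+1 * n.+1).-1, (k * n.+1 - l * m.+1).
    rewrite prednK ?muln_gt0 // mulrnBl mulrnA xE mulnC mulrnA yE.
    by rewrite mulrzBr !mulrzA.
  - move=> n x [m [k xE]]; exists (n.+1 * m.+1).-1, k.
    by rewrite prednK ?muln_gt0 // mulrnA.
have [M0 MB Mpure] := pM.
have MN y : M y -> M (- y) by rewrite -sub0r; apply: MB.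
have MD y z : M y -> M z -> M (y + z).
  by move=> My /MN; rewrite -{2}[z]opprK; apply: MB.
have pos_int x m (k : int) : C0 x -> x *+ m.+1 = d0 *~ k -> exists n, k = n.+1.
  move=> C0x xE; have C0xm := C0Mn _ m C0x; case: k xE => [[|n]|n] xE.
  - by case: C0n; move: C0xm; rewrite xE.
  - by exists n.
  - case: C0n; rewrite -(addrN (d0 *~ Negz n)); apply: C0D; first by rewrite -xE.
    by rewrite NegzE mulrNz opprK; apply: C0Mn.
(* The elements of the cone spanned by the differences that do not lie in M, up to
   multiples of d0; extremality of d0 makes this set disjoint from M. *)
pose P := [set y | exists N (k : int) z,
  [/\ ncone E z, C0 z & y *+ N.+1 = d0 *~ k + z]].
have [|y|C [PC CD CM Ctot]] := @total_cone G M P pM.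
- move=> y y' [N [k [z [Ez Cz yE]]]] [N' [k' [z' [Ez' Cz' yE']]]].
  exists (N.+1 * N'.+1).-1, (k * N'.+1 + k' * N.+1), (z *+ N'.+1 + z' *+ N.+1).
  split; [by apply: nconeD; apply: nconeMn|by apply: C0D; apply: C0Mn|].
  rewrite prednK ?muln_gt0 // mulrnDl mulrnA yE mulnC mulrnA yE' !mulrnDl.
  by rewrite mulrzDr !mulrzA addrACA.
- move=> [N [k [z [Ez Cz yE]]]] [m [l yE']].
  have zE : z *+ m.+1 = d0 *~ (l * N.+1 - k * m.+1).
    rewrite mulrzBr !mulrzA -[d0 *~ l *~ _]/(d0 *~ l *+ N.+1) -yE'.
    by rewrite -mulrnA mulnC mulrnA yE mulrnDl addrAC subrr add0r.
  have [n nE] := pos_int _ _ _ Cz zE.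
  by apply: (Eext n); rewrite -[_ *+ _]/(d0 *~ n.+1) -nE -zE; apply: nconeMn.
(* Along d0 the first order is positive and the second one negative. *)
pose pos := [set y | exists m n, y *+ m.+1 = d0 *+ n.+1].
have posM y : pos y -> M y by move=> [m [n yE]]; exists m, n.+1.
have posD x y : pos x -> pos y -> pos (x + y).
  move=> [m [n xE]] [k [l yE]].
  exists (m.+1 * k.+1).-1, (n.+1 * k.+1 + l.+1 * m.+1).-1.
  rewrite !prednK ?muln_gt0 // ?addn_gt0 ?muln_gt0 // mulrnDl mulrnA xE mulnC.
  by rewrite mulrnA yE -!mulrnA mulrnDr.
have pos0 : ~ pos 0.
  by move=> [m [n]]; rewrite mul0rn => /esym/mulrn_eq0P d0E; rewrite d0E eqxx in d00.
have posT x : x != 0 -> M x -> pos x \/ pos (- x).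
  move=> x0 [m [[[|k]|k] xE]].
  - by move: xE => /mulrn_eq0P xE; rewrite xE eqxx in x0.
  - by left; exists m, k.
  - by right; exists m, k; rewrite mulNrn xE NegzE mulrNz opprK.
have CMD c y : C c -> M y -> C (c + y).
  move=> Cc My; have ncy : ~ M (c + y).
    by move=> Mcy; apply: (CM c) => //; rewrite -[c](addrK y); apply: MB.
  have [//|CN] := Ctot _ ncy; case: (CM (- y)); last exact: MN.
  by rewrite -[- y]sub0r -(subrr c) -addrA -opprD; apply: CD.
have coneO (pos' : set G) : (forall x, pos' x -> M x) ->
    (forall x y, pos' x -> pos' y -> pos' (x + y)) -> ~ pos' 0 ->
    (forall x, x != 0 -> M x -> pos' x \/ pos' (- x)) ->
    mon_order (cone_lt (C `|` pos')).
  move=> pos'M pos'D pos'0 pos'T; apply: cone_lt_order.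
  - move=> x y [Cx|px] [Cy|py]; [left|left|left|right].
    + exact: CD.
    + by apply: CMD => //; apply: pos'M.
    + by rewrite addrC; apply: CMD => //; apply: pos'M.
    + exact: pos'D.
  - by move=> [/CM|].
  - move=> x x0; have [/(pos'T _ x0)[]|/Ctot[]] := pselect (M x).
    + by left; right.
    + by right; right.
    + by left; left.
    + by right; left.
pose neg := [set y | pos (- y)].
have O1 := coneO pos posM posD pos0 posT.
have O2 : mon_order (cone_lt (C `|` neg)).
  apply: coneO => [x /posM/MN|x y nx ny||x x0 Mx].
  - by rewrite opprK.
  - by rewrite /neg /= opprD; apply: posD.
  - by rewrite /neg /= oppr0.
  - by rewrite /neg /= opprK; case: (posT x x0 Mx); [right|left].
have [m2 fm2] := leading_exists O2 f0.
exists (cone_lt (C `|` pos)), (cone_lt (C `|` neg)), m1, m2; split=> //.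
- exists d0 => x; rewrite /cone_lt subr0 sub0r => -[Cx|[m [n xE]]]; last by exists m, n.
  case=> [CNx|]; first by case: (CM 0) => //; rewrite -(addrN x); apply: CD.
  by rewrite /neg /= opprK => /posM/(CM _ Cx).
- split=> //; split=> // a fa am1; have ads := ds_mem _ fa am1.
  have C0a := dsC0 _ ads; rewrite /cone_lt.
  have [[m [k aE]]|nM] := pselect (M (m1 - a)).
    by right; have [n nE] := pos_int _ _ _ C0a aE; exists m, n; rewrite aE nE.
  left; apply: PC; have [n [k [z [Ez zE]]]] := Egen _ ads.
  exists n, k, z; split=> //.
  have [z0|//] := ncone_pos C0D C0E Ez.
  by case: nM; exists n, k; rewrite zE z0 addr0.
- move=> m12; have [a [fa am1 d0E]] := dsP _ d0ds.
  have [_ /(_ a fa)] := fm2; rewrite -m12 => /(_ am1); rewrite /cone_lt -d0E.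
  case=> [/CM|[m [n]]]; first by apply; exists 0%N, 1; rewrite mulr1n mulr1z.
  rewrite mulNrn => /eqP; rewrite eq_sym -subr_eq0 opprK -mulrnDr addnS.
  by move=> /eqP/mulrn_eq0P d0E'; rewrite d0E' eqxx in d00.
Qed.

End Edges.

(** * Bounded factorization in group algebras *)

Section CyclicClosure.
Variable G : tfGroupType.
Hypothesis accG : acc_cyclic_subgroups G.
Implicit Types (x y c : G).

Definition in_cycle c y := exists k : int, y = c *~ k.

Lemma in_cycle_trans c d y : in_cycle d c -> in_cycle c y -> in_cycle d y.
Proof. by move=> [k ->] [l ->]; exists (k * l); rewrite mulrzA. Qed.

(** Otherwise dependent choice builds a strictly ascending chain of cyclic groups. *)
Lemma maximal_cycle x : exists c, in_cycle c x /\
  forall d, in_cycle d c -> in_cycle c d.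
Proof.
apply: contrapT => nmax.
have /choice[F FP] c : exists d, in_cycle c x -> in_cycle d c /\ ~ in_cycle c d.
  have [cx|] := pselect (in_cycle c x); last by exists 0.
  apply: contrapT => nd; apply: nmax; exists c; split=> // d dc.
  by apply: contrapT => ncd; apply: nd; exists d.
pose g n := iter n F x.
have gx n : in_cycle (g n) x.
  elim: n => [|n IHn]; first by exists 1; rewrite mulr1z.
  by have [cy _] := FP _ IHn; apply: in_cycle_trans cy IHn.
have [|N /(_ N.+1 (leqnSn _)) gN] := accG (g := g).
  move=> n _ [k _ <-]; have [[l gE] _] := FP _ (gx n).
  by exists (l * k) => //; rewrite mulrzA -gE.
have [_ []] := FP _ (gx N); have : range (fun k : int => g N.+1 *~ k) (g N.+1).
  by exists 1; rewrite ?mulr1z.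
by rewrite gN => -[k _ kE]; exists k; apply: esym.
Qed.

(** A maximal cyclic subgroup around x absorbs every element commensurable with x, as
    two commensurable elements generate a cyclic group by Bezout's identity. *)
Lemma commensurable_cyclic x : x != 0 -> exists c (J : nat), x = c *+ J.+1 /\
  forall y m n, y *+ m.+1 = x *+ n.+1 -> exists j, y = c *+ j.+1.
Proof.
move=> x0; have [c [[a xE] cmax]] := maximal_cycle x.
wlog [J aE] : c a xE cmax / exists J, a = Posz J.+1.
  move=> wl; case: a xE => [[|J]|J] xE.
  - by rewrite xE mulr0z eqxx in x0.
  - by apply: (wl c J.+1) => //; exists J.
  - apply: (wl (- c) J.+1); [|move=> d [k dE]|by exists J].
      by rewrite xE NegzE mulrNz mulNrz.
    have [|l ->] := cmax d; first by exists (- k); rewrite mulrNz -dE opprK.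
    by exists (- l); rewrite mulNrz mulrNz opprK.
rewrite {a}aE in xE; exists c, J; split=> // y m n yE.
have c0 : c != 0 by apply: contraNneq x0 => c0; rewrite xE c0 mul0rz.
have {}yE : y *~ m.+1 = c *~ (J.+1 * n.+1)%N.
  by rewrite -[LHS]/(y *+ m.+1) yE xE -[LHS]/(c *+ J.+1 *+ n.+1) -mulrnA.
have [k yc] : in_cycle c y.
  move: yE; set p : int := m.+1; set l : int := (J.+1 * n.+1)%N => yE.
  have [u [v uvE]] := Bezoutz p l; set g := gcdz p l in uvE.
  have g0 : g != 0 by rewrite gcdz_eq0.
  have [p' pE] : exists p', p = p' * g by exists (p %/ g)%Z; rewrite divzK ?dvdz_gcdl.
  have [l' lE] : exists l', l = l' * g by exists (l %/ g)%Z; rewrite divzK ?dvdz_gcdr.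
  have uv1 : u * p' + v * l' = 1.
    by apply: (mulIf g0); rewrite mul1r -[RHS]uvE pE lE; ring.
  have yc' : y *~ p' = c *~ l'.
    by apply: (mulrz_inj g0); rewrite -!mulrzA -pE -lE.
  have [|b dE] := cmax (y *~ v + c *~ u).
    exists p'; rewrite mulrzDl -!mulrzA [v * p']mulrC [y *~ _]mulrzA yc' -mulrzA.
    by rewrite -mulrzDr addrC [l' * v]mulrC uv1 mulr1z.
  exists (b * l'); rewrite mulrzA -dE mulrzDl -!mulrzA [u * l']mulrC.
  by rewrite [c *~ _]mulrzA -yc' -mulrzA -mulrzDr addrC [p' * u]mulrC uv1 mulr1z.
move: yE; rewrite yc -mulrzA => /(mulrz_injl c0); case: k yc => [[|j]|j] yc.
- by rewrite mul0r.
- by exists j.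
- by rewrite NegzE mulNr.
Qed.

Lemma mon_order_sum (lt : G -> G -> Prop) x y : mon_order lt ->
  lt 0 x -> lt 0 y -> lt 0 (x + y).
Proof.
by move=> [_ tr _ ltD] x0 y0; apply: (tr _ x) => //; rewrite -{1}[x]addr0; apply: ltD.
Qed.

Lemma mon_order_opp (lt : G -> G -> Prop) x : mon_order lt -> lt x 0 -> lt 0 (- x).
Proof.
by move=> [_ _ _ ltD] x0; rewrite -(addNr x) -{2}[- x]addr0; apply: ltD.
Qed.

Lemma mon_order_opp2 (lt : G -> G -> Prop) x : mon_order lt -> lt 0 (- x) -> lt x 0.
Proof.
by move=> [_ _ _ ltD] x0; rewrite -(addrN x) -{1}[x]addr0; apply: ltD.
Qed.

(** The elements on which two adjacent orders disagree are positive rational multiples of a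
    single one, so a given x is a sum of boundedly many of them; the bound does not
    depend on the orders. *)
Lemma adjacent_sum_bound x : exists N, forall lt1 lt2 (ys : seq G),
    mon_order lt1 -> mon_order lt2 -> adjacent lt1 lt2 ->
    (forall y, y \in ys -> lt1 0 y /\ lt2 y 0) ->
  \sum_(y <- ys) y = x -> (size ys <= N)%N.
Proof.
suff [N NP] : exists N : nat, forall lt1 lt2 (ys : seq G),
    mon_order lt1 -> mon_order lt2 -> adjacent lt1 lt2 ->
    (forall y, y \in ys -> lt1 0 y /\ lt2 y 0) -> x != 0 ->
    lt1 0 x -> lt2 x 0 -> \sum_(y <- ys) y = x -> (size ys <= N)%N.
  exists N => lt1 lt2 ys O1 O2 adj ysP xE.
  have [->//|[x1 x2]] : ys = [::] \/ (lt1 0 x /\ lt2 x 0).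
    rewrite -xE; case: ys ysP {xE} => [|y ys] ysP; [by left|right].
    rewrite big_cons; have [y1 y2] := ysP y (mem_head _ _).
    have {}ysP z : z \in ys -> lt1 0 z /\ lt2 z 0.
      by move=> zys; apply: ysP; rewrite inE zys orbT.
    elim: ys y y1 y2 ysP => [|z ys IHys] y y1 y2 ysP; first by rewrite big_nil addr0.
    rewrite big_cons addrA; have [z1 z2] := ysP z (mem_head _ _).
    apply: IHys => [||t tys]; last by apply: ysP; rewrite inE tys orbT.
      exact: mon_order_sum.
    apply: mon_order_opp2 => //; rewrite opprD.
    by apply: mon_order_sum => //; apply: mon_order_opp.
  apply: (NP _ _ _ O1 O2 adj ysP _ x1 x2 xE); apply/eqP => x0.
  by have [irr _ _ _] := O1; apply: (irr 0); rewrite -{2}x0.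
have [x0|x0] := eqVneq x 0; first by exists 0%N.
have [c [J [xE cP]]] := commensurable_cyclic x0.
have c0 : c != 0 by apply: contraNneq x0 => c0; rewrite xE c0 mul0rn.
exists J.+1 => lt1 lt2 ys O1 O2 [d0 dP] ysP _ x1 x2 sumE.
have [p [q xd]] := dP x x1 x2.
have {}ysP y : y \in ys -> exists j, y = c *+ j.+1.
  move=> /ysP[y1 y2]; have [m [n yd]] := dP y y1 y2.
  apply: (cP y (m.+1 * q.+1).-1 (p.+1 * n.+1).-1).
  by rewrite !prednK ?muln_gt0 // !mulrnA yd xd -!mulrnA mulnC.
have [T TE leT] : exists2 T, \sum_(y <- ys) y = c *+ T & (size ys <= T)%N.
  elim: ys ysP {sumE} => [|y ys IHys] ysP; first by exists 0%N; rewrite ?big_nil.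
  have [|T TE leT] := IHys; first by move=> z zys; apply: ysP; rewrite inE zys orbT.
  have [j yE] := ysP y (mem_head _ _); exists (j.+1 + T)%N.
    by rewrite big_cons TE yE mulrnDr.
  by rewrite /= addSn ltnS (leq_trans leT) // leq_addl.
suff TJ : T = J.+1 by rewrite -TJ.
by move: sumE; rewrite TE xE => /(@mulrz_injl _ _ c0 T J.+1) [].
Qed.

End CyclicClosure.

Section BoundedFactorization.
Variables (K : fieldType) (G : tfGroupType).
Hypothesis accG : acc_cyclic_subgroups G.
Implicit Types (f g h : {monalg K[G]}) (lt : G -> G -> Prop) (x y : G).

Lemma nonunit_two_terms f : f != 0 -> f \isn't a GRing.unit ->
  exists s t, [/\ s != t, acoef f s != 0 & acoef f t != 0].
Proof.
move=> f0 fU; have [s fs] := alg_neq0 f0; apply: contrapT => nst.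
suff fE : f = monom (acoef f s) s.
  move/negP: fU; apply; rewrite fE; apply: (@monom_unit _ _ _ _ (- s)).
    by rewrite unitfE.
  exact: subrr.
apply/algP => t; rewrite coef_monom; have [->//|ts] := eqVneq t s.
apply/eqP/negPn/negP => ft; apply: nst; exists s, t; split=> //.
by rewrite eq_sym.
Qed.

Definition leading_exp lt f : G := xget 0 [set m | leading lt f m].

Lemma leading_expP lt f : mon_order lt -> f != 0 -> leading lt f (leading_exp lt f).
Proof.
move=> ltO f0; apply: (@xgetPex _ 0 [set m | leading lt f m]).
exact: leading_exists.
Qed.

Lemma prod_neq0 (R : idomainType) (rs : seq R) : (forall r, r \in rs -> r != 0) ->
  \prod_(r <- rs) r != 0.
Proof. by move=> rs0; rewrite prodf_seq_neq0; apply/allP. Qed.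

Lemma leading_prod lt (gs : seq {monalg K[G]}) : mon_order lt ->
    (forall g, g \in gs -> g != 0) ->
  leading lt (\prod_(g <- gs) g) (\sum_(g <- gs) leading_exp lt g).
Proof.
move=> ltO; elim: gs => [|g gs IHgs] gs0.
  rewrite !big_nil; split; first by rewrite coef_monom eqxx oner_eq0.
  by move=> s + /negPf s0; rewrite coef_monom s0 eqxx.
rewrite !big_cons; apply: (leadingM ltO _ _).2.
  by apply: leading_expP => //; apply: gs0; rewrite mem_head.
by apply: IHgs => h hgs; apply: gs0; rewrite inE hgs orbT.
Qed.

(** If the two orders disagreed on a factor, then the vertex of the product for the
    second one would be strictly smaller than its vertex for the first one. *)
Lemma leading_factor_eq lt lt' g h a : mon_order lt -> mon_order lt' ->
    g != 0 -> h != 0 -> leading lt (g * h) a -> leading lt' (g * h) a ->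
  leading_exp lt g = leading_exp lt' g.
Proof.
move=> ltO ltO' g0 h0 la la'.
have lg := leading_expP ltO g0; have lh := leading_expP ltO h0.
have lg' := leading_expP ltO' g0; have lh' := leading_expP ltO' h0.
have aE := leading_uniq ltO la (leadingM ltO lg lh).2.
have aE' := leading_uniq ltO' la' (leadingM ltO' lg' lh').2.
have [irr _ _ _] := ltO.
have [[->]//|] := lt_leading_add ltO lg lh lg'.1 lh'.1.
by rewrite -aE -aE' => /irr.
Qed.

(** Each non-unit factor of f has an edge; for the corresponding orders, the difference
    of the two vertices of f is the sum of those of the factors, so the factor
    contributes to an edge of f. An edge of f is recorded by its two ends in the support
    of f, and has room for boundedly many contributions. *)
Lemma bounded_factorization f : f != 0 -> exists N, forall gs : seq {monalg K[G]},
    (forall g, g \in gs -> g \isn't a GRing.unit) ->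
  f = \prod_(g <- gs) g -> (size gs <= N)%N.
Proof.
move=> f0; have /choice[B BP] := adjacent_sum_bound accG.
pose E := [seq (a, b) | a <- asupp f, b <- asupp f].
exists (\sum_(e <- E) B (e.1 - e.2)) => gs gsU fE.
have gs0 g : g \in gs -> g != 0.
  move=> ggs; apply: contraNneq f0 => g0; rewrite fE (big_rem g) //= g0.
  by rewrite mul0r.
(* The factor g contributes to the edge of f with ends e.1 and e.2. *)
pose W (e : G * G) g := `[< exists lt1 lt2, [/\ mon_order lt1, mon_order lt2,
  adjacent lt1 lt2, leading lt1 f e.1 /\ leading lt2 f e.2 &
  leading_exp lt1 g <> leading_exp lt2 g] >].
have factor g : g \in gs -> exists2 h, h != 0 & f = g * h.
  move=> ggs; exists (\prod_(h <- rem g gs) h); last by rewrite fE (big_rem g).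
  by apply: prod_neq0 => h /mem_rem/gs0.
have edge g : g \in gs -> exists2 e, e \in E & W e g.
  move=> ggs; have [s [t [st gs' gt]]] := nonunit_two_terms (gs0 g ggs) (gsU g ggs).
  have [lt1 [lt2 [m1 [m2 [O1 O2 adj [gm1 gm2] m12]]]]] := exists_edge st gs' gt.
  have [a fa] := leading_exists O1 f0; have [b fb] := leading_exists O2 f0.
  exists (a, b).
    apply: allpairs_f; rewrite -[_ \in _]/(_ \in asupp f) mem_asupp.
      by case: fa.
    by case: fb.
  apply/asboolP; exists lt1, lt2; split=> //.
  rewrite (leading_uniq O1 (leading_expP O1 (gs0 g ggs)) gm1).
  by rewrite (leading_uniq O2 (leading_expP O2 (gs0 g ggs)) gm2).
have count_edge e : (count (W e) gs <= B (e.1 - e.2)%R)%N.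
  have [/hasP[g0 g0gs /asboolP]|] := boolP (has (W e) gs); last first.
    by rewrite has_count -eqn0Ngt => /eqP ->.
  (* One pair of orders witnesses the contributions of all factors to e. *)
  move=> [lt1 [lt2 [O1 O2 adj [fa fb] _]]].
  pose y g := leading_exp lt1 g - leading_exp lt2 g.
  apply: (@leq_trans (size [seq z <- map y gs | z != 0])).
    rewrite size_filter count_map -!sum1_count.
    rewrite big_mkcond [X in (_ <= X)%N]big_mkcond.
    rewrite big_seq [X in (_ <= X)%N]big_seq /=; apply: leq_sum => g ggs.
    suff : W e g -> y g != 0 by case: (W e g) => // ->.
    move=> /asboolP[lt1' [lt2' [O1' O2' adj' [fa' fb'] gE]]].
    have [h h0 ghE] := factor g ggs.
    rewrite /= /y subr_eq0; apply/eqP => yE; apply: gE.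
    rewrite ghE in fa fb fa' fb'.
    rewrite -(leading_factor_eq O1 O1' (gs0 g ggs) h0 fa fa').
    by rewrite -(leading_factor_eq O2 O2' (gs0 g ggs) h0 fb fb').
  apply: (BP _ lt1 lt2) => //.
    move=> z; rewrite mem_filter => /andP[z0 /mapP[g ggs zE]].
    have l1 := leading_expP O1 (gs0 g ggs); have l2 := leading_expP O2 (gs0 g ggs).
    have neq : leading_exp lt1 g != leading_exp lt2 g.
      by apply: contraNneq z0; rewrite zE /y => ->; rewrite subrr.
    have [_ _ _ D1] := O1; have [_ _ _ D2] := O2.
    have := l1.2 _ l2.1; rewrite eq_sym => /(_ neq) lt12.
    have lt21 := l2.2 _ l1.1 neq.
    split; rewrite zE /y addrC.
      by rewrite -(addNr (leading_exp lt2 g)); apply: D1.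
    by rewrite -[X in lt2 _ X](addNr (leading_exp lt2 g)); apply: D2.
  rewrite big_filter big_mkcond big_map /=.
  rewrite (leading_uniq O1 fa _ : _ = \sum_(g <- gs) leading_exp lt1 g); last first.
    by rewrite fE; apply: leading_prod.
  rewrite (leading_uniq O2 fb _ : _ = \sum_(g <- gs) leading_exp lt2 g); last first.
    by rewrite fE; apply: leading_prod.
  rewrite -sumrB; apply: eq_bigr => g _.
  by rewrite /y; case: eqP.
apply: (@leq_trans (\sum_(e <- E) count (W e) gs)%N); last first.
  by apply: leq_sum => e _; apply: count_edge.
have countE T (p : pred T) (r : seq T) : count p r = (\sum_(i <- r) p i)%N.
  by rewrite -sum1_count [LHS]big_mkcond; apply: eq_bigr => i _; case: (p i).
have -> : (\sum_(e <- E) count (W e) gs = \sum_(g <- gs) count (W^~ g) E)%N.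
  under eq_bigr do rewrite countE; rewrite exchange_big.
  by apply: eq_bigr => g _; rewrite countE.
rewrite -sum1_size big_seq [X in (_ <= X)%N]big_seq; apply: leq_sum => g /edge[e eE We].
by rewrite -has_count; apply/hasP; exists e.
Qed.

End BoundedFactorization.

Definition irreducible_elt (R : idomainType) (f : R) :=
  f \isn't a GRing.unit /\
  forall a b, f = a * b -> a \is a GRing.unit \/ b \is a GRing.unit.

(** A factorization of maximal length has irreducible factors. *)
Lemma bounded_factorization_ufd (R : idomainType) :
    (forall f : R, f != 0 -> exists N, forall gs,
      (forall g, g \in gs -> g \isn't a GRing.unit) ->
      f = \prod_(g <- gs) g -> (size gs <= N)%N) ->
    (forall f : R, f != 0 -> irreducible_elt f -> prime_elt f) ->
  ufd R.
Proof.
move=> bfd irrp f f0; have [fU|fU] := boolP (f \is a GRing.unit).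
  by exists f, [::]; rewrite big_nil mulr1.
have [N NP] := bfd f f0.
pose fact n := `[< exists gs : seq R, [/\ forall g, g \in gs -> g \isn't a GRing.unit,
  f = \prod_(g <- gs) g & size gs = n] >].
have ex : exists n, fact n.
  exists 1%N; apply/asboolP; exists [:: f]; rewrite big_seq1; split=> // g.
  by rewrite inE => /eqP ->.
have bound n : fact n -> (n <= N)%N by move=> /asboolP[gs [gsU fE <-]]; apply: NP.
have [n /asboolP[gs [gsU fE szn]] nmax] := ex_maxnP ex bound.
exists 1, gs; rewrite unitr1 mul1r; split=> // g ggs; apply: irrp.
  by apply: contraNneq f0 => g0; rewrite fE (big_rem g) //= g0 mul0r.
split; first exact: gsU.
move=> a b gE; apply/orP; rewrite -[_ || _]negbK negb_or; apply/negP => /andP[aU bU].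
have /nmax : fact n.+1.
  apply/asboolP; exists [:: a, b & rem g gs]; split.
  - by move=> h; rewrite !inE => /or3P[/eqP ->|/eqP ->|/mem_rem/gsU].
  - by rewrite !big_cons mulrA -gE fE (big_rem g).
  - by rewrite /= size_rem // -szn; case: (gs) ggs.
by rewrite ltnn.
Qed.

(** * Group algebras of torsion-free groups are factorial *)

Section FreeBasis.
Variable G : tfGroupType.
Implicit Types (b : nat -> G) (k c : nat -> int) (x y : G) (A : seq G).

Definition spanned n b x := exists k, x = \sum_(i < n) b i *~ k i.

Definition independent n b := forall k, \sum_(i < n) b i *~ k i = 0 ->
  forall i, (i < n)%N -> k i = 0.

(** The elementary step of Euclid's algorithm: when e times the i-th generator is added
    to the j-th one, e times the j-th coefficient is subtracted from the i-th one. *)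
Lemma sum_shear n b c (e : int) i j : (i < n)%N -> (j < n)%N -> i != j ->
  \sum_(l < n) b l *~ c l =
  \sum_(l < n) (if l == j :> nat then b j + b i *~ e else b l) *~
               (if l == i :> nat then c i - e * c j else c l).
Proof.
move=> ltin ltjn ij; pose i' := Ordinal ltin; pose j' := Ordinal ltjn.
have ji' : j' != i' by rewrite -val_eqE /= eq_sym.
rewrite (bigD1 i') // (bigD1 j') //= [RHS](bigD1 i') // [in RHS](bigD1 j') //=.
rewrite !eqxx (negPf ij) [j == i]eq_sym (negPf ij) !addrA; congr (_ + _).
  by rewrite mulrzBr mulrzDl -mulrzA addrACA addNr addr0.
apply: eq_bigr => l /andP[/negPf li /negPf lj].
by rewrite -[l == i :> nat]/(l == i') li -[l == j :> nat]/(l == j') lj.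
Qed.

(** Euclid's algorithm on the coefficients of a relation ends with a single nonzero
    coefficient; the corresponding generator is then zero, by torsion-freeness. *)
Lemma remove_generator n b k : \sum_(i < n) b i *~ k i = 0 ->
    (exists2 i, (i < n)%N & k i != 0) ->
  exists b', forall x, spanned n b x -> spanned n.-1 b' x.
Proof.
have [m] := ubnP (\sum_(i < n) `|k i|)%N; elim: m => // m IHm in b k *.
rewrite ltnS => le_m sumk [i0 lti0 ki0].
pose two i j :=
  [&& (i < n)%N, (j < n)%N, i != j, k i != 0, k j != 0 & (`|k j| <= `|k i|)%N].
have [[i [j /and5P[ltin ltjn ij ki /andP[kj kji]]]]|one] :=
    pselect (exists i j, two i j).
  (* The sign for which k i - e * k j is smaller than k i in absolute value. *)
  pose e := sgz (k i) * sgz (k j).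
  have shear c := @sum_shear n b c e i j ltin ltjn ij.
  pose b' l := if l == j then b j + b i *~ e else b l.
  pose k' l := if l == i then k i - e * k j else k l.
  have [|||b'' b''P] := IHm b' k'.
  - apply: leq_trans le_m; rewrite (bigD1 (Ordinal ltin)) //= {1}/k' eqxx.
    rewrite [X in (_ < X)%N](bigD1 (Ordinal ltin)) //=.
    rewrite (eq_bigr (fun l : 'I_n => `|k l|%N)); last first.
      by move=> l /negPf li; rewrite /k' -[nat_of_ord l == i]/(l == Ordinal ltin) li.
    rewrite ltn_add2r /e; move: ki kj kji.
    by case: sgzP => //; case: sgzP => //; lia.
  - by rewrite -shear.
  - by exists j => //; rewrite /k' [j == i]eq_sym (negPf ij).
  exists b'' => x [c ->]; apply: b''P.
  by exists (fun l => if l == i then c i - e * c j else c l); rewrite shear.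
have k0 l : (l < n)%N -> l != i0 -> k l = 0.
  move=> ltl li; apply/eqP/negPn/negP => kl; apply: one.
  have [le|/ltnW le] := leqP `|k l| `|k i0|.
    by exists i0, l; apply/and5P; split=> //; rewrite ?kl ?le // eq_sym.
  by exists l, i0; apply/and5P; split=> //; rewrite ki0.
case: n lti0 sumk k0 {IHm le_m two one} => // n lti0.
rewrite (bigD1_ord (Ordinal lti0)) //= => sumk k0.
have bi0 : b i0 = 0.
  apply: (mulrz_inj ki0); rewrite mul0rz -[RHS]sumk big1 ?addr0 // => l _.
  rewrite k0 ?mulr0z //; first exact: (ltn_ord (lift (Ordinal lti0) l)).
  by have := neq_lift (Ordinal lti0) l; rewrite -val_eqE /= eq_sym.
exists (fun l => b (bump i0 l)) => x [c ->]; exists (fun l => c (bump i0 l)).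
by rewrite (bigD1_ord (Ordinal lti0)) //= bi0 mul0rz add0r.
Qed.

(** A nontrivial relation would reduce a minimal number of generators. *)
Lemma free_basis A : exists n b, independent n b /\ forall a, a \in A -> spanned n b a.
Proof.
pose gen n := `[< exists b, forall a, a \in A -> spanned n b a >].
have ex : exists n, gen n.
  exists (size A); apply/asboolP; exists (nth 0 A) => a aA.
  have lt_a : (index a A < size A)%N by rewrite index_mem.
  exists (fun i => (i == index a A)%:Z).
  rewrite (bigD1 (Ordinal lt_a)) //= eqxx mulr1z nth_index // big1 ?addr0 // => i.
  by rewrite -val_eqE /= => /negPf ->; rewrite mulr0z.
have [n /asboolP[b bA] nmin] := ex_minnP ex.
exists n, b; split=> // k sumk i lti; apply/eqP/negPn/negP => ki.
have [|b' b'P] := remove_generator sumk; first by exists i.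
have /nmin : gen n.-1 by apply/asboolP; exists b' => a /bA/b'P.
by case: n lti {bA nmin sumk b'P} => // n _; rewrite ltnn.
Qed.

Lemma shift_nonneg n b A : (forall a, a \in A -> spanned n b a) ->
  exists N, forall a, a \in A -> exists k : nat -> nat,
    \sum_(i < n) b i *+ N + a = \sum_(i < n) b i *+ k i.
Proof.
elim: A => [|a A IHA] bA; first by exists 0%N.
have [x xA|N NP] := IHA; first by apply: bA; rewrite inE xA orbT.
have [c aE] := bA a (mem_head _ _); pose M := (\sum_(i < n) `|c i|)%N.
exists (N + M)%N => x; rewrite inE => /orP[/eqP ->|/NP[k kE]]; last first.
  exists (fun i => k i + M)%N; under eq_bigr do rewrite mulrnDr.
  under [RHS]eq_bigr do rewrite mulrnDr.
  by rewrite !big_split /= -kE addrAC.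
exists (fun i => absz (Posz (N + M) + c i)%R).
rewrite aE -big_split; apply: eq_bigr => i _ /=.
rewrite -[_ *+ (N + M)]/(b i *~ Posz (N + M)) -mulrzDr.
rewrite -[RHS]/(b i *~ Posz (absz (Posz (N + M) + c i)%R)) gez0_abs //.
have : (`|c i| <= M)%N by rewrite /M (bigD1 i) //= leq_addr.
lia.
Qed.

End FreeBasis.

Section PolynomialSubring.
Variables (K : fieldType) (G : tfGroupType).
Implicit Types (b : nat -> G) (x y s : G) (f g h : {monalg K[G]}).

Lemma ufd_field : ufd K.
Proof. by move=> c c0; exists c, [::]; rewrite unitfE big_nil mulr1. Qed.

(** R is the polynomial ring in the variables X^(b i), built by adjoining one variable
    at a time so that it inherits factoriality from K. Powers of the last variable
    shift the group spanned by the earlier generators to disjoint cosets, which makes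
    the evaluation injective. *)
Lemma polynomial_subring n b : independent n b ->
  exists (R : idomainType) (phi : {rmorphism R -> {monalg K[G]}}),
  [/\ ufd R, injective phi,
    forall c (k : nat -> nat), exists r, phi r = monom c (\sum_(i < n) b i *+ k i) &
    forall r s, acoef (phi r) s != 0 -> spanned n b s].
Proof.
elim: n => [|n IHn] indb.
  exists K, (@scalar_monom K G : {rmorphism K -> {monalg K[G]}}); split.
  - exact: ufd_field.
  - move=> c d /eqP; rewrite -subr_eq0 -rmorphB monom_eq0 subr_eq0.
    by move/eqP.
  - by move=> c k; exists c; rewrite big_ord0.
  - move=> c s; rewrite coef_monom; have [->|] := eqVneq s 0; rewrite ?eqxx //.
    by move=> _; exists (fun=> 0); rewrite big_ord0.
have indb' : independent n b.
  move=> k sumk i lti; pose k' i := if (i < n)%N then k i else 0.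
  have := indb k' _ i (ltnW lti); rewrite /k' lti; apply.
  rewrite big_ord_recr /= ltnn mulr0z addr0 -[RHS]sumk.
  by apply: eq_bigr => j _; rewrite ltn_ord.
have [R [phi [fR phi_inj phi_monom phi_supp]]] := IHn indb'.
pose u : {monalg K[G]} := monom 1 (b n).
have cu : commr_rmorph phi u by move=> x; apply: mulrC.
have phiE p : horner_morph cu p = \sum_(i < size p) monom 1 (b n *+ i) * phi p`_i.
  rewrite /horner_morph horner_coef size_map_inj_poly ?rmorph0 //.
  by apply: eq_bigr => i _; rewrite coef_map /= mulrC /u monomX expr1n.
exists {poly R}, (horner_morph cu : {rmorphism {poly R} -> {monalg K[G]}}); split.
- exact: ufd_poly.
- apply: raddf_inj => p /= p0; apply/polyP => j; rewrite coef0.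
  have [ltj|/(nth_default 0)//] := ltnP j (size p).
  apply: phi_inj; rewrite rmorph0; apply/algP => s; rewrite acoef0.
  apply/eqP/negPn/negP => pjs; have [k sE] := phi_supp _ _ pjs.
  have /algP/(_ (b n *+ j + s)) := p0; rewrite phiE acoef0 acoef_sum.
  rewrite (bigD1 (Ordinal ltj)) //= acoef_monomM mul1r big1 ?addr0.
    by move/eqP; rewrite (negPf pjs).
  move=> i ij; apply/eqP/negPn/negP => /acoefM_neq0[t [t' [+ pit' stE]]].
  move=> /acoef_monom_neq0 tE.
  have [k' t'E] := phi_supp _ _ pit'.
  pose c l := if (l < n)%N then k l - k' l else (Posz j - Posz i).
  suff sumc : \sum_(l < n.+1) b l *~ c l = 0.
    have := indb c sumc n (ltnSn _); rewrite /c ltnn => /eqP.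
    rewrite subr_eq0 eqz_nat eq_sym => /eqP ji.
    by case/eqP: ij; apply: val_inj.
  rewrite /c big_ord_recr /= ltnn mulrzBr.
  under eq_bigr do rewrite ltn_ord mulrzBr.
  rewrite sumrB -sE -t'E addrACA -opprD; apply/eqP; rewrite subr_eq0 [t' + _]addrC.
  by rewrite [s + _]addrC -[b n *~ j]/(b n *+ j) stE tE.
- move=> c k; have [r rE] := phi_monom c k; exists (r%:P * 'X^(k n)).
  rewrite rmorphM rmorphXn /= horner_morphC horner_morphX rE.
  by rewrite /u monomX expr1n monomM mulr1 big_ord_recr.
- move=> p s /=; rewrite phiE acoef_sum => ps.
  have [i pis] : exists i : 'I_(size p), acoef (monom 1 (b n *+ i) * phi p`_i) s != 0.
    apply: contrapT => ni; case/eqP: ps; apply: big1 => i _.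
    by apply/eqP/negPn/negP => pis; apply: ni; exists i.
  have [t [t' [/acoef_monom_neq0 -> /phi_supp[k t'E] ->]]] := acoefM_neq0 pis.
  exists (fun l => if (l < n)%N then k l else i).
  rewrite big_ord_recr /= ltnn addrC t'E.
  by congr (_ + _); apply: eq_bigr => l _; rewrite ltn_ord.
Qed.

(** All but one of the factors become units in R'. *)
Lemma irreducible_prod (R R' : idomainType) (psi : {rmorphism R -> R'}) (a w : R')
    (ps : seq R) : irreducible_elt a -> w \is a GRing.unit ->
    a = w * \prod_(p <- ps) psi p ->
  exists2 p, p \in ps & exists2 e, e \is a GRing.unit & a = e * psi p.
Proof.
move=> [aU airr]; elim: ps w => [|p ps IHps] w wU aE.
  by case/negP: aU; rewrite aE big_nil mulr1.
rewrite big_cons in aE.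
have [|pU|wpU] := airr (psi p) (w * \prod_(q <- ps) psi q).
- by rewrite aE mulrCA.
- have [||q qps [e eU qE]] := IHps (w * psi p); first by rewrite unitrM wU.
    by rewrite aE mulrA.
  by exists q; rewrite ?inE ?qps ?orbT //; exists e.
- exists p; first exact: mem_head.
  by exists (w * \prod_(q <- ps) psi q) => //; rewrite aE; ring.
Qed.

(** A relation f q = g h involves finitely many exponents; they span a free group, so
    after multiplication by a monomial the relation takes place in a polynomial ring.
    There f is a product of primes, only one of which stays a non-unit in K[G]. *)
Lemma group_algebra_irreducible_prime f : f != 0 -> irreducible_elt f -> prime_elt f.
Proof.
move=> f0 [fU firr]; split=> // g h [q ghE].
pose A := asupp f ++ asupp q ++ asupp g ++ asupp h.
have [n [b [indb bA]]] := free_basis A; have [N NP] := shift_nonneg bA.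
have [R [phi [fR phi_inj phi_monom _]]] := polynomial_subring indb.
set v := \sum_(i < n) b i *+ N in NP; pose u : {monalg K[G]} := monom 1 v.
have uU : u \is a GRing.unit.
  by apply: (@monom_unit _ _ _ _ (- v)); rewrite ?unitr1 ?subrr.
have lift k : (forall s, acoef k s != 0 -> s \in A) -> exists r, phi r = u * k.
  move=> kA; rewrite [k]alg_sum_monom mulr_sumr big_seq.
  apply: (big_ind (fun z => exists r, phi r = z)).
  - by exists 0; rewrite rmorph0.
  - by move=> _ _ [r <-] [r' <-]; exists (r + r'); rewrite rmorphD.
  - move=> s; rewrite mem_asupp => /kA/NP[l lE]; have [r rE] := phi_monom (acoef k s) l.
    by exists r; rewrite rE monomM mul1r lE.
have mem k s : acoef k s != 0 -> s \in (asupp k : seq G).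
  by rewrite -mem_asupp.
have [s /mem fs|F FE] := lift f; first by rewrite !mem_cat fs.
have [s /mem qs|Q QE] := lift q; first by rewrite !mem_cat qs orbT.
have [s /mem gs|Gg GE] := lift g; first by rewrite !mem_cat gs !orbT.
have [s /mem hs|H HE] := lift h; first by rewrite !mem_cat hs !orbT.
have GHE : Gg * H = Q * F.
  apply: phi_inj; rewrite !rmorphM GE HE QE FE.
  by rewrite mulrACA ghE; ring.
have F0 : F != 0.
  apply: contraNneq f0 => F0; rewrite -(mulKr uU f) -FE F0 rmorph0.
  by rewrite mulr0.
have [w [ps [wU pps FpE]]] := fR F F0.
have ufI : irreducible_elt (u * f).
  split; first by rewrite unitrM uU.
  move=> a c acE; have [|aU|] := firr (u^-1 * a) c.
  - by rewrite -mulrA -acE mulKr.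
  - by left; move: aU; rewrite unitrM => /andP[].
  - by right.
have [||p pps' [e eU fE]] := @irreducible_prod _ _ phi (u * f) (phi w) ps ufI.
- exact: rmorph_unit.
- by rewrite -FE FpE rmorphM rmorph_prod.
have [_ _ pM] := pps p pps'.
have fp : dvr f (phi p).
  by exists (e^-1 * u); rewrite -mulrA fE mulKr.
have /pM pGH : dvr p (Gg * H).
  rewrite GHE FpE (big_rem p) //=; apply/dvr_mull/dvr_mull/dvr_mulr; exact: dvr_refl.
have back k r : phi r = u * k -> dvr p r -> dvr f k.
  move=> rE /(dvr_rmorph phi); rewrite rE => /(dvr_trans fp) [c cE].
  by exists (u^-1 * c); rewrite -mulrA -cE mulKr.
by case: pGH => [/(back g)|/(back h)]; [left|right]; auto.
Qed.

Lemma group_algebra_ufd : acc_cyclic_subgroups G -> ufd {monalg K[G]}.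
Proof.
move=> accG; apply: bounded_factorization_ufd.
  exact: bounded_factorization.
exact: group_algebra_irreducible_prime.
Qed.

End PolynomialSubring.

(** * Monoid algebras under change of coefficients and exponents *)

HB.instance Definition _ (S : tfMonoidType) :=
  GRing.isNmodMorphism.Build S (quotient_group S) (@QuotientGroup.embed S)
    (conj (@QuotientGroup.embed0 S) (@QuotientGroup.embedD S)).

Section MapAlg.
Variables (D E : idomainType) (S T : tfMonoidType).
Variables (phi : {rmorphism D -> E}) (h : {additive S -> T}).
Implicit Types (f g : {monalg D[S]}).

Let F (c : D) (s : S) : {monalg E[T]} := monom (phi c) (h s).

Let F0 s : F 0 s = 0.
Proof. by rewrite /F rmorph0 monom0. Qed.

Let FD s c d : F (c + d) s = F c s + F d s.
Proof. by rewrite /F rmorphD monomD. Qed.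

Lemma map_algE f : map_alg phi h f = lift_alg F f. Proof. by []. Qed.

Lemma map_alg_monom c s : map_alg phi h (monom c s) = monom (phi c) (h s).
Proof. by rewrite map_algE lift_alg_monom. Qed.

Lemma map_algD f g : map_alg phi h (f + g) = map_alg phi h f + map_alg phi h g.
Proof. by rewrite !map_algE lift_algD. Qed.

Lemma map_alg0 : map_alg phi h 0 = 0.
Proof. by rewrite map_algE lift_alg0. Qed.

Lemma map_alg_is_zmod_morphism : zmod_morphism (map_alg phi h).
Proof.
move=> f g; rewrite map_algD; congr (_ + _).
by apply: (addrI (map_alg phi h g)); rewrite -map_algD !addrN map_alg0.
Qed.

Lemma map_alg_is_monoid_morphism : monoid_morphism (map_alg phi h).
Proof.
split=> [|f g]; first by rewrite map_alg_monom rmorph1 raddf0.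
elim/alg_ind: f => [|c s|f f' IHf IHf'].
- by rewrite !(mul0r, map_alg0).
- elim/alg_ind: g => [|d t|g g' IHg IHg'].
  + by rewrite !(mulr0, map_alg0).
  + by rewrite !(monomM, map_alg_monom) rmorphM raddfD.
  + by rewrite !(mulrDr, map_algD) IHg IHg'.
- by rewrite !(mulrDl, map_algD) IHf IHf'.
Qed.

HB.instance Definition _ := GRing.isZmodMorphism.Build {monalg D[S]} {monalg E[T]}
  (map_alg phi h) map_alg_is_zmod_morphism.
HB.instance Definition _ := GRing.isMonoidMorphism.Build {monalg D[S]} {monalg E[T]}
  (map_alg phi h) map_alg_is_monoid_morphism.

Lemma map_alg_support f t : acoef (map_alg phi h f) t != 0 -> exists s, t = h s.
Proof.
move=> ft; apply: contrapT => ns; case/eqP: ft; rewrite acoef_sum big1 // => s _.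
by apply/eqP/negPn/negP => /acoef_monom_neq0 ts; apply: ns; exists s.
Qed.

Hypothesis h_inj : injective h.

Lemma acoef_map_alg f s : acoef (map_alg phi h f) (h s) = phi (acoef f s).
Proof.
elim/alg_ind: f => [|c t|f g IHf IHg].
- by rewrite map_alg0 !acoef0 rmorph0.
- rewrite map_alg_monom !coef_monom (inj_eq h_inj).
  by case: ifP; rewrite ?rmorph0.
- by rewrite map_algD !acoefD IHf IHg rmorphD.
Qed.

(** The terms of an element of E[T] are brought into D[S] one after the other, by
    monomials with coefficient in A and exponent in H. This treats the passages to
    K[S], D[G] and K[G] alike. *)
Lemma map_alg_localization (A : set D) (H : set S) : is_localization phi A ->
    H 0 -> (forall s t, H s -> H t -> H (s + t)) ->
    (forall s, H s -> exists t, h s + t = 0) ->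
    (forall x, exists2 s, H s & exists t, x + h s = h t) ->
  is_localization (map_alg phi h)
    [set f | exists d s, [/\ A d, H s & f = monom d s]].
Proof.
move=> locA H0 HD HU Hfrac; split.
- apply: raddf_inj => f f0; apply/algP => s; rewrite acoef0.
  apply: (loc_inj locA); rewrite rmorph0 -acoef_map_alg.
  by rewrite -[map_alg _ _ _]/(GRing.Additive.sort _ f) in f0 *; rewrite f0 acoef0.
- by exists 1, 0; split=> //; apply: loc1 locA.
- move=> _ _ [d [s [Ad Hs ->]]] [e [t [Ae Ht ->]]]; exists (d * e), (s + t).
  by rewrite monomM; split; [apply: (locM locA)|apply: HD|].
- move=> _ [d [s [Ad Hs ->]]] /=; rewrite map_alg_monom.
  by have [t st] := HU s Hs; apply: monom_unit st; apply: (loc_unit locA).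
- elim/alg_ind => [|c x|f g [t Tt [r ft]] [u Tu [q gu]]].
  + exists (monom 1 0); first by exists 1, 0; split=> //; apply: loc1 locA.
    by exists 0; rewrite mul0r rmorph0.
  + have [d Ad [e ce]] := loc_frac locA c; have [s Hs [t xs]] := Hfrac x.
    exists (monom d s); first by exists d, s.
    by exists (monom e t); rewrite /= !map_alg_monom monomM ce xs.
  + exists (t * u).
      case: Tt Tu => [d [s [Ad Hs ->]]] [e [v [Ae Hv ->]]]; exists (d * e), (s + v).
      by rewrite monomM; split; [apply: (locM locA)|apply: HD|].
    exists (r * u + q * t); rewrite rmorphD !rmorphM -ft -gu; ring.
Qed.

End MapAlg.

(** * The embeddings of D[S] into K[S], D[G] and K[G] *)

Section Localizations.
Variables (D : idomainType) (S : tfMonoidType).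
Let K := {fraction D}.
Let G := quotient_group S.
Let frac : {rmorphism D -> K} := @FracField.tofrac D.
Let quot : {additive S -> G} := @QuotientGroup.embed S.

Lemma tofrac_localization : is_localization frac [set d | d != 0].
Proof.
split=> [x y /eqP||x y|x|z] /=.
- by rewrite tofrac_eq => /eqP.
- exact: oner_neq0.
- exact: mulf_neq0.
- by rewrite unitfE tofrac_eq0.
- have [a [b [b0 ->]]] := fraction_quotient z; exists b => //; exists a.
  by rewrite divfK // tofrac_eq0.
Qed.

Lemma id_localization (R : idomainType) :
  is_localization (idfun : {rmorphism R -> R}) [set 1].
Proof.
split=> [x y //|//|_ _ -> ->|_ ->|z]; first by rewrite mulr1.
  exact: unitr1.
by exists 1 => //; exists z; rewrite mulr1.
Qed.

Lemma quotient_frac (g : G) : exists s t, g + quot s = quot t.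
Proof.
have [s [t ->]] := QuotientGroup.embedP g.
by exists t, s; rewrite subrK.
Qed.

(** These morphisms are convertible to [scalar_ext], [exponent_ext] and the composite
    of the two; in this form they fall under [map_alg_localization]. *)
Definition scalar_morph : {rmorphism {monalg D[S]} -> {monalg K[S]}} :=
  map_alg frac (idfun : {additive S -> S}).

Definition exponent_morph : {rmorphism {monalg D[S]} -> {monalg D[G]}} :=
  map_alg (idfun : {rmorphism D -> D}) quot.

Definition both_morph : {rmorphism {monalg D[S]} -> {monalg K[G]}} :=
  map_alg frac quot.

Lemma acoef_scalar_morph f s : acoef (scalar_morph f) s = frac (acoef f s).
Proof. exact: (@acoef_map_alg _ _ _ _ frac (idfun : {additive S -> S})). Qed.

Lemma acoef_exponent_morph f s : acoef (exponent_morph f) (quot s) = acoef f s.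
Proof.
exact: (@acoef_map_alg _ _ _ _ (idfun : {rmorphism D -> D}) _
  (@QuotientGroup.embed_inj S)).
Qed.

Lemma acoef_both_morph f s : acoef (both_morph f) (quot s) = frac (acoef f s).
Proof. exact: (@acoef_map_alg _ _ _ _ _ _ (@QuotientGroup.embed_inj S)). Qed.

Lemma scalar_localization : is_localization scalar_morph
  [set f | exists d s, [/\ d != 0, s = 0 & f = monom d s]].
Proof.
apply: (map_alg_localization _ tofrac_localization (H := [set 0])) => //=.
- by move=> s t -> ->; rewrite addr0.
- by move=> s ->; exists 0; rewrite addr0.
- by move=> x; exists 0 => //; exists x; rewrite addr0.
Qed.

Lemma exponent_localization : is_localization exponent_morph
  [set f | exists d s, [/\ d = 1, True & f = monom d s]].
Proof.
apply: (map_alg_localization _ (id_localization D) (H := setT)) => //.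
- exact: QuotientGroup.embed_inj.
- by move=> s _; exists (- quot s); rewrite subrr.
- by move=> x; have [s [t st]] := quotient_frac x; exists s => //; exists t.
Qed.

Lemma both_localization : is_localization both_morph
  [set f | exists d s, [/\ d != 0, True & f = monom d s]].
Proof.
apply: (map_alg_localization _ tofrac_localization (H := setT)) => //.
- exact: QuotientGroup.embed_inj.
- by move=> s _; exists (- quot s); rewrite subrr.
- by move=> x; have [s [t st]] := quotient_frac x; exists s => //; exists t.
Qed.

Lemma scalar_morph_exp_ext (P : set S) :
  scalar_morph @^-1` (exp_ext P) = (exp_ext P : set {monalg D[S]}).
Proof.
by rewrite eqEsubset; split=> f /= /exp_extE fP; apply/exp_extE => s;
   have := fP s; rewrite acoef_scalar_morph tofrac_eq0.
Qed.

Lemma exponent_morph_coef_ext (P : set D) : prime_ideal P ->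
  exponent_morph @^-1` (coef_ext P) = (coef_ext P : set {monalg D[S]}).
Proof.
move=> pP; rewrite eqEsubset; split=> f /= /(coef_extE _ pP) fP;
  apply/(coef_extE _ pP) => s; first by rewrite -acoef_exponent_morph.
have [->|/map_alg_support[t ->]] := eqVneq (acoef (exponent_morph f) s) 0.
  exact: prime0.
by rewrite [acoef _ _]acoef_exponent_morph.
Qed.

End Localizations.

(** * Primes of D[S] that contain monomials or constants *)

Lemma weakly_Krull_finite (R : idomainType) (a : R) : weakly_Krull_domain R ->
  a != 0 -> finite_set [set P | height_one_primes R P /\ P a].
Proof.
move=> /weakly_KrullE[_ fin] a0; have [aU|aU] := boolP (a \is a GRing.unit).
  apply: (@sub_finite_set _ _ set0) => // P [hP Pa].
  by have := prime_not_unit (height_one_prime hP) Pa; rewrite aU.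
exact: fin.
Qed.

Section MonoidPrimes.
Variable S : tfMonoidType.
Implicit Types (P : set S) (a b c d s t : S).

Lemma monoid_prime0 P : monoid_prime_ideal P -> ~ P 0.
Proof.
move=> [PI PT _] P0; apply: PT; rewrite -subTset => s _.
by rewrite -(add0r s); apply: PI.
Qed.

Lemma embed_subP a b c d :
  toquot a - toquot b = toquot c - toquot d <-> a + d = c + b.
Proof.
split=> [ab|ab].
  apply: QuotientGroup.embed_inj; rewrite !QuotientGroup.embedD.
  by rewrite -[toquot a](subrK (toquot b)) ab addrAC subrK.
apply/eqP; rewrite subr_eq addrAC eq_sym subr_eq -!QuotientGroup.embedD.
by rewrite ab.
Qed.

Lemma weakly_Krull_monoidE : weakly_Krull_monoid S <->
  (forall a b, (forall P, minimal_nonempty_primes S P ->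
      exists2 d, ~ P d & exists c, a + d = b + c) -> exists c, a = b + c) /\
  (forall a, ~ (exists b, a + b = 0) ->
     finite_set [set P | minimal_nonempty_primes S P /\ P a]).
Proof.
split=> -[wK fin]; split=> //.
  move=> a b ab.
  have : (\bigcap_(P in minimal_nonempty_primes S) monoid_localization P)
      (toquot a - toquot b).
    move=> P /ab[d Pd [c adc]]; exists c, d; split=> //; apply/embed_subP.
    by rewrite adc addrC.
  rewrite -wK => -[c _ /eqP]; rewrite eq_sym subr_eq -QuotientGroup.embedD => /eqP.
  by move/QuotientGroup.embed_inj => ->; exists c; rewrite addrC.
rewrite eqEsubset; split=> [_ [s _ <-] P [pP _ _]|g gP].
  exists s, 0; split; first exact: monoid_prime0.
  by rewrite QuotientGroup.embed0 subr0.
have [a [b gE]] := QuotientGroup.embedP g.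
have [|c aE] := wK a b.
  move=> P /gP[c [d [Pd]]]; rewrite gE => /embed_subP ad.
  by exists d => //; exists c; rewrite ad addrC.
exists c => //; rewrite gE aE QuotientGroup.embedD.
by rewrite addrAC subrr add0r.
Qed.

End MonoidPrimes.

Section MonomialPrimes.
Variables (E : idomainType) (S : tfMonoidType).
Implicit Types (P : set S) (Q : set {monalg E[S]}) (s t : S).

Let one_neq0 : (1 : E) != 0. Proof. exact: oner_neq0. Qed.

Lemma exp_extS P P' : P `<=` P' ->
  (exp_ext P : set {monalg E[S]}) `<=` exp_ext P'.
Proof. by move=> PP' f /exp_extE fP; apply/exp_extE => s /fP/PP'. Qed.

Lemma exp_extSE P P' :
  (exp_ext P : set {monalg E[S]}) `<=` exp_ext P' -> P `<=` P'.
Proof.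
move=> PP' s /(exp_ext_monom _ _ one_neq0)/PP'.
by move/(exp_ext_monom _ _ one_neq0).
Qed.

Lemma exp_ext_inj : injective (fun P => exp_ext P : set {monalg E[S]}).
Proof. by move=> P P' PP'; rewrite eqEsubset; split; apply: exp_extSE; rewrite PP'. Qed.

(** The monomials of a prime Q span a prime E[P] below Q, so a height-one prime
    that contains a monomial is spanned by monomials. *)
Lemma height_one_monomial Q s : height_one_primes _ Q -> Q (monom 1 s) ->
  exists2 P, minimal_nonempty_primes S P & Q = exp_ext P.
Proof.
move=> /height_oneE[pQ _ Qmin] Qs; pose P t := Q (monom 1 t).
have monomE a b : monom 1 (a + b) = monom 1 a * monom 1 b :> {monalg E[S]}.
  by rewrite monomM mulr1.
have pP : monoid_prime_ideal P.
  split.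
  - by move=> a b; rewrite /P monomE mulrC; apply: primeMl.
  - by move=> PT; apply: (prime1 pQ); rewrite -[Q 1]/(P 0) PT.
  - by move=> a b; rewrite /P monomE => /(primeM pQ).
have nz P' t : P' t -> exists2 x, (exp_ext P' : set {monalg E[S]}) x & x != 0.
  by exists (monom 1 t); [apply/exp_ext_monom|rewrite monom_eq0].
have PQ : exp_ext P `<=` Q.
  move=> f /exp_extE fP; rewrite [f]alg_sum_monom big_seq; apply: (prime_sum pQ) => t.
  rewrite mem_asupp => /fP Qt; rewrite -[acoef f t]mulr1 -[t]add0r -monomM add0r.
  exact: primeMl.
have QE : exp_ext P = Q by apply: Qmin PQ; [apply: exp_ext_prime|apply: (nz P s)].
exists P => //; split=> //; first by exists s.
move=> P' pP' [t P't] P'P; apply: exp_ext_inj; rewrite QE; apply: Qmin.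
- exact: exp_ext_prime.
- exact: nz P't.
- by rewrite -QE; apply: exp_extS.
Qed.

(** A height-one prime between a monomial of E[P] and E[P] is spanned by monomials, so
    the minimality of P identifies it with E[P]. *)
Lemma weakly_Krull_minimal_prime P : weakly_Krull_domain {monalg E[S]} ->
  minimal_nonempty_primes S P -> height_one_primes {monalg E[S]} (exp_ext P).
Proof.
move=> wK [pP [s Ps] Pmin].
have [||Q [hQ Qs QP]] := weakly_Krull_prime_contains wK (exp_ext_prime E pP)
    (b := monom 1 s).
- exact/exp_ext_monom.
- by rewrite monom_eq0.
have [P' [pP' P'0 _] QE] := height_one_monomial hQ Qs.
rewrite -(Pmin P') // -?QE //; apply: exp_extSE; by rewrite -QE.
Qed.

Lemma monom_dvr s t : dvr (monom 1 s : {monalg E[S]}) (monom 1 t) ->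
  exists u, t = s + u.
Proof.
move=> [f tE]; have : acoef (f * monom 1 s) t != 0 by rewrite -tE coef_monom eqxx.
by case/acoefM_neq0 => u [v [_ /acoef_monom_neq0 -> ->]]; exists u; rewrite addrC.
Qed.

(** Divisibility of monomials in E[S] is divisibility of exponents in S, and can be
    tested at the primes E[P], as the other height-one primes contain no monomial. *)
Lemma weakly_Krull_algebra_monoid : weakly_Krull_domain {monalg E[S]} ->
  weakly_Krull_monoid S /\ monoid_UMT E S.
Proof.
move=> wK; have /weakly_KrullE[wK1 _] := wK.
have hP P : minimal_nonempty_primes S P -> height_one_primes {monalg E[S]} (exp_ext P).
  exact: weakly_Krull_minimal_prime.
split.
  apply/weakly_Krull_monoidE; split=> [a b ab|a aU].
    apply: monom_dvr; apply: wK1 => [|Q hQ]; first by rewrite monom_eq0.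
    have [Qb|Qb] := pselect (Q (monom 1 b)); last first.
      by exists (monom 1 b) => //; apply/dvr_mull/dvr_refl.
    have [P mP QE] := height_one_monomial hQ Qb; have [d Pd [c adc]] := ab P mP.
    exists (monom 1 d); first by rewrite QE => /exp_ext_monom-/(_ one_neq0).
    by exists (monom 1 c); rewrite !monomM adc addrC.
  have := weakly_Krull_finite wK (_ : monom 1 a != 0).
  rewrite monom_eq0 => /(_ one_neq0) fin.
  pose F := [set P | minimal_nonempty_primes S P /\ P a].
  have : finite_set ((fun P => exp_ext P : set {monalg E[S]}) @` F).
    apply: sub_finite_set fin => _ [P [mP Pa] <-]; split; first exact: hP.
    exact/exp_ext_monom.
  by rewrite (eq_finite_set (inj_card_eq _)) // => P P' _ _; apply: exp_ext_inj.
rewrite /monoid_UMT eqEsubset; split=> Q.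
  move=> hQ; have [[s Qs]|nQ] := pselect (exists s, Q (monom 1 s)).
    by left; have [P mP ->] := height_one_monomial hQ Qs; exists P.
  right; have [|Q' hQ' QE] := loc_height_one_extend (exponent_localization E S) hQ.
    by move=> _ [d [s [-> _ ->]]] Qs; apply: nQ; exists s.
  by exists Q'.
case=> [[P mP <-]|[Q' hQ' <-]]; first exact: hP.
exact: (loc_height_one (exponent_localization E S) hQ').
Qed.

End MonomialPrimes.

Section ConstantPrimes.
Variables (D : idomainType) (S : tfMonoidType).
Implicit Types (P : set D) (Q : set {monalg D[S]}) (c d : D).

Lemma coef_extSE P P' : prime_ideal P -> prime_ideal P' ->
  (coef_ext P : set {monalg D[S]}) `<=` coef_ext P' -> P `<=` P'.
Proof.
move=> pP pP' PP' c Pc; apply/(coef_ext_monom c (0 : S) pP')/PP'.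
exact/(coef_ext_monom c (0 : S) pP).
Qed.

Lemma coef_extS P P' : prime_ideal P -> prime_ideal P' -> P `<=` P' ->
  (coef_ext P : set {monalg D[S]}) `<=` coef_ext P'.
Proof.
move=> pP pP' PP' f /(coef_extE _ pP) fP; apply/(coef_extE _ pP') => s.
exact/PP'/fP.
Qed.

Lemma coef_ext_inj P P' : prime_ideal P -> prime_ideal P' ->
  (coef_ext P : set {monalg D[S]}) = coef_ext P' -> P = P'.
Proof.
by move=> pP pP' PP'; rewrite eqEsubset; split; apply: coef_extSE; rewrite // PP'.
Qed.

(** The constants in a prime Q span a prime P[S] below Q. *)
Lemma height_one_constant Q c : height_one_primes _ Q -> Q (monom c 0) -> c != 0 ->
  exists2 P, height_one_primes D P & Q = coef_ext P.
Proof.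
move=> /height_oneE[pQ _ Qmin] Qc c0.
pose P : set D := [set d | Q (monom d 0)].
have pP : prime_ideal P := prime_preimage (@scalar_monom D S) pQ.
have nz P' d : prime_ideal P' -> P' d -> d != 0 ->
    exists2 x, (coef_ext P' : set {monalg D[S]}) x & x != 0.
  by move=> pP' P'd d0; exists (monom d 0); [apply/coef_ext_monom|rewrite monom_eq0].
have PQ : coef_ext P `<=` Q.
  move=> f /(coef_extE _ pP) fP; rewrite [f]alg_sum_monom; apply: (prime_sum pQ) => t _.
  by rewrite -[acoef f t]mul1r -[t]addr0 -monomM addr0; apply/(primeMl pQ)/fP.
have QE : coef_ext P = Q by apply: Qmin PQ; [apply: coef_ext_prime|apply: (nz P c)].
exists P => //; apply/height_oneE; split=> //; first by exists c.
move=> P' pP' [d P'd d0] P'P; apply: coef_ext_inj => //; rewrite QE; apply: Qmin.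
- exact: coef_ext_prime.
- exact: nz P'd d0.
- by rewrite -QE; apply: coef_extS.
Qed.

(** A height-one prime between a constant of P[S] and P[S] is spanned by constants, so
    the minimality of P identifies it with P[S]. *)
Lemma weakly_Krull_height_one_coef P : weakly_Krull_domain {monalg D[S]} ->
  height_one_primes D P -> height_one_primes {monalg D[S]} (coef_ext P).
Proof.
move=> wK /height_oneE[pP [c Pc c0] Pmin].
have [||Q [hQ Qc QP]] := weakly_Krull_prime_contains wK (coef_ext_prime S pP)
    (b := monom c 0).
- exact/coef_ext_monom.
- by rewrite monom_eq0.
have [P' hP' QE] := height_one_constant hQ Qc c0.
have [pP' P'0 _] := (height_oneE P').1 hP'.
by rewrite -(Pmin P') // -?QE //; apply: coef_extSE; rewrite // -QE.
Qed.

Lemma constant_dvr c d : dvr (monom c 0 : {monalg D[S]}) (monom d 0) -> dvr c d.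
Proof.
move=> [f dE]; exists (acoef f 0).
have /algP/(_ (0 + 0)) := dE; rewrite mulrC acoef_monomM addr0 coef_monom eqxx.
by rewrite mulrC.
Qed.

(** Divisibility of constants can be tested at the primes P[S], as the other height-one
    primes contain no nonzero constant. *)
Lemma weakly_Krull_algebra_domain : weakly_Krull_domain {monalg D[S]} ->
  weakly_Krull_domain D /\ domain_UMT D S.
Proof.
move=> wK; have /weakly_KrullE[wK1 _] := wK.
have hP P : height_one_primes D P -> height_one_primes {monalg D[S]} (coef_ext P).
  exact: weakly_Krull_height_one_coef.
split.
  apply/weakly_KrullE; split=> [a b b0 ab|a a0 _].
    apply: constant_dvr; apply: wK1 => [|Q hQ]; first by rewrite monom_eq0.
    have [Qb|Qb] := pselect (Q (monom b 0)); last first.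
      by exists (monom b 0) => //; apply/dvr_mull/dvr_refl.
    have [P pP QE] := height_one_constant hQ Qb b0; have [d Pd [c adc]] := ab P pP.
    exists (monom d 0).
      by rewrite QE => /coef_ext_monom-/(_ (height_one_prime pP)).
    by exists (monom c 0); rewrite !monomM adc.
  have := weakly_Krull_finite wK (_ : monom a 0 != 0).
  rewrite monom_eq0 => /(_ a0) fin.
  pose F := [set P | height_one_primes D P /\ P a].
  have : finite_set ((fun P => coef_ext P : set {monalg D[S]}) @` F).
    apply: sub_finite_set fin => _ [P [pP Pa] <-]; split; first exact: hP.
    exact/coef_ext_monom/Pa/height_one_prime.
  rewrite (eq_finite_set (inj_card_eq _)) // => P P' /set_mem[pP _] /set_mem[pP' _].
  by apply: coef_ext_inj; apply: height_one_prime.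
rewrite /domain_UMT eqEsubset; split=> Q.
  move=> hQ; have [[c c0 Qc]|nQ] := pselect (exists2 c, c != 0 & Q (monom c 0)).
    by left; have [P pP ->] := height_one_constant hQ Qc c0; exists P.
  right; have [|Q' hQ' QE] := loc_height_one_extend (scalar_localization D S) hQ.
    by move=> _ [d [s [d0 -> ->]]] Qd; apply: nQ; exists d.
  by exists Q'.
case=> [[P pP <-]|[Q' hQ' <-]]; first exact: hP.
exact: (loc_height_one (scalar_localization D S) hQ').
Qed.

End ConstantPrimes.

(** * Exponents and coefficients from local conditions *)

(** Multiplying an element outside A by suitable nilpotent elements pushes it to the
    last position before it falls into A. *)
Lemma peel (L : comNzRingType) (A : set L) (ws : seq L) x :
    (forall w, w \in ws -> forall y, A y -> A (w * y)) ->
    (forall w, w \in ws -> forall y, exists n, A (w ^+ n * y)) -> ~ A x ->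
  exists z, [/\ ~ A (z * x), forall w, w \in ws -> A (w * (z * x)) &
    forall y, A y -> A (z * y)].
Proof.
elim: ws => [|w ws IHws] wA wnil nAx.
  by exists 1; split=> // [|y]; rewrite mul1r.
have [||//|z [nAz zA Az]] := IHws.
- by move=> v vws; apply: wA; rewrite inE vws orbT.
- by move=> v vws; apply: wnil; rewrite inE vws orbT.
have wA' := wA w (mem_head _ _).
have ex : exists n, `[< A (w ^+ n * (z * x)) >].
  by have [n An] := wnil w (mem_head _ _) (z * x); exists n; apply/asboolP.
have [[|n] /asboolP An nmin] := ex_minnP ex.
  by case: nAz; move: An; rewrite expr0 mul1r.
have wXA y : A y -> A (w ^+ n * y).
  elim: n {An nmin} => [|n IHn] Ay; first by rewrite expr0 mul1r.
  by rewrite exprS -mulrA; apply/wA'/IHn.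
exists (w ^+ n * z); split.
- rewrite -mulrA => /asboolP/nmin; by rewrite ltnn.
- move=> v; rewrite inE => /orP[/eqP ->|vws].
    by rewrite -mulrA mulrA -exprS.
  rewrite -mulrA mulrCA; apply: wXA; exact: zA.
- by move=> y Ay; rewrite -mulrA; apply/wXA/Az.
Qed.

(** On an element in that last position the nilpotent terms of d act as zero modulo A,
    so d acts there as d1. *)
Lemma reflect_mod_nilpotent (L : comNzRingType) (A : set L) (ws : seq L) (d d1 : L) x :
    (forall y z, A y -> A z -> A (y - z)) ->
    (forall w, w \in ws -> forall y, A y -> A (w * y)) ->
    (forall w, w \in ws -> forall y, exists n, A (w ^+ n * y)) ->
    d = d1 + \sum_(w <- ws) w ->
    (forall y, A (d1 * y) -> A y) ->
  A (d * x) -> A x.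
Proof.
move=> AB wA wnil dE d1A Adx; apply: contrapT => nAx.
have [z [nAz zA Az]] := peel wA wnil nAx; apply/nAz/d1A.
have A0 : A 0 by rewrite -(subrr (d * x)); apply: AB.
have AN y : A y -> A (- y) by rewrite -sub0r; apply: AB.
have AD y t : A y -> A t -> A (y + t) by move=> Ay /AN At; rewrite -[t]opprK; apply: AB.
rewrite (_ : d1 * _ = z * (d * x) - \sum_(w <- ws) w * (z * x)).
  apply: AB; first exact: Az.
  by rewrite big_seq; apply: (big_ind A).
by rewrite dE -mulr_suml; ring.
Qed.

Section ExponentsAtPrime.
Variables (E : idomainType) (S : tfMonoidType) (P : set S).
Let G := quotient_group S.
Hypothesis mP : minimal_nonempty_primes S P.
Implicit Types (s t p : S) (g : G) (d y x : {monalg E[G]}).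

Let pP : monoid_prime_ideal P. Proof. by case: mP. Qed.

(** In S_P some multiple of p lies in s + S_P: the elements s for which this fails
    would form a nonempty prime ideal inside P that misses p. *)
Lemma minimal_prime_nilpotent p s : P p ->
  exists n t u, ~ P t /\ p *+ n + t = s + u.
Proof.
move=> Pp; have [_ _ Pmin] := mP; have [PI _ PM] := pP.
have P0 := monoid_prime0 pP.
pose reach s := exists n t u, ~ P t /\ p *+ n + t = s + u.
have out t : ~ P t -> reach t.
  by move=> Pt; exists 0%N, t, 0; rewrite mulr0n add0r addr0.
apply: contrapT => ns; pose Q := [set s | ~ reach s].
suff QP : Q = P.
  suff : Q p by apply; exists 1%N, 0, 0; rewrite mulr1n.
  by rewrite QP.
apply: Pmin; last 1 first.
- by move=> t nt; apply: contrapT => /out.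
- split.
  + move=> a b nr [n [t [u [Pt E1]]]]; apply: nr.
    by exists n, t, (b + u); rewrite addrA.
  + by move=> QT; have : Q 0 by [rewrite QT]; apply; apply: out.
  + move=> a b nab; apply: contrapT => /not_orP[/contrapT ra /contrapT rb].
    have [n [t [u [Pt tE]]]] := ra; have [m [v [w [Pv vE]]]] := rb.
    apply: nab; exists (n + m)%N, (t + v), (u + w); split=> [/PM[]|] //.
    by rewrite mulrnDr addrACA tE vE addrACA.
- by exists s.
Qed.

Let H : set G := monoid_localization P.

Lemma monoid_localizationD g g' : H g -> H g' -> H (g + g').
Proof.
have [_ _ PM] := pP; move=> [a [b [Pb ->]]] [c [d [Pd ->]]].
exists (a + c), (b + d); split=> [/PM[]|] //.
by rewrite !QuotientGroup.embedD opprD addrACA.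
Qed.

Lemma monoid_localization_embed s : H (toquot s).
Proof.
exists s, 0; split; first exact: monoid_prime0.
by rewrite QuotientGroup.embed0 subr0.
Qed.

Lemma monoid_localization_sub g t : ~ P t -> H (g + toquot t) -> H g.
Proof.
have [_ _ PM] := pP; move=> Pt [a [b [Pb gE]]].
exists a, (b + t); split=> [/PM[]|] //.
by rewrite QuotientGroup.embedD opprD addrA -gE addrK.
Qed.

Lemma exp_extM (H' : set G) x y : (forall g g', H' g -> H' g' -> H' (g + g')) ->
  exp_ext H' x -> exp_ext H' y -> exp_ext H' (x * y).
Proof.
move=> HD /exp_extE Hx /exp_extE Hy; apply/exp_extE => u.
by move=> /acoefM_neq0[s [t [/Hx Hs /Hy Ht ->]]]; apply: HD.
Qed.

Lemma exp_extD (H' : set G) x y :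
  exp_ext H' x -> exp_ext H' y -> exp_ext H' (x + y).
Proof.
move=> /exp_extE Hx /exp_extE Hy; apply/exp_extE => s; rewrite acoefD.
by have [->|/Hx//] := eqVneq (acoef x s) 0; rewrite add0r; apply: Hy.
Qed.

Lemma exp_extN (H' : set G) x : exp_ext H' x -> exp_ext H' (- x).
Proof.
by move=> /exp_extE Hx; apply/exp_extE => s; rewrite acoefN oppr_eq0; apply: Hx.
Qed.

(** The terms of d with exponent in P are nilpotent modulo E[S_P]. The exponents of
    its other terms are units of S_P, which cannot move an exponent into S_P from
    outside. *)
Lemma exponents_at_prime d x :
    (forall g, acoef d g != 0 -> exists s, g = toquot s) ->
    (exists2 s, ~ P s & acoef d (toquot s) != 0) ->
  exp_ext H (d * x) -> exp_ext H x.
Proof.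
move=> dS [s0 Ps0 ds0].
pose inP g := `[< exists2 s, P s & g = toquot s >].
pose ws := [seq monom (acoef d g) g | g <- asupp d & inP g].
have wsP w : w \in ws -> exists c p, P p /\ w = monom c (toquot p).
  case/mapP => g; rewrite mem_filter => /andP[/asboolP[p Pp ->] _] ->.
  by exists (acoef d (toquot p)), p.
have wsH w : w \in ws -> exp_ext H w.
  move=> /wsP[c [p [Pp ->]]]; apply/exp_extE => g /acoef_monom_neq0 ->.
  exact: monoid_localization_embed.
apply: (@reflect_mod_nilpotent _ _ ws d (alg_restrict (predC inP) d)).
- by move=> y z Hy /exp_extN; apply: exp_extD.
- by move=> w /wsH Hw y; apply: exp_extM => //; apply: monoid_localizationD.
- move=> w wws; have [c [p [Pp wE]]] := wsP w wws => y.
  elim/alg_ind: y => [|e g|y z [n Hn] [m Hm]].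
  + by exists 0%N; rewrite mulr0; apply/exp_extE => g; rewrite acoef0 eqxx.
  + have [a [b gE]] := QuotientGroup.embedP g.
    have [n [t [u [Pt nE]]]] := minimal_prime_nilpotent b Pp.
    exists n; rewrite wE monomX monomM; apply/exp_extE => k /acoef_monom_neq0 ->.
    exists (a + u), t; split=> //; rewrite gE.
    have -> : toquot p *+ n = toquot (b + u) - toquot t.
      rewrite -nE QuotientGroup.embedD addrK.
      by elim: n {nE} => [|n IHn]; rewrite ?mulr0n // !mulrS QuotientGroup.embedD IHn.
    rewrite !QuotientGroup.embedD; move: (toquot a) (toquot b) (toquot u) => a' b' u'.
    by rewrite -[b' + u' - _]addrA addrC addrA subrK addrA.
  + have wX k l v : exp_ext H (w ^+ k * v) -> exp_ext H (w ^+ (l + k) * v).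
      move=> Hk; elim: l => // l IHl; rewrite addSn exprS -mulrA.
      by apply: exp_extM => //; [apply: monoid_localizationD|apply: wsH].
    exists (m + n)%N; rewrite mulrDr; apply: exp_extD; first exact: wX.
    by rewrite addnC; apply: wX.
- rewrite {1}(alg_restrictC inP d) addrC; congr (_ + _).
  by rewrite sum_monom_filter.
- set d1 := alg_restrict _ d => y Hd1y.
  have d10 : d1 != 0.
    apply/eqP => /algP/(_ (toquot s0)); rewrite acoef0 acoef_alg_restrict /= /inP.
    case: asboolP => [[s Ps /QuotientGroup.embed_inj sE]|_ /eqP].
      by case: Ps0; rewrite sE.
    by rewrite (negPf ds0).
  have d1P g : acoef d1 g != 0 -> exists2 s, ~ P s & g = toquot s.
    rewrite acoef_alg_restrict /= /inP; case: asboolP => [_|nP]; rewrite ?eqxx //=.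
    move=> /dS[s gE]; exists s => // Ps; apply: nP; by exists s.
  pose q g := `[< H g >].
  have Hq : exp_ext H (alg_restrict q y).
    by apply/exp_extE => g; rewrite acoef_alg_restrict /q; case: asboolP; rewrite ?eqxx.
  suff y0 : alg_restrict (predC q) y = 0 by rewrite (alg_restrictC q y) y0 addr0.
  apply/eqP/negPn/negP => y0; have := mulf_neq0 d10 y0 => /alg_neq0[g gE].
  have Hg : exp_ext H (d1 * alg_restrict (predC q) y).
    rewrite (_ : _ * _ = d1 * y + - (d1 * alg_restrict q y)).
      apply: exp_extD => //; apply: exp_extN; apply: exp_extM => //.
        exact: monoid_localizationD.
      by apply/exp_extE => k /d1P[s _ ->]; apply: monoid_localization_embed.
    by rewrite {2}(alg_restrictC q y); ring.
  have := (exp_extE _ _).1 Hg _ gE; have [k [l [/d1P[s Ps ->] + ->]]] := acoefM_neq0 gE.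
  rewrite acoef_alg_restrict /= /q; case: asboolP => [_|nHl _]; first by rewrite eqxx.
  by rewrite addrC => /(monoid_localization_sub Ps).
Qed.

End ExponentsAtPrime.

Section CoefficientsAtPrime.
Variables (D : idomainType) (S : tfMonoidType) (P : set D).
Let K := {fraction D}.
Hypothesis hP : height_one_primes D P.
Implicit Types (c e : D) (z : K) (d x y : {monalg K[S]}) (s t : S).

Let V : set K := localization P.
Let frac : {rmorphism D -> K} := @FracField.tofrac D.
Let pP : prime_ideal P. Proof. exact: height_one_prime. Qed.

Let nz c : ~ P c -> frac c != 0.
Proof.
by move=> Pc; rewrite tofrac_eq0; apply/eqP => c0; apply: Pc; rewrite c0; apply: prime0.
Qed.

Let localization_frac c : V (frac c).
Proof. by exists c, 1; split; [apply: prime1|rewrite tofrac1 divr1]. Qed.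

Let localizationB z z' : V z -> V z' -> V (z - z').
Proof.
move=> [a [b [Pb ->]]] [c [e [Pe ->]]]; exists (a * e - c * b), (b * e).
split; first by move/(primeM pP)=> [].
by rewrite -mulNr addf_div ?nz // rmorphB !rmorphM mulNr.
Qed.

Let localizationM z z' : V z -> V z' -> V (z * z').
Proof.
move=> [a [b [Pb ->]]] [c [e [Pe ->]]]; exists (a * c), (b * e).
split; first by move/(primeM pP)=> [].
by rewrite mulf_div !rmorphM.
Qed.

Let localization_div z c : ~ P c -> V (frac c * z) -> V z.
Proof.
move=> Pc [a [b [Pb zE]]]; exists a, (b * c); split; first by move/(primeM pP)=> [].
apply: (mulfI (nz Pc)); rewrite zE rmorphM.
by rewrite invfM [RHS]mulrCA [X in _ = _ * X]mulrCA mulfV ?nz // mulr1.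
Qed.

Let A : set {monalg K[S]} := [set x | forall s, V (acoef x s)].

Let coefB x y : A x -> A y -> A (x - y).
Proof. by move=> Ax Ay s; rewrite acoefD acoefN; apply: localizationB. Qed.

Let loc0 : V 0.
Proof. by rewrite -(rmorph0 frac); apply: localization_frac. Qed.

Let locD z z' : V z -> V z' -> V (z + z').
Proof.
move=> Vz Vz'; rewrite -[z']opprK; apply: (localizationB Vz).
by rewrite -sub0r; apply: localizationB.
Qed.

Let coefM x y : A x -> A y -> A (x * y).
Proof.
move=> Ax Ay u; rewrite acoefM; apply: (big_ind V) => // s _.
apply: (big_ind V) => // t _; case: ifP => // _; exact: localizationM.
Qed.

(** In the one-dimensional local ring D_P the elements of P are nilpotent modulo any
    denominator, in particular the coefficients of d in P. The other coefficients are units of D_P; in particular the leading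
    one cannot move a leading coefficient into D_P from outside. *)
Lemma coefficients_at_prime d x :
    (forall s, exists c, acoef d s = frac c) ->
    (exists s c, ~ P c /\ acoef d s = frac c) ->
  A (d * x) -> A x.
Proof.
move=> dD [s0 [c0 [Pc0 ds0]]].
pose inP s := `[< exists2 c, P c & acoef d s = frac c >].
pose ws := [seq monom (acoef d s) s | s <- asupp d & inP s].
have wsP w : w \in ws -> exists c s, P c /\ w = monom (frac c) s.
  case/mapP => s; rewrite mem_filter => /andP[/asboolP[c Pc cE] _] ->.
  by exists c, s; rewrite cE.
have Amonom c s : A (monom (frac c) s).
  by move=> t; rewrite coef_monom; case: ifP.
apply: (@reflect_mod_nilpotent _ _ ws d (alg_restrict (predC inP) d)).
- exact: coefB.
- by move=> w /wsP[c [s [_ ->]]] y; apply: coefM.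
- move=> w /wsP[c [s [Pc ->]]] y; elim/alg_ind: y => [|e t|y z [n An] [m Am]].
  + by exists 0%N; rewrite mulr0 => u; rewrite acoef0.
  + have [a [b [b0 eE]]] := fraction_quotient e.
    have [f Pf [n [k kE]]] := height_one_nilpotent hP b0 Pc.
    exists n => u; rewrite monomX monomM coef_monom; case: ifP => // _.
    apply: (localization_div Pf); rewrite eE.
    have bF : frac b != 0 by rewrite tofrac_eq0.
    have -> : frac f * (frac c ^+ n * (frac a / frac b)) = frac (k * a).
      apply: (mulIf bF); rewrite !mulrA divfK // -rmorphXn -!rmorphM.
      by congr (frac _); rewrite [f * _]mulrC kE; ring.
    exact: localization_frac.
  + have wX k l v : A (monom (frac c) s ^+ k * v) -> A (monom (frac c) s ^+ (l + k) * v).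
      by move=> Ak; elim: l => // l IHl; rewrite addSn exprS -mulrA; apply: coefM.
    exists (m + n)%N; rewrite mulrDr => u; rewrite acoefD; apply: locD; first exact: wX.
    by rewrite addnC; apply: wX.
- rewrite {1}(alg_restrictC inP d) addrC; congr (_ + _).
  by rewrite sum_monom_filter.
- set d1 := alg_restrict _ d => y Ad1y.
  have d1P s : acoef d1 s != 0 -> exists2 c, ~ P c & acoef d1 s = frac c.
    rewrite acoef_alg_restrict /= /inP; case: asboolP => [_|nP]; rewrite ?eqxx //= => _.
    by have [c cE] := dD s; exists c => // Pc; apply: nP; exists c.
  have Ad1 : A d1.
    move=> s; have [->//|/d1P[c _ ->]] := eqVneq (acoef d1 s) 0.
    exact: localization_frac.
  have d10 : d1 != 0.
    apply/eqP => /algP/(_ s0); rewrite acoef0 acoef_alg_restrict /= /inP.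
    case: asboolP => [[c Pc]|_ /eqP]; last by rewrite ds0 (negPf (nz Pc0)).
    rewrite ds0 => /eqP; rewrite tofrac_eq => /eqP cE.
    by case: Pc0; rewrite cE.
  pose q s := `[< V (acoef y s) >].
  have Aq : A (alg_restrict q y).
    by move=> s; rewrite acoef_alg_restrict /q; case: asboolP.
  have outV s : acoef (alg_restrict (predC q) y) s != 0 ->
      ~ V (acoef (alg_restrict (predC q) y) s).
    by rewrite acoef_alg_restrict /= /q; case: asboolP; rewrite ?eqxx.
  suff y0 : alg_restrict (predC q) y = 0 by rewrite (alg_restrictC q y) y0 addr0.
  have [lt ltO] := tfMonoid_order S; apply/eqP/negPn/negP => y0.
  have [m ld1] := leading_exists ltO d10; have [n ly] := leading_exists ltO y0.
  have [E _] := leadingM ltO ld1 ly; have [c Pc cE] := d1P m ld1.1.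
  apply: (outV n ly.1); apply: (localization_div Pc); rewrite -cE -E.
  rewrite (_ : d1 * _ = d1 * y - d1 * alg_restrict q y).
    by apply: coefB => //; apply: coefM.
  by rewrite {2}(alg_restrictC q y); ring.
Qed.

End CoefficientsAtPrime.

(** * Reconstruction of the weakly Krull property of D[S] *)

Section Converse.
Variables (D : idomainType) (S : tfMonoidType).
Let K := {fraction D}.
Let G := quotient_group S.
Implicit Types (f : {monalg D[S]}) (h : {monalg K[G]}).

Lemma both_morph_image h : (forall g, acoef h g != 0 -> exists s, g = toquot s) ->
    (forall g, exists c, acoef h g = FracField.tofrac c) ->
  exists f, @both_morph D S f = h.
Proof.
move=> hS hD; rewrite [h]alg_sum_monom big_seq.
apply: (big_ind (fun z => exists f, @both_morph D S f = z)).
- by exists 0; rewrite rmorph0.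
- by move=> _ _ [f <-] [g <-]; exists (f + g); rewrite rmorphD.
- move=> g; rewrite mem_asupp => /hS[s ->]; have [c ->] := hD (toquot s).
  by exists (monom c s); rewrite /= map_alg_monom.
Qed.

(** The height-one primes of D[S] are the D[P], the P[S] and the contractions from K[G].
    The contractions show that a quotient a / b lying in all localizations is an element
    of K[G]; then the D[P] put its exponents into S, and the P[S] its coefficients
    into D. *)
Lemma weakly_Krull_algebra : weakly_Krull_domain {monalg K[G]} ->
    weakly_Krull_monoid S -> monoid_UMT K S ->
    weakly_Krull_domain D -> domain_UMT D G ->
  weakly_Krull_domain {monalg D[S]}.
Proof.
move=> wKG wKS umtS wKD umtD.
have loc := both_localization D S; set iota := @both_morph D S in loc.
have hexp P : minimal_nonempty_primes S P -> height_one_primes {monalg D[S]} (exp_ext P).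
  move=> mP; rewrite -scalar_morph_exp_ext.
  apply: (loc_height_one (scalar_localization D S)).
  by rewrite umtS; left; exists P.
have hcoef P : height_one_primes D P -> height_one_primes {monalg D[S]} (coef_ext P).
  move=> hP; rewrite -exponent_morph_coef_ext; last exact: height_one_prime.
  apply: (loc_height_one (exponent_localization D S)).
  by rewrite umtD; left; exists P.
apply/weakly_KrullE; split=> [a b b0 ab|f f0 _]; last first.
  have [s fs] := alg_neq0 f0; set c := acoef f s in fs.
  have finS : finite_set [set P | minimal_nonempty_primes S P /\ P s].
    have [[t st]|sU] := pselect (exists t, s + t = 0); last first.
      by have [_ fin] := wKS; apply: fin.
    apply: (@sub_finite_set _ _ set0) => // P [[pP _ _] Ps].
    apply: (monoid_prime0 pP); rewrite -st; have [PI _ _] := pP; exact: PI.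
  have iotaf0 : iota f != 0 by apply: loc_neq0 loc _ f0.
  apply: (@sub_finite_set _ _ (((fun P => exp_ext P : set {monalg D[S]}) @`
      [set P | minimal_nonempty_primes S P /\ P s] `|`
    (fun P => coef_ext P : set {monalg D[S]}) @`
      [set P | height_one_primes D P /\ P c]) `|`
    (fun Q => iota @^-1` Q) @`
      [set Q | height_one_primes {monalg K[G]} Q /\ Q (iota f)])); last first.
    rewrite !finite_setU; split; first split.
    - exact: finite_image.
    - by apply/finite_image/weakly_Krull_finite.
    - by apply/finite_image/weakly_Krull_finite.
  move=> Q [hQ Qf]; have pQ := height_one_prime hQ.
  have [[d [t [d0 Qdt]]]|nQ] := pselect (exists d t, d != 0 /\ Q (monom d t)).
    left; have /(primeM pQ)[Qd|Qt] : Q (monom d 0 * monom 1 t).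
      by rewrite monomM mulr1 add0r.
      right; have [P hP QE] := height_one_constant hQ Qd d0; exists P => //.
      split=> //; move: Qf; rewrite QE => /coef_extE; apply.
      exact: height_one_prime.
    left; have [P mP QE] := height_one_monomial hQ Qt; exists P => //.
    by split=> //; move: Qf; rewrite QE => /exp_extE; apply.
  right; have [|Q' hQ' QE] := loc_height_one_extend loc hQ.
    by move=> _ [d [t [d0 _ ->]]] Qdt; apply: nQ; exists d, t.
  by exists Q' => //; split=> //; move: Qf; rewrite -QE.
have [h hE] : dvr (iota b) (iota a).
  have /weakly_KrullE[wKG1 _] := wKG; apply: wKG1 => [|Q hQ].
    by apply: loc_neq0 loc _ b0.
  have [d Qd bad] := ab _ (loc_height_one loc hQ).
  by exists (iota d) => //; rewrite -rmorphM; apply: dvr_rmorph.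
have hlocal Q : height_one_primes {monalg D[S]} Q ->
    exists2 d, ~ Q d & exists c, iota d * h = iota c.
  move=> /ab[d Qd [c adE]]; exists d => //; exists c.
  apply: (mulIf (loc_neq0 loc b0)); rewrite -rmorphM -adE rmorphM hE; ring.
have hS g : acoef h g != 0 -> exists s, g = toquot s.
  move=> hg; have [wKS1 _] := wKS.
  suff : range (@QuotientGroup.embed S) g by case=> s _ <-; exists s.
  rewrite wKS1 => P mP; have [d Qd [c dhE]] := hlocal _ (hexp P mP).
  apply: (exp_extE _ _).1 g hg.
  apply: (exponents_at_prime mP (d := iota d)) => [g' /map_alg_support//||].
    apply: contrapT => ns; apply: Qd; apply/exp_extE => s ds.
    apply: contrapT => Ps; apply: ns; exists s => //.
    by rewrite acoef_both_morph tofrac_eq0.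
  rewrite dhE; apply/exp_extE => g' /map_alg_support[s ->].
  exact: monoid_localization_embed.
have coefD f g : exists c, acoef (iota f) g = FracField.tofrac c.
  have [->|/map_alg_support[s ->]] := eqVneq (acoef (iota f) g) 0.
    by exists 0; rewrite tofrac0.
  by exists (acoef f s); rewrite -[RHS]acoef_both_morph.
have hD g : exists c, acoef h g = FracField.tofrac c.
  have [wKD1 _] := wKD.
  suff : range (@FracField.tofrac D) (acoef h g) by case=> c _ <-; exists c.
  rewrite wKD1 => P hP; have pP := height_one_prime hP.
  have [d Qd [c dhE]] := hlocal _ (hcoef P hP).
  apply: (coefficients_at_prime hP (d := iota d)) => [g'||g'].
  - exact: coefD.
  - apply: contrapT => ns; apply: Qd; apply/(coef_extE _ pP) => s.
    apply: contrapT => Ps; apply: ns; exists (toquot s), (acoef d s).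
    by split=> //; apply: acoef_both_morph.
  - have [e eE] := coefD c g'; rewrite dhE eE; exists e, 1.
    by split; [apply: prime1|rewrite tofrac1 divr1].
have [f fE] := both_morph_image hS hD.
exists f; apply: (loc_inj loc); rewrite rmorphM hE -fE.
by [].
Qed.

End Converse.

Theorem theorem3p7 (D : idomainType) (S : tfMonoidType) :
  acc_cyclic_subgroups (quotient_group S) ->
  (weakly_Krull_domain {monalg D[S]} <->
     (weakly_Krull_monoid S /\ monoid_UMT {fraction D} S) /\
     (weakly_Krull_domain D /\ domain_UMT D (quotient_group S))).
Proof.
move=> accG; split=> [wK|[[wKS umtS] [wKD umtD]]].
  split.
    apply: weakly_Krull_algebra_monoid.
    exact: weakly_Krull_localization (scalar_localization D S) wK.
  apply: weakly_Krull_algebra_domain.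
  exact: weakly_Krull_localization (exponent_localization D S) wK.
apply: weakly_Krull_algebra => //.
exact/ufd_weakly_Krull/group_algebra_ufd.
Qed.
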